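(* Let $\mathcal M$ be a symplectic Lie $2$-algebroid over a base manifold $M$. Then the corresponding Courant algebroid is defined as follows. Choose any splitting $\mathcal M\simeq Q[-1]\oplus T^*M[-2]$ of the underlying symplectic $[2]$-manifold. Then $Q\simeq Q^*$ via $\partial_Q$, and $Q$ inherits a nondegenerate pairing given by $\langle\partial_Q\tau_1,\partial_Q\tau_2\rangle_Q=\langle\tau_1,\partial_Q\tau_2\rangle$. The split Lie $2$-algebroid structure on $Q\oplus T^*M$ is dual to a Dorfman $2$-representation $(\partial_{TM},\Delta,\nabla,R)$ of $Q$ on $\partial_{TM}=-l_1^*:Q^*\to TM$. The map $\partial_{TM}\circ\partial_Q^{-1}:Q\to TM$ defines an anchor on $Q$, and the bracket $[\![\cdot,\cdot]\!]_Q$ defined on $\Gamma(Q)$ by $$[\![\partial_Q\tau_1,\partial_Q\tau_2]\!]_Q=\partial_Q\bigl(\Delta_{\partial_Q\tau_1}\tau_2-\{\partial_{TM}\tau_2,\tau_1\}\bigr),\qquad\tau_1,\tau_2\in\Gamma(Q^* ),$$ does not depend on the choice of the splitting. This anchor, pairing and bracket define a Courant algebroid structure on $Q$ (the Courant algebroid corresponding to $\mathcal M$).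
   Context: **Symplectic Lie $2$-algebroids.** A $[2]$-manifold $\mathcal M$ is a smooth manifold $M$ with a sheaf $C^\infty(\mathcal M)$ of $\mathbb N$-graded commutative unital $\mathbb R$-algebras with degree $0$ part $C^\infty(M)$, locally freely generated by generators of degrees $1$ and $2$. A Poisson Lie $2$-algebroid is a $[2]$-manifold with a degree $1$ derivation $\mathcal Q$, $\mathcal Q^2=0$, and a Poisson bracket of degree $-2$ ($|\{\xi,\eta\}|=|\xi|+|\eta|-2$, $\{\xi,\eta\}=-(-1)^{|\xi||\eta|}\{\eta,\xi\}$, $\{\xi_1,\xi_2\xi_3\}=\{\xi_1,\xi_2\}\xi_3+(-1)^{|\xi_1||\xi_2|}\xi_2\{\xi_1,\xi_3\}$, $\{\xi_1,\{\xi_2,\xi_3\}\}=\{\{\xi_1,\xi_2\},\xi_3\}+(-1)^{|\xi_1||\xi_2|}\{\xi_2,\{\xi_1,\xi_3\}\}$) such that $\mathcal Q\{\xi_1,\xi_2\}=\{\mathcal Q\xi_1,\xi_2\}+(-1)^{|\xi_1|}\{\xi_1,\mathcal Q\xi_2\}$. It is a symplectic Lie $2$-algebroid if in addition the derivations $\{\xi,\cdot\}$ generate $\mathrm{Der}(C^\infty(\mathcal M))$ as a $C^\infty(\mathcal M)$-module. **Splittings.** A split $[2]$-manifold $Q[-1]\oplus B^*[-2]$ has functions generated over $C^\infty(M)$ by $\Gamma(Q^* )$ (degree $1$) and $\Gamma(B)$ (degree $2$); every $[2]$-manifold is non-canonically isomorphic to one ($Q$ and $B$ are canonical, the embedding of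 $\Gamma(B)$ in degree $2$ functions is not). In a splitting the Poisson bracket is $\{\tau_1,\tau_2\}=\langle\tau_2,\partial_Q\tau_1\rangle$, $\{b,f\}=\rho_B(b)f$, $\{b,\tau\}=\nabla^{Q^*}_b\tau$, $\{b_1,b_2\}=[b_1,b_2]-R_B(b_1,b_2)$, for a Lie algebroid structure on $B$ and a self-dual $2$-representation on $\partial_Q=\partial_Q^*:Q^*\to Q$. In the symplectic case $\rho_B:B\to TM$ and $\partial_Q$ are isomorphisms, and $B$ is identified with $TM$ by $\rho_B$. **Lie $2$-algebroid in a splitting.** $\mathcal Q$ on $Q[-1]\oplus B^*[-2]$ is locally (coordinates $x_j$, dual frames $(q_i),(\tau_i)$ of $Q,Q^*$ and $(\beta_j),(b_j)$ of $B^*,B$) $$\mathcal Q=\sum\rho_Q(q_i)(x_j)\tau_i\partial_{x_j}-\sum_{i<j,k}\langle[\![q_i,q_j]\!]_\Delta,\tau_k\rangle\tau_i\tau_j\partial_{\tau_k}+\sum\langle\partial_B^*\beta_r,\tau_k\rangle b_r\partial_{\tau_k}-\sum_{i<j<k,l}\omega_R(q_i,q_j,q_k)(b_l)\tau_i\tau_j\tau_k\partial_{b_l}-\sum\langle\nabla^*_{q_i}\beta_j,b_l\rangle\tau_ib_j\partial_{b_l}.$$ Here $\rho_Q:Q\to TM$; $\partial_B=-l_1^*:Q^*\to B$ with $l_1:B^*\to Q$; $\Delta:\Gamma(Q)\times\Gamma(Q^* )\to\Gamma(Q^* )$ is the map dual to the skew-symmetric bracket $[\![\cdot,\cdot]\!]_\Delta$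 on $\Gamma(Q)$: $\langle q_2,\Delta_{q_1}\tau\rangle=\rho_Q(q_1)\langle q_2,\tau\rangle-\langle[\![q_1,q_2]\!]_\Delta,\tau\rangle$; $\nabla$ is a linear $Q$-connection on $B$; $\omega_R\in\Omega^3(Q,B^* )$, $\omega_R(q_1,q_2,q_3)=R(q_1,q_2)^*q_3$. The quadruple $(\partial_B,\Delta,\nabla,R)$ is the Dorfman $2$-representation dual to the split Lie $2$-algebroid. With $B=TM$ we write $\partial_{TM}$ for $\partial_B$. **Courant algebroid**: vector bundle with nondegenerate symmetric pairing, anchor $\rho$ and $\mathbb R$-bilinear bracket with $[\![e_1,[\![e_2,e_3]\!]]\!]=[\![[\![e_1,e_2]\!],e_3]\!]+[\![e_2,[\![e_1,e_3]\!]]\!]$, $\rho(e_1)\langle e_2,e_3\rangle=\langle[\![e_1,e_2]\!],e_3\rangle+\langle e_2,[\![e_1,e_3]\!]\rangle$, $[\![e_1,e_2]\!]+[\![e_2,e_1]\!]=\mathcal D\langle e_1,e_2\rangle$, $\langle\mathcal Df,e\rangle=\rho(e)f$. **Corresponding Courant algebroid (Roytenberg).** The Courant algebroid whose sections are the degree $1$ functions $\tau\in\Gamma(Q^* )$ of $\mathcal M$ (identified with $\Gamma(Q)$ via $\partial_Q$), with pairing $\{\tau_1,\tau_2\}$, anchor $f\mapsto\{\mathcal Q\tau,f\}$ and derived bracket $\{\mathcal Q\tau_1,\tau_2\}$. *)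

(* Defs.v *)
From HB Require Import structures.
From mathcomp Require Import all_boot all_order all_algebra.
From mathcomp Require Import all_classical all_reals all_analysis.

Set Implicit Arguments.
Unset Strict Implicit.
Unset Printing Implicit Defensive.
Import Order.TTheory GRing.Theory Num.Theory.
Import numFieldNormedType.Exports.

Local Open Scope classical_set_scope.
Local Open Scope ring_scope.

Section Euclidean.
Variables (R : realType) (n : nat).

(* [W] is meant to be open. *)
Fixpoint Ck (k : nat) (W : set 'rV[R]_n) (g : 'rV[R]_n -> R) : Prop :=
  (forall y, W y -> {for y, continuous g}) /\
  if k is k'.+1 then
    forall i : 'I_n,
      (forall y, W y -> derivable g y (delta_mx 0 i)) /\
      Ck k' W (fun y => 'D_(delta_mx 0 i) g y)
  else True.

Definition Cinfty (W : set 'rV[R]_n) (g : 'rV[R]_n -> R) := forall k, Ck k W g.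

(* [cmap] and [cinv] are total; only their values on [cdom] and [cimg] matter. *)
Record chart (M : topologicalType) := Chart {
  cdom : set M;
  cimg : set 'rV[R]_n;
  cmap : M -> 'rV[R]_n;
  cinv : 'rV[R]_n -> M;
  cdom_open : open cdom;
  cimg_open : open cimg;
  cmap_img : forall x, cdom x -> cimg (cmap x);
  cinv_dom : forall y, cimg y -> cdom (cinv y);
  cmapK : forall x, cdom x -> cinv (cmap x) = x;
  cinvK : forall y, cimg y -> cmap (cinv y) = y;
  cmap_continuous : forall x, cdom x -> {for x, continuous cmap};
  cinv_continuous : forall y, cimg y -> {for y, continuous cinv} }.

Record manifold := Manifold {
  carrier :> topologicalType;
  atlas : set (chart carrier);
  manifold_hausdorff : hausdorff_space carrier;
  manifold_second_countable : @second_countable carrier;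
  atlas_cover : forall x, exists2 c, atlas c & cdom c x;
  atlas_smooth : forall c d, atlas c -> atlas d -> forall j,
    Cinfty [set y | cimg c y /\ cdom d (cinv c y)]
           (fun y => cmap d (cinv c y) 0 j) }.

End Euclidean.

Section Manifold.
Variables (R : realType) (n : nat) (M : manifold R n).

(* "[f] restricted to the open set [U] is smooth" *)
Definition smooth_on (U : set M) (f : M -> R) : Prop :=
  forall c, atlas c ->
    Cinfty [set y | cimg c y /\ U (cinv c y)] (fun y => f (cinv c y)).

Definition smooth_at (p : M) (f : M -> R) : Prop :=
  exists U, [/\ open U, U p & smooth_on U f].

Definition eq_on (T : M -> Type) (U : set M) (s t : forall x, T x) : Prop :=
  forall x, U x -> s x = t x.

(* A tangent vector at [p] is a derivation at [p] on germs of smooth functions;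
   the last clause only normalizes the value on functions that are not smooth
   near [p], so that equality of tangent vectors is Leibniz equality. *)

Definition derivation_at (p : M) (v : (M -> R) -> R^o) : Prop :=
  [/\ forall U f g, open U -> U p -> smooth_on U f ->
        eq_on (T := fun _ => R) U f g -> v f = v g,
      forall a f g, smooth_at p f -> smooth_at p g ->
        v (fun x => a * f x + g x) = a * v f + v g,
      forall f g, smooth_at p f -> smooth_at p g ->
        v (fun x => f x * g x) = f p * v g + g p * v f
    & forall f, ~ smooth_at p f -> v f = 0].

Definition derivation_pred (p : M) : {pred (M -> R) -> R^o} :=
  fun v => `[< derivation_at p v >].

Lemma derivation_submod_closed p : submod_closed (derivation_pred p).
Proof.
split.
  apply/asboolP; split=> //= *; first by rewrite mulr0 addr0.
  by rewrite !mulr0 addr0.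
move=> a u v /asboolP [u1 u2 u3 u4] /asboolP [v1 v2 v3 v4].
apply/asboolP; split.
- move=> U f g oU Up sf e; rewrite !fctE.
  by rewrite (u1 U f g) // (v1 U f g).
- move=> b f g sf sg; rewrite !fctE u2 // v2 //.
  rewrite /GRing.scale /= !mulrDr !addrA; congr (_ + _).
  rewrite -!addrA; congr (_ + _); first by rewrite mulrCA.
  by rewrite addrC.
- move=> f g sf sg; rewrite !fctE u3 // v3 //.
  rewrite /GRing.scale /= !mulrDr.
  rewrite [a * (f p * _)]mulrCA [a * (g p * _)]mulrCA -!addrA; congr (_ + _).
  by rewrite addrCA.
- by move=> f nf; rewrite !fctE u4 // v4 // scaler0 addr0.
Qed.

HB.instance Definition _ p :=
  GRing.isSubmodClosed.Build R _ (derivation_pred p) (derivation_submod_closed p).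

Record tangent (p : M) := Tangent {
  tval :> (M -> R) -> R^o;
  tvalP : tval \in derivation_pred p }.

HB.instance Definition _ p := [isSub for @tval p].
HB.instance Definition _ p := [Choice of tangent p by <:].
HB.instance Definition _ p := [SubChoice_isSubLmodule of tangent p by <:].

End Manifold.

Section Dual.
Variables (R : realType) (V : lmodType R).

Definition functional_pred : {pred V -> R^o} :=
  fun phi => `[< forall a u v, phi (a *: u + v) = a * phi u + phi v >].

Lemma functional_submod_closed : submod_closed functional_pred.
Proof.
split; first by apply/asboolP => a u v /=; rewrite mulr0 addr0.
move=> a f g /asboolP lf /asboolP lg; apply/asboolP => b u v.
rewrite !fctE lf lg /GRing.scale /= !mulrDr -!addrA; congr (_ + _).
  by rewrite mulrCA.
by rewrite addrCA.
Qed.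

HB.instance Definition _ :=
  GRing.isSubmodClosed.Build R _ functional_pred functional_submod_closed.

Record dual := Dual {
  dval :> V -> R^o;
  dvalP : dval \in functional_pred }.

HB.instance Definition _ := [isSub for dval].
HB.instance Definition _ := [Choice of dual by <:].
HB.instance Definition _ := [SubChoice_isSubLmodule of dual by <:].

End Dual.

Section Bundles.
Variables (R : realType) (n : nat) (M : manifold R n).

(* Fibres together with the smooth local sections.  A section over an open set
   [U] is represented by a total section, of which only the values on [U]
   matter. *)
Record prebundle := Prebundle {
  fiber :> M -> lmodType R;
  smooth : set M -> (forall x, fiber x) -> Prop }.

Definition sect (E : prebundle) := forall x : M, E x.

Definition frame (E : prebundle) (U : set M) r (e : 'I_r -> sect E) : Prop :=
  (forall x, U x -> forall v : E x,
     exists! c : 'rV[R]_r, v = \sum_(i < r) c 0 i *: e i x) /\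
  (forall V, open V -> V `<=` U -> forall s : sect E,
     smooth V s <->
     exists2 g : 'I_r -> M -> R, forall i, smooth_on V (g i) &
       forall x, V x -> s x = \sum_(i < r) g i x *: e i x).

Definition is_vbundle (E : prebundle) : Prop :=
  [/\ forall U (s t : sect E), open U -> smooth U s -> eq_on U s t -> smooth U t,
      forall U V (s : sect E), open U -> open V -> V `<=` U ->
        smooth U s -> smooth V s,
      forall U (s : sect E), open U ->
        (forall x, U x -> exists V, [/\ open V, V x, V `<=` U & smooth V s]) ->
        smooth U s
    & forall x : M, exists U r (e : 'I_r -> sect E),
        [/\ open U, U x & frame U e]].

Record vbundle := VBundle { vb :> prebundle; vbP : is_vbundle vb }.

Definition dual_bundle (E : prebundle) : prebundle :=
  @Prebundle (fun x => dual (E x)) (fun U a =>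
    forall V (s : sect E), open V -> V `<=` U -> smooth V s ->
      smooth_on V (fun x => a x (s x))).

Definition TM : prebundle :=
  @Prebundle (fun x => tangent x) (fun U X =>
    forall V f, open V -> V `<=` U -> smooth_on V f ->
      smooth_on V (fun x => X x f)).

Definition TstarM : prebundle := dual_bundle TM.

Definition lie (X : sect TM) (f : M -> R) : M -> R := fun x => X x f.

Definition pairing (E : prebundle) (a : sect (dual_bundle E)) (s : sect E) :
  M -> R := fun x => a x (s x).

Definition sadd (E : prebundle) (s t : sect E) : sect E := fun x => s x + t x.
Definition smul (E : prebundle) (f : M -> R) (s : sect E) : sect E :=
  fun x => f x *: s x.

Record bhom (E F : prebundle) := BHom {
  bmap :> forall x, {linear E x -> F x};
  bmap_smooth : forall U (s : sect E), open U -> smooth U s ->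
    smooth (p := F) U (fun x => bmap x (s x)) }.

Definition app (E F : prebundle) (phi : bhom E F) (s : sect E) : sect F :=
  fun x => phi x (s x).

Definition is_biso (E F : prebundle) (phi : bhom E F) : Prop :=
  exists psi : bhom F E,
    forall x, cancel (phi x) (psi x) /\ cancel (psi x) (phi x).

(* For every open [U], [op] induces a map Gamma(U,E) x Gamma(U,F) -> Gamma(U,G), compatibly with
   restrictions. *)
Definition local_op (E F G : prebundle) (op : sect E -> sect F -> sect G) :=
  forall U s s' t t', open U -> smooth U s -> smooth U t ->
    eq_on U s s' -> eq_on U t t' ->
    smooth U (op s t) /\ eq_on U (op s t) (op s' t').

Definition biadditive (E F G : prebundle) (op : sect E -> sect F -> sect G) :=
  forall U, open U ->
    (forall s s' t, smooth U s -> smooth U s' -> smooth U t ->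
       eq_on U (op (sadd s s') t) (sadd (op s t) (op s' t))) /\
    (forall s t t', smooth U s -> smooth U t -> smooth U t' ->
       eq_on U (op s (sadd t t')) (sadd (op s t) (op s t'))).

Definition Rbilinear (E F G : prebundle) (op : sect E -> sect F -> sect G) :=
  biadditive op /\
  forall U (a : R) s t, open U -> smooth U s -> smooth U t ->
    eq_on U (op (smul (fun=> a) s) t) (smul (fun=> a) (op s t)) /\
    eq_on U (op s (smul (fun=> a) t)) (smul (fun=> a) (op s t)).

Definition is_connection (Q E : prebundle) (rho : bhom Q TM)
    (nab : sect Q -> sect E -> sect E) : Prop :=
  [/\ local_op nab, biadditive nab,
      forall U f q e, open U -> smooth_on U f -> smooth U q -> smooth U e ->
        eq_on U (nab (smul f q) e) (smul f (nab q e))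
    & forall U f q e, open U -> smooth_on U f -> smooth U q -> smooth U e ->
        eq_on U (nab q (smul f e))
                (sadd (smul f (nab q e)) (smul (lie (app rho q) f) e))].

Record courant (E : prebundle) := Courant {
  cpair : forall x, E x -> E x -> R;
  canchor : bhom E TM;
  cbr : sect E -> sect E -> sect E }.

Definition cpairs (E : prebundle) (C : courant E) (s t : sect E) : M -> R :=
  fun x => cpair C (s x) (t x).

Record is_courant (E : prebundle) (C : courant E) : Prop := IsCourant {
  cpair_linear : forall x a (u v w : E x),
    cpair C (a *: u + v) w = a * cpair C u w + cpair C v w;
  cpair_sym : forall x (u v : E x), cpair C u v = cpair C v u;
  cpair_nondeg : forall x (u : E x), (forall v, cpair C u v = 0) -> u = 0;
  cpair_smooth : forall U s t, open U -> smooth U s -> smooth U t ->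
    smooth_on U (cpairs C s t);
  cbr_local : local_op (cbr C);
  cbr_bilinear : Rbilinear (cbr C);
  cbr_jacobi : forall U e1 e2 e3, open U ->
    smooth U e1 -> smooth U e2 -> smooth U e3 ->
    eq_on U (cbr C e1 (cbr C e2 e3))
            (sadd (cbr C (cbr C e1 e2) e3) (cbr C e2 (cbr C e1 e3)));
  cbr_invariant : forall U e1 e2 e3, open U ->
    smooth U e1 -> smooth U e2 -> smooth U e3 ->
    eq_on (T := fun=> R) U
      (lie (app (canchor C) e1) (cpairs C e2 e3))
      (fun x => cpairs C (cbr C e1 e2) e3 x + cpairs C e2 (cbr C e1 e3) x);
  cbr_symmetric_part : exists DD : (M -> R) -> sect E,
    (forall U f, open U -> smooth_on U f ->
       smooth U (DD f) /\
       forall x, U x -> forall v : E x,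
         cpair C (DD f x) v = (canchor C x v : tangent x) f) /\
    (forall U e1 e2, open U -> smooth U e1 -> smooth U e2 ->
       eq_on U (sadd (cbr C e1 e2) (cbr C e2 e1)) (DD (cpairs C e1 e2))) }.

Record courant_iso (E F : prebundle) (phi : bhom E F)
    (C : courant E) (C' : courant F) : Prop := CourantIso {
  iso_bijective : is_biso phi;
  iso_pair : forall x (u v : E x),
    cpair C' (phi x u) (phi x v) = cpair C u v;
  iso_anchor : forall x (u : E x), canchor C' x (phi x u) = canchor C x u;
  iso_bracket : forall U s t, open U -> smooth U s -> smooth U t ->
    eq_on U (app phi (cbr C s t)) (cbr C' (app phi s) (app phi t)) }.

End Bundles.

Section TwoManifolds.
Variables (R : realType) (n : nat) (M : manifold R n).

(* Sheaf of N-graded commutative algebras whose degree 0 part is the sheaf of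
   smooth functions.  All axioms are about open sets.  [emb U] restricts to an
   isomorphism from the smooth functions on [U] onto the degree 0 part of
   [fn U]; it also provides the R-algebra structure of [fn U].  Gluing is only
   asked for homogeneous elements, since the direct sum of the degrees need not
   be a sheaf. *)
Record graded_sheaf := GradedSheaf {
  fn : set M -> pzRingType;
  hom : forall U, nat -> set (fn U);
  res : forall U V, V `<=` U -> {rmorphism fn U -> fn V};
  emb : forall U, (M -> R) -> fn U;

  res_id : forall U (h : U `<=` U) a, open U -> res h a = a;
  res_comp : forall U V W (h : V `<=` U) (k : W `<=` V) (l : W `<=` U) a,
    open U -> open V -> open W -> res k (res h a) = res l a;
  res_hom : forall U V (h : V `<=` U) k a, open U -> open V ->
    hom k a -> hom k (res h a);

  hom0 : forall U k, open U -> hom k (0 : fn U);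
  homB : forall U k (a b : fn U), open U -> hom k a -> hom k b -> hom k (a - b);
  homM : forall U k l (a b : fn U), open U ->
    hom k a -> hom l b -> hom (k + l) (a * b);
  fn_comm : forall U k l (a b : fn U), open U -> hom k a -> hom l b ->
    a * b = (-1) ^+ (k * l) * (b * a);
  hom_generate : forall U (a : fn U), open U ->
    exists N (c : nat -> fn U),
      (forall k, hom k (c k)) /\ a = \sum_(k < N) c k;
  hom_direct : forall U N (c : nat -> fn U), open U ->
    (forall k, hom k (c k)) -> \sum_(k < N) c k = 0 ->
    forall k, (k < N)%N -> c k = 0;

  emb_hom : forall U (a : fn U), open U ->
    hom 0 a <-> exists2 f, smooth_on U f & a = emb U f;
  emb_eq : forall U f g, open U -> smooth_on U f -> smooth_on U g ->
    emb U f = emb U g <-> eq_on (T := fun=> R) U f g;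
  embD : forall U f g, open U -> smooth_on U f -> smooth_on U g ->
    emb U (fun x => f x + g x) = emb U f + emb U g;
  embM : forall U f g, open U -> smooth_on U f -> smooth_on U g ->
    emb U (fun x => f x * g x) = emb U f * emb U g;
  emb1 : forall U, open U -> emb U (fun=> 1) = 1;
  emb_res : forall U V (h : V `<=` U) f, open U -> open V -> smooth_on U f ->
    res h (emb U f) = emb V f;

  sheaf_separated : forall U k (a : fn U), open U -> hom k a ->
    (forall x, U x -> exists V (h : V `<=` U),
       [/\ open V, V x & res h a = 0]) -> a = 0;
  sheaf_glue : forall U k (I : Type) (V : I -> set M) (h : forall i, V i `<=` U)
      (c : forall i, fn (V i)),
    open U -> (forall i, open (V i)) ->
    (forall x, U x -> exists i, V i x) ->
    (forall i, hom k (c i)) ->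
    (forall i j (hi : V i `&` V j `<=` V i) (hj : V i `&` V j `<=` V j),
       res hi (c i) = res hj (c j)) ->
    exists2 a : fn U, hom k a & forall i, res (h i) a = c i }.

Arguments res {_ _ _} _.

Variable A : graded_sheaf.

(* Exponents of the degree [k] part of the free graded commutative algebra on
   [r1] generators of degree 1 and [r2] generators of degree 2: a set of odd
   generators and a multi-index (with entries at most [k]) of even ones. *)
Definition expo (r1 r2 k : nat) : Type :=
  ({set 'I_r1} * {ffun 'I_r2 -> 'I_k.+1})%type.

Definition expo_deg r1 r2 k (p : {set 'I_r1} * {ffun 'I_r2 -> 'I_k.+1}) : nat :=
  (#|p.1| + 2 * \sum_j (p.2 j : nat))%N.

Definition monomial U r1 r2 (xi : 'I_r1 -> fn A U) (eta : 'I_r2 -> fn A U) k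
    (p : {set 'I_r1} * {ffun 'I_r2 -> 'I_k.+1}) : fn A U :=
  (\prod_(i < r1 | i \in p.1) xi i) * \prod_(j < r2) eta j ^+ p.2 j.

(* [xi] and [eta] freely generate the restriction of [A] to [U]. *)
Definition freely_generate U r1 r2
    (xi : 'I_r1 -> fn A U) (eta : 'I_r2 -> fn A U) : Prop :=
  [/\ forall i, hom 1 (xi i), forall j, hom 2 (eta j) &
   forall V (h : V `<=` U), open V -> forall k : nat,
     let mono := monomial (fun i => res h (xi i)) (fun j => res h (eta j)) in
     (forall a : fn A V, hom k a ->
        exists2 c, forall p, smooth_on V (c p) &
          a = \sum_(p | expo_deg p == k) emb A V (c p) * mono k p) /\
     (forall c, (forall p, smooth_on V (c p)) ->
        \sum_(p | expo_deg p == k) emb A V (c p) * mono k p = 0 ->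
        forall p x, expo_deg p = k -> V x -> c p x = 0)].

Definition is_two_manifold : Prop :=
  forall x : M, exists U r1 r2 (xi : 'I_r1 -> fn A U) (eta : 'I_r2 -> fn A U),
    [/\ open U, U x & freely_generate xi eta].

(* [A] is zero in negative degrees. *)
Definition homz U (m : int) (a : fn A U) : Prop :=
  match m with Posz k => hom k a | Negz _ => a = 0 end.

(* [D V] is meant for open [V] contained in [U]. *)
Definition is_derivation (U : set M) (m : int)
    (D : forall V, fn A V -> fn A V) : Prop :=
  [/\ forall V, open V -> V `<=` U -> forall a b : fn A V,
        D V (a + b) = D V a + D V b,
      forall V, open V -> V `<=` U -> forall (t : R) (a : fn A V),
        D V (emb A V (fun=> t) * a) = emb A V (fun=> t) * D V a,
      forall V W (h : W `<=` V) (a : fn A V), open V -> open W -> V `<=` U ->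
        res h (D V a) = D W (res h a),
      forall V k (a : fn A V), open V -> V `<=` U ->
        hom k a -> homz (k%:Z + m) (D V a)
    & forall V k (a b : fn A V), open V -> V `<=` U -> hom k a ->
        D V (a * b) = D V a * b + (-1) ^+ (`|m|%N * k) * (a * D V b)].

Definition is_poisson (br : forall U, fn A U -> fn A U -> fn A U) : Prop :=
  [/\ (forall U, open U -> forall a b c : fn A U,
         br U (a + b) c = br U a c + br U b c /\
         br U a (b + c) = br U a b + br U a c) /\
      (forall U, open U -> forall (t : R) (a b : fn A U),
         br U (emb A U (fun=> t) * a) b = emb A U (fun=> t) * br U a b /\
         br U a (emb A U (fun=> t) * b) = emb A U (fun=> t) * br U a b) /\
      (forall U V (h : V `<=` U) (a b : fn A U), open U -> open V ->
         res h (br U a b) = br V (res h a) (res h b)),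
      forall U k l (a b : fn A U), open U -> hom k a -> hom l b ->
        homz (k%:Z + l%:Z - 2) (br U a b),
      forall U k l (a b : fn A U), open U -> hom k a -> hom l b ->
        br U a b = - ((-1) ^+ (k * l) * br U b a),
      forall U k l (a b c : fn A U), open U -> hom k a -> hom l b ->
        br U a (b * c) = br U a b * c + (-1) ^+ (k * l) * (b * br U a c)
    & forall U k l (a b c : fn A U), open U -> hom k a -> hom l b ->
        br U a (br U b c) =
        br U (br U a b) c + (-1) ^+ (k * l) * br U b (br U a c)].

(* The derivations {xi, -} generate the sheaf of modules Der(A): every
   derivation is locally a combination of finitely many of them. *)
Definition is_symplectic (br : forall U, fn A U -> fn A U -> fn A U) : Prop :=
  forall U m D, open U -> is_derivation U m D ->
  forall x, U x -> exists V r (a xi : 'I_r -> fn A V),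
    [/\ open V, V x, V `<=` U &
     forall W (h : W `<=` V) (b : fn A W), open W ->
       D W b = \sum_(i < r) res h (a i) * br W (res h (xi i)) b].

End TwoManifolds.

Arguments res {R n M _ U V} _.

Record symplectic_lie2 (R : realType) (n : nat) (M : manifold R n) :=
  SymplecticLie2 {
  sheaf :> graded_sheaf M;
  homological : forall U, fn sheaf U -> fn sheaf U;
  poisson : forall U, fn sheaf U -> fn sheaf U -> fn sheaf U;
  sheaf_two_manifold : is_two_manifold sheaf;
  homological_derivation : is_derivation setT 1 homological;
  homological_square : forall U (a : fn sheaf U), open U ->
    homological (homological a) = 0;
  poissonP : is_poisson poisson;
  homological_poisson : forall U k (a b : fn sheaf U), open U -> hom k a ->
    homological (poisson a b) =
    poisson (homological a) b + (-1) ^+ k * poisson a (homological b);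
  poisson_symplectic : is_symplectic poisson }.

Section Splittings.
Variables (R : realType) (n : nat) (M : manifold R n) (S : symplectic_lie2 M).

Local Notation emb := (emb S).
Local Notation "{{ a , b }}" := (poisson (s := S) a b).
Local Notation QQ := (homological (s := S)).

(* An isomorphism from the split symplectic [2]-manifold Q[-1] (+) T^*M[-2] to
   [S], given by its restrictions to the generators: [i1] on sections of Q^*
   (degree 1) and [i2] on sections of TM (degree 2).  [i2_anchor] says that
   B = TM is identified with TM through rho_B. *)
Record splitting (Q : vbundle M) := Splitting {
  i1 : forall U, sect (dual_bundle Q) -> fn S U;
  i2 : forall U, sect (TM M) -> fn S U;
  i1_hom : forall U t, open U -> smooth U t -> hom 1 (i1 U t);
  i2_hom : forall U X, open U -> smooth U X -> hom 2 (i2 U X);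
  i1_eq : forall U (s t : sect (dual_bundle Q)), open U -> smooth U s -> smooth U t ->
    eq_on U s t -> i1 U s = i1 U t;
  i2_eq : forall U (X Y : sect (TM M)), open U -> smooth U X -> smooth U Y ->
    eq_on U X Y -> i2 U X = i2 U Y;
  i1D : forall U s t, open U -> smooth U s -> smooth U t ->
    i1 U (sadd s t) = i1 U s + i1 U t;
  i2D : forall U X Y, open U -> smooth U X -> smooth U Y ->
    i2 U (sadd X Y) = i2 U X + i2 U Y;
  i1Z : forall U f t, open U -> smooth_on U f -> smooth U t ->
    i1 U (smul f t) = emb U f * i1 U t;
  i2Z : forall U f X, open U -> smooth_on U f -> smooth U X ->
    i2 U (smul f X) = emb U f * i2 U X;
  i1_res : forall U V (h : V `<=` U) t, open U -> open V -> smooth U t ->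
    res h (i1 U t) = i1 V t;
  i2_res : forall U V (h : V `<=` U) X, open U -> open V -> smooth U X ->
    res h (i2 U X) = i2 V X;
  split_generate : forall x : M, exists U r1 r2
      (t : 'I_r1 -> sect (dual_bundle Q)) (b : 'I_r2 -> sect (TM M)),
    [/\ open U, U x, frame U t, frame U b &
        freely_generate (fun i => i1 U (t i)) (fun j => i2 U (b j))];
  i2_anchor : forall U X f, open U -> smooth U X -> smooth_on U f ->
    {{ i2 U X, emb U f }} = emb U (lie X f) }.

Section Components.
Variables (Q : vbundle M) (sg : splitting Q).
Local Notation Qs := (dual_bundle Q).
Local Notation i1 := (i1 sg).
Local Notation i2 := (i2 sg).

(* the component d_Q : Q^* -> Q of the Poisson bracket *)
Definition is_dQ (dQ : bhom Qs Q) : Prop :=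
  forall U t1 t2, open U -> smooth U t1 -> smooth U t2 ->
    {{ i1 U t1, i1 U t2 }} = emb U (pairing t2 (app dQ t1)).

(* Structure maps of a split Lie 2-algebroid on Q (+) T^*M; [nabs] is the
   Q-connection nabla^* on B^* = T^*M. *)
Record split_lie2 := SplitLie2 {
  l1 : bhom (TstarM M) Q;
  rhoQ : bhom Q (TM M);
  dull : sect Q -> sect Q -> sect Q;
  nabs : sect Q -> sect (TstarM M) -> sect (TstarM M);
  omega : forall x, Q x -> Q x -> Q x -> dual (tangent x) }.

Definition omegas (L : split_lie2) (q1 q2 q3 : sect Q) : sect (TstarM M) :=
  fun x => omega L (q1 x) (q2 x) (q3 x).

Record is_split_lie2 (L : split_lie2) : Prop := IsSplitLie2 {
  dull_local : local_op (dull L);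
  dull_bilinear : Rbilinear (dull L);
  dull_skew : forall U p q, open U -> smooth U p -> smooth U q ->
    eq_on U (dull L p q) (smul (fun=> -1) (dull L q p));
  dull_leibniz : forall U f p q, open U -> smooth_on U f ->
    smooth U p -> smooth U q ->
    eq_on U (dull L p (smul f q))
            (sadd (smul f (dull L p q)) (smul (lie (app (rhoQ L) p) f) q));
  nabs_connection : is_connection (rhoQ L) (nabs L);
  omega_linear : forall x a (u v w z : Q x),
    omega L (a *: u + v) w z = a *: omega L u w z + omega L v w z;
  omega_skew12 : forall x (u v w : Q x), omega L u v w = - omega L v u w;
  omega_skew23 : forall x (u v w : Q x), omega L u v w = - omega L u w v;
  omega_smooth : forall U q1 q2 q3, open U ->
    smooth U q1 -> smooth U q2 -> smooth U q3 -> smooth U (omegas L q1 q2 q3) }.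

(* The components of the homological vector field: its values on functions and
   on local frames ([q], [t] dual frames of Q, Q^*; [b], [beta] dual frames of
   TM, T^*M), with d_B^* = - l_1. *)
Definition lie2_expression (L : split_lie2) : Prop :=
  forall U r1 r2 (q : 'I_r1 -> sect Q) (t : 'I_r1 -> sect Qs)
      (b : 'I_r2 -> sect (TM M)) (beta : 'I_r2 -> sect (TstarM M)),
  open U -> frame U q -> frame U b ->
  (forall i, smooth U (t i)) -> (forall j, smooth U (beta j)) ->
  (forall x i j, U x -> pairing (t i) (q j) x = (i == j)%:R) ->
  (forall x i j, U x -> pairing (beta i) (b j) x = (i == j)%:R) ->
  [/\ forall f, smooth_on U f ->
        QQ (emb U f) =
        \sum_(i < r1) emb U (lie (app (rhoQ L) (q i)) f) * i1 U (t i),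
      forall k, QQ (i1 U (t k)) =
        - (\sum_(i < r1) \sum_(j < r1 | (i < j)%N)
             emb U (pairing (t k) (dull L (q i) (q j)))
             * (i1 U (t i) * i1 U (t j)))
        + \sum_(r < r2)
             emb U (fun x => - pairing (t k) (app (l1 L) (beta r)) x)
             * i2 U (b r)
    & forall l, QQ (i2 U (b l)) =
        - (\sum_(i < r1) \sum_(j < r1 | (i < j)%N) \sum_(k < r1 | (j < k)%N)
             emb U (pairing (omegas L (q i) (q j) (q k)) (b l))
             * (i1 U (t i) * i1 U (t j) * i1 U (t k)))
        - \sum_(i < r1) \sum_(j < r2)
             emb U (pairing (nabs L (q i) (beta j)) (b l))
             * (i1 U (t i) * i2 U (b j))].

Record dorfman := Dorfman {
  dTM : bhom Qs (TM M);
  Delta : sect Q -> sect Qs -> sect Qs;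
  nab : sect Q -> sect (TM M) -> sect (TM M);
  curv : forall x, Q x -> Q x -> tangent x -> dual (Q x) }.

Record dorfman_dual (L : split_lie2) (D : dorfman) : Prop := DorfmanDual {
  dTM_dual : forall x (beta : dual (tangent x)) (t : dual (Q x)),
    beta (dTM D x t) = - t (l1 L x beta);
  Delta_local : local_op (Delta D);
  Delta_dual : forall U q1 q2 t, open U ->
    smooth U q1 -> smooth U q2 -> smooth U t ->
    eq_on (T := fun=> R) U (pairing (Delta D q1 t) q2)
      (fun x => lie (app (rhoQ L) q1) (pairing t q2) x
                - pairing t (dull L q1 q2) x);
  nab_connection : is_connection (rhoQ L) (nab D);
  nab_dual : forall U q beta X, open U ->
    smooth U q -> smooth U beta -> smooth U X ->
    eq_on (T := fun=> R) U (pairing (nabs L q beta) X)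
      (fun x => lie (app (rhoQ L) q) (pairing beta X) x
                - pairing beta (nab D q X) x);
  curv_linear : forall x a (u v w : Q x) X,
    curv D (a *: u + v) w X = a *: curv D u w X + curv D v w X;
  curv_linear3 : forall x a (u v : Q x) X Y,
    curv D u v (a *: X + Y) = a *: curv D u v X + curv D u v Y;
  curv_skew : forall x (u v : Q x) X, curv D u v X = - curv D v u X;
  curv_dual : forall x (u v w : Q x) (X : tangent x),
    omega L u v w X = curv D u v X w }.

Record splitting_data (dQ : bhom Qs Q) (L : split_lie2) (D : dorfman) : Prop :=
  SplittingData {
  data_dQ : is_dQ dQ;
  data_lie2 : is_split_lie2 L;
  data_expression : lie2_expression L;
  data_dorfman : dorfman_dual L D }.

(* The anchor, pairing and bracket on Q defined in the splitting [sg]; [s] is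
   the section of Q^* corresponding to the degree 1 function
   {d_TM t2, t1}. *)
Record courant_formulas (dQ : bhom Qs Q) (D : dorfman) (C : courant Q) : Prop :=
  CourantFormulas {
  formula_pair : forall x (t1 t2 : dual (Q x)),
    cpair C (dQ x t1) (dQ x t2) = t1 (dQ x t2);
  formula_anchor : forall x (t : dual (Q x)), canchor C x (dQ x t) = dTM D x t;
  formula_local : local_op (cbr C);
  formula_bracket : forall U t1 t2, open U -> smooth U t1 -> smooth U t2 ->
    exists s : sect Qs,
      [/\ smooth U s,
          i1 U s = {{ i2 U (app (dTM D) t2), i1 U t1 }}
        & eq_on U (cbr C (app dQ t1) (app dQ t2))
                  (app dQ (fun x => Delta D (app dQ t1) t2 x - s x))] }.

(* [C] is, through d_Q, the Courant algebroid on degree 1 functions with pairing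
   {t1, t2}, anchor f |-> {Q t, f} and derived bracket {Q t1, t2}. *)
Record corresponds (dQ : bhom Qs Q) (C : courant Q) : Prop := Corresponds {
  corresponds_pair : forall U t1 t2, open U -> smooth U t1 -> smooth U t2 ->
    emb U (cpairs C (app dQ t1) (app dQ t2)) = {{ i1 U t1, i1 U t2 }};
  corresponds_anchor : forall U t f, open U -> smooth U t -> smooth_on U f ->
    emb U (lie (app (canchor C) (app dQ t)) f) = {{ QQ (i1 U t), emb U f }};
  corresponds_bracket : forall U t1 t2, open U -> smooth U t1 -> smooth U t2 ->
    exists s : sect Qs,
      [/\ smooth U s, i1 U s = {{ QQ (i1 U t1), i1 U t2 }}
        & eq_on U (cbr C (app dQ t1) (app dQ t2)) (app dQ s)] }.

End Components.

(* Sections [q] of Q and [q'] of Q' over [U] that correspond to each other under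
   the isomorphism Q = Q' dual to the identification of Q^* and Q'^* with the
   degree 1 functions of [S]. *)
Definition same_section (Q Q' : vbundle M) (sg : splitting Q)
    (sg' : splitting Q') (U : set M) (q : sect Q) (q' : sect Q') : Prop :=
  forall V t t', open V -> V `<=` U ->
    smooth V t -> smooth V t' -> i1 sg V t = i1 sg' V t' ->
    eq_on (T := fun=> R) V (pairing t q) (pairing t' q').

End Splittings.

(* Main.v *)
(* In a symplectic [2]-manifold the Euler derivation, which multiplies a function of degree k
   by k, is locally a combination of Hamiltonian derivations.  Taking homogeneous components writes
   every function [a] of degree k as a combination, divided by k, of brackets with [a] of
   functions of degree at most 2.  Hence [dQ] is invertible, and a function of positive degree
   that Poisson-commutes with the functions of degrees 0 and 1 is zero.  Functions are
   therefore determined by iterated brackets with degree 1 functions, and all structure maps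
   are such brackets: with t, s_i in Gamma(Q^* ), X in Gamma(TM), q_i = dQ s_i and X_t = dTM t,
     X_t f          = {Q t, f},
     t([q_1, q_2])  = {{Q s_1, s_2}, t} - {{X_t, s_1}, s_2},
     nabla_{q_1} X  = the vector field component of {s_1, Q X},
     omega(q_1, q_2, q_3)(X) = - {s_3, {s_2, {s_1, Q X}}} + (terms in nabla_{q_i} X).
   Defined this way they satisfy the coordinate expression of Q; conversely that expression
   forces these formulas.  They give Delta_{q_1} t = {Q s_1, t} + {X_t, s_1}, so the bracket of
   the theorem is the derived bracket {Q s_1, s_2}, and the Courant algebroid axioms become the
   Jacobi identity and Q^2 = 0.  Degree 1 functions do not depend on the splitting, hence
   neither does the bracket. *)

Require Import Defs.
From HB Require Import structures.
From mathcomp Require Import all_boot all_order all_algebra.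
From mathcomp Require Import all_classical all_reals all_analysis.
From mathcomp Require Import ring lra zify.

Set Implicit Arguments.
Unset Strict Implicit.
Unset Printing Implicit Defensive.
Import Order.TTheory GRing.Theory Num.Theory.
Import numFieldNormedType.Exports.
(* Again, lest [hom] denote that of [vector]. *)
Import Defs.

Local Open Scope classical_set_scope.
Local Open Scope ring_scope.

(** No bump functions are used, and sections are total functions of which only the values on some
    open set matter. Each structure map is therefore specified over all open sets at once, by an
    identity between functions of $\mathcal M$. Its values exist locally and agree on overlaps,
    because the identity determines them, and they glue to one total section that serves every open
    set on which the arguments are smooth.

    Degree 1 functions suffice in the Euler derivation for the following reason. The degree 2
    Hamiltonian in its expansion might contain a vector field, but the Euler derivation kills
    functions of degree 0; so this vector field vanishes, and the Hamiltonian is locally quadratic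
    in degree 1 functions.

    The vector fields X_t and nabla_q X occur in the formulas because TM sits non-canonically in
    degree 2. They subtract from Q t and Q X the part that is not a polynomial in degree 1
    functions; only after this subtraction are the iterated brackets skew-symmetric. *)

Section AbelianGroupIdentities.
Variable V : zmodType.

Inductive zexpr := ZAtom of nat | ZAdd of zexpr & zexpr | ZOpp of zexpr | ZZero.

Fixpoint zeval (env : seq V) (e : zexpr) : V :=
  match e with
  | ZAtom i => env`_i
  | ZAdd a b => zeval env a + zeval env b
  | ZOpp a => - zeval env a
  | ZZero => 0
  end.

Fixpoint zcoef (e : zexpr) (i : nat) : int :=
  match e with
  | ZAtom j => (i == j : nat)%:Z
  | ZAdd a b => zcoef a i + zcoef b i
  | ZOpp a => - zcoef a i
  | ZZero => 0
  end.

Lemma zevalE env e : zeval env e = \sum_(i < size env) env`_i *~ zcoef e i.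
Proof.
elim: e => [j|a IHa b IHb|a IHa|] /=.
- have [lt|ge] := ltnP j (size env).
    rewrite (bigD1 (Ordinal lt)) //= eqxx mulr1z big1 ?addr0 // => i.
    by rewrite -val_eqE /= => /negbTE ->.
  rewrite nth_default // big1 // => i _; case: eqP => // e.
  by have := ltn_ord i; rewrite e ltnNge ge.
- by rewrite IHa IHb -big_split; apply: eq_bigr => i _; rewrite mulrzDr.
- by rewrite IHa -sumrN; apply: eq_bigr => i _; rewrite mulrNz.
- by rewrite big1.
Qed.

(** Coefficients need comparing only at the positions of [env]: an atom beyond its length evaluates
    to the default 0. *)
Lemma zeval_eq env e e' :
  all (fun i => zcoef e i == zcoef e' i) (iota 0 (size env)) -> zeval env e = zeval env e'.
Proof.
move=> /allP H; rewrite !zevalE; apply: eq_bigr => i _.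
by rewrite (eqP (H i _)) // mem_iota add0n ltn_ord.
Qed.

End AbelianGroupIdentities.

Ltac zinsert x env :=
  match env with
  | context [cons x _] => env
  | _ => constr:(cons x env)
  end.
Ltac zatoms t env :=
  match t with
  | (?a + ?b)%R => let env := zatoms a env in zatoms b env
  | (- ?a)%R => zatoms a env
  | 0%R => env
  | _ => zinsert t env
  end.
Ltac zindex x env :=
  match env with
  | cons x _ => constr:(0%N)
  | cons _ ?env => let i := zindex x env in constr:(S i)
  end.
Ltac zreify t env :=
  match t with
  | (?a + ?b)%R => let u := zreify a env in let v := zreify b env in constr:(ZAdd u v)
  | (- ?a)%R => let u := zreify a env in constr:(ZOpp u)
  | 0%R => constr:(ZZero)
  | _ => let i := zindex t env in constr:(ZAtom i)
  end.

(* Stands in for [ring], which requires commutative rings: the algebras of functions are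
   only graded commutative. *)
Ltac zmod :=
  cbv beta;
  match goal with
  | |- @eq ?T ?a ?b =>
    let env := zatoms a (@nil T) in
    let env := zatoms b env in
    let u := zreify a env in
    let v := zreify b env in
    refine (@zeval_eq _ env u v _); vm_compute; reflexivity
  end.

(** * Smooth functions and vector bundles *)

Section CkCalculus.
Variables (R : realType) (n : nat).
Implicit Types (W : set 'rV[R]_n) (f g : 'rV[R]_n -> R).

Lemma near_eq_on W f g y : open W -> W y -> (forall z, W z -> f z = g z) ->
  \forall z \near y, f z = g z.
Proof.
move=> oW Wy e; have := open_nbhs_nbhs (conj oW Wy).
by apply: filterS => z /e.
Qed.

Lemma continuous_at_eq_on W f g y : open W -> W y ->
  (forall z, W z -> f z = g z) ->
  {for y, continuous f} -> {for y, continuous g}.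
Proof.
move=> oW Wy e cf; have E := e _ Wy.
rewrite /prop_for /continuous_at -E; apply: cvg_trans cf.
apply: (near_eq_cvg (F := nbhs y)).
exact: near_eq_on oW Wy e.
Qed.

Lemma Ck_ext k W f g : open W -> (forall y, W y -> f y = g y) ->
  Ck k W f -> Ck k W g.
Proof.
elim: k f g => [|k IH] f g oW e /= [cf df]; split=> //.
- move=> y Wy; exact: continuous_at_eq_on oW Wy e (cf y Wy).
- move=> y Wy; exact: continuous_at_eq_on oW Wy e (cf y Wy).
move=> i; have [d c] := df i; split.
  move=> y Wy; apply: near_eq_derivable (d y Wy).
  exact: near_eq_on oW Wy e.
apply: (IH _ _ oW _ c) => y Wy; apply: near_eq_derive.
exact: near_eq_on oW Wy e.
Qed.

Lemma Ck_sub k W W' f : W' `<=` W -> Ck k W f -> Ck k W' f.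
Proof.
elim: k f => [|k IH] f s /= [cf df]; split=> //; try by move=> y /s; apply: cf.
by move=> i; have [d c] := df i; split; [move=> y /s; apply: d|apply: IH].
Qed.

(** [Ck] is a condition at each point of [W] separately, since its derivatives are those of the
    total function. So [W'] need not be open. *)
Lemma Ck_local k W f :
  (forall y, W y -> exists W', [/\ W' y, W' `<=` W & Ck k W' f]) -> Ck k W f.
Proof.
elim: k f => [|k IH] f H /=; split=> //.
- by move=> y /H[W' [W'y _ [+ _]]]; apply.
- by move=> y /H[W' [W'y _ [+ _]]]; apply.
move=> i; split.
  by move=> y /H[W' [W'y _ [_ /(_ i)[+ _]]]]; apply.
by apply: IH => y /H[W' [W'y W'W [_ /(_ i)[_ c]]]]; exists W'.
Qed.

(** For the induction in [CkM]: the derivative of a product contains the factors themselves, needed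
    there at one order less. *)
Lemma Ck_pred k W f : Ck k.+1 W f -> Ck k W f.
Proof.
elim: k f => [|k IH] f [cf df]; first by split.
by split=> // i; have [d c] := df i; split=> //; apply: IH.
Qed.

Lemma Ck_cst k W (a : R) : Ck k W (fun=> a).
Proof.
elim: k a => [|k IH] a /=; split=> //; try by move=> y _; apply: cst_continuous.
move=> i; split; first by move=> y _; apply: derivable_cst.
have -> : (fun y : 'rV[R]_n => 'D_(delta_mx 0 i) (fun=> a) y) = (fun=> 0).
  by apply/funext => y; rewrite derive_cst.
exact: IH.
Qed.

Lemma CkD k W f g : open W -> Ck k W f -> Ck k W g ->
  Ck k W (fun y => f y + g y).
Proof.
move=> oW; elim: k f g => [|k IH] f g /= [cf df] [cg dg]; split=> //;
  try by move=> y Wy; apply: continuousD; [apply: cf|apply: cg].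
move=> i; have [d c] := df i; have [d' c'] := dg i; split.
  by move=> y Wy; apply: derivableD; [apply: d|apply: d'].
apply: (Ck_ext oW _ (IH _ _ c c')) => y Wy; rewrite -deriveD //.
  exact: d.
exact: d'.
Qed.

Lemma CkM k W f g : open W -> Ck k W f -> Ck k W g ->
  Ck k W (fun y => f y * g y).
Proof.
move=> oW; elim: k f g => [|k IH] f g.
  move=> [cf df] [cg dg]; split=> // y Wy.
  by apply: continuousM; [apply: cf|apply: cg].
move=> Cf Cg; have Cf' := Ck_pred Cf; have Cg' := Ck_pred Cg.
case: Cf Cg => [cf df] [cg dg]; split.
  by move=> y Wy; apply: continuousM; [apply: cf|apply: cg].
move=> i; have [d c] := df i; have [d' c'] := dg i; split.
  by move=> y Wy; apply: derivableM; [apply: d|apply: d'].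
apply: (Ck_ext oW _ (CkD oW (IH _ _ Cf' c') (IH _ _ Cg' c))) => y Wy.
by rewrite deriveM //; [apply: d|apply: d'].
Qed.

End CkCalculus.

Section SmoothFunctions.
Variables (R : realType) (n : nat) (M : manifold R n).
Implicit Types (U V : set M) (f g : M -> R).

Lemma open_chart_preimage (c : chart R n M) U : open U ->
  open [set y | cimg c y /\ U (cinv c y)].
Proof.
move=> oU; rewrite openE => y [cy Uy].
have n1 : nbhs y (cimg c) by apply: open_nbhs_nbhs; split=> //; apply: cimg_open.
have n2 : nbhs y (cinv c @^-1` U).
  by apply: (cinv_continuous cy); apply: open_nbhs_nbhs.
by near=> z; split; near: z.
Unshelve. all: by end_near. Qed.

Lemma smooth_on_eq U f g : open U -> smooth_on U f -> (forall x, U x -> f x = g x) ->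
  smooth_on U g.
Proof.
move=> oU sf e c ac k; apply: Ck_ext (sf c ac k).
  exact: open_chart_preimage.
by move=> y [_ /e].
Qed.

Lemma smooth_on_sub U V f : V `<=` U -> smooth_on U f -> smooth_on V f.
Proof.
move=> VU sf c ac k; apply: Ck_sub (sf c ac k) => y [? /VU ?]; by split.
Qed.

Lemma smooth_on_local U f :
  (forall x, U x -> exists V, [/\ V x, V `<=` U & smooth_on V f]) ->
  smooth_on U f.
Proof.
move=> H c ac k; apply: Ck_local => y [cy /H[V [Vy VU sf]]].
exists [set z | cimg c z /\ V (cinv c z)]; split=> //.
  by move=> z [? /VU ?].
exact: sf.
Qed.

Lemma smooth_cst U (a : R) : smooth_on U (fun=> a).
Proof. by move=> c ac k; apply: Ck_cst. Qed.

Lemma smoothD U f g : open U -> smooth_on U f -> smooth_on U g ->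
  smooth_on U (fun x => f x + g x).
Proof.
move=> oU sf sg c ac k; apply: CkD; first exact: open_chart_preimage.
  exact: sf.
exact: sg.
Qed.

Lemma smoothM U f g : open U -> smooth_on U f -> smooth_on U g ->
  smooth_on U (fun x => f x * g x).
Proof.
move=> oU sf sg c ac k; apply: CkM; first exact: open_chart_preimage.
  exact: sf.
exact: sg.
Qed.

Lemma smoothN U f : open U -> smooth_on U f -> smooth_on U (fun x => - f x).
Proof.
move=> oU sf; apply: (smooth_on_eq oU (smoothM oU (smooth_cst U (-1)) sf) _).
by move=> x _; rewrite mulN1r.
Qed.

Lemma smoothB U f g : open U -> smooth_on U f -> smooth_on U g ->
  smooth_on U (fun x => f x - g x).
Proof. by move=> oU sf sg; apply: smoothD => //; apply: smoothN. Qed.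

Lemma smooth_sum U (I : Type) (r : seq I) (P : pred I) (f : I -> M -> R) :
  open U -> (forall i, smooth_on U (f i)) ->
  smooth_on U (fun x => \sum_(i <- r | P i) f i x).
Proof.
move=> oU sf; elim: r => [|i r IH].
  by apply: (smooth_on_eq oU (smooth_cst U 0) _) => x _; rewrite big_nil.
have [Pi|nPi] := boolP (P i).
  apply: (smooth_on_eq oU (smoothD oU (sf i) IH) _) => x _.
  by rewrite big_cons Pi.
by apply: (smooth_on_eq oU IH _) => x _; rewrite big_cons (negbTE nPi).
Qed.

Lemma smooth_onI U V f : open U -> open V -> smooth_on U f -> smooth_on (U `&` V) f.
Proof. by move=> oU oV; apply: smooth_on_sub => x []. Qed.

Section Tangent.
Variables (x : M) (v : tangent x).

Lemma tangent_derivation : derivation_at x (v : (M -> R) -> R^o).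
Proof. by have := tvalP v => /asboolP. Qed.

Lemma tangent_eq U f g : open U -> U x -> smooth_on U f ->
  (forall y, U y -> f y = g y) -> v f = v g.
Proof. by case: tangent_derivation => H _ _ _ oU Ux sf e; apply: H oU Ux sf e. Qed.

Lemma tangent_out f : ~ smooth_at x f -> v f = 0.
Proof. by case: tangent_derivation => _ _ _; apply. Qed.

Lemma tangentM U f g : open U -> U x -> smooth_on U f -> smooth_on U g ->
  v (fun y => f y * g y) = f x * v g + g x * v f.
Proof. by case: tangent_derivation => _ _ H _ oU Ux sf sg; apply: H; exists U. Qed.

Lemma tangentD U f g : open U -> U x -> smooth_on U f -> smooth_on U g ->
  v (fun y => f y + g y) = v f + v g.
Proof.
case: tangent_derivation => _ H _ _ oU Ux sf sg.
have := H 1 f g; rewrite mul1r => <-; try by exists U.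
by congr (v _); apply/funext => y; rewrite mul1r.
Qed.

Lemma tangent1 : v (fun=> 1) = 0.
Proof.
have := tangentM openT I (smooth_cst setT 1) (smooth_cst setT 1).
under eq_fun => y do rewrite mulr1.
rewrite mul1r => /eqP.
by rewrite -subr_eq0 opprD addrA subrr add0r oppr_eq0 => /eqP.
Qed.

Lemma tangent_cst (a : R) : v (fun=> a) = 0.
Proof.
case: tangent_derivation => _ H _ _.
have s1 : smooth_at x (fun=> 1 : R).
  by exists setT; split=> //; [exact: openT|exact: smooth_cst].
(* The constant [a] is taken as [(a - 1) * 1 + 1], the shape in which linearity of derivations is
   stated. *)
have := H (a - 1) _ _ s1 s1; rewrite tangent1 mulr0 addr0 mulr1.
by under eq_fun => y do rewrite subrK.
Qed.

End Tangent.

Lemma tangent_ext (x : M) (v w : tangent x) :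
  (forall f, smooth_at x f -> v f = w f) -> v = w.
Proof.
move=> e; apply: val_inj; apply/funext => f.
change (v f = w f).
have [/e //|nf] := pselect (smooth_at x f).
by rewrite (tangent_out v nf) (tangent_out w nf).
Qed.

End SmoothFunctions.

(** * Linear functionals on a fibre *)

Section DualVectors.
Variables (R : realType) (V : lmodType R).
Implicit Types (phi psi : dual V) (u v : V).

Lemma dual_linear phi a u v : phi (a *: u + v) = a * phi u + phi v.
Proof. by have := dvalP phi => /asboolP; apply. Qed.

Lemma dualD phi u v : phi (u + v) = phi u + phi v.
Proof. by have := dual_linear phi 1 u v; rewrite scale1r mul1r. Qed.

Lemma dualv0 phi : phi 0 = 0.
Proof.
have := dualD phi 0 0; rewrite addr0 => /eqP.
by rewrite -subr_eq0 opprD addrA subrr add0r oppr_eq0 => /eqP.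
Qed.

Lemma dualZ phi a v : phi (a *: v) = a * phi v.
Proof. by have := dual_linear phi a v 0; rewrite !addr0 dualv0 addr0. Qed.

Lemma dualN phi v : phi (- v) = - phi v.
Proof. by rewrite -scaleN1r dualZ mulN1r. Qed.

Lemma dual_sum phi (I : Type) (r : seq I) (P : pred I) (F : I -> V) :
  phi (\sum_(i <- r | P i) F i) = \sum_(i <- r | P i) phi (F i).
Proof. exact: (big_morph phi (dualD phi) (dualv0 phi)). Qed.

Lemma addd phi psi v : (phi + psi) v = phi v + psi v. Proof. by []. Qed.
Lemma scaled a phi v : (a *: phi) v = a * phi v. Proof. by []. Qed.
Lemma oppd phi v : (- phi) v = - phi v. Proof. by []. Qed.
Lemma sumd (I : Type) (r : seq I) (P : pred I) (F : I -> dual V) v :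
  (\sum_(i <- r | P i) F i) v = \sum_(i <- r | P i) F i v.
Proof. by elim/big_rec2: _ => // i y1 y2 _ <-. Qed.

Lemma dual_ext phi psi : (forall v, phi v = psi v) -> phi = psi.
Proof. by move=> e; apply: val_inj; apply/funext. Qed.

Lemma dual_of (f : V -> R) :
  (forall a u v, f (a *: u + v) = a * f u + f v) ->
  exists phi : dual V, forall v, phi v = f v.
Proof.
move=> lf; have fP : (f : V -> R^o) \in @functional_pred R V by apply/asboolP.
by exists (Dual fP).
Qed.

Lemma linear_of (W : lmodType R) (f : V -> W) :
  (forall a u v, f (a *: u + v) = a *: f u + f v) ->
  exists phi : {linear V -> W}, forall v, phi v = f v.
Proof.
move=> lf; pose m := GRing.isLinear.Build R V W *:%R f lf.
by exists (HB.pack_for {linear V -> W} f m).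
Qed.

End DualVectors.

(** * Vector bundles: frames, duals and tensorial maps *)

Section Bundles.
Variables (R : realType) (n : nat) (M : manifold R n).
Implicit Types (U V : set M) (x : M).

(* Sections are glued from partial data: [P U r] reads "[r] is the wanted section over [U]". *)
Lemma glue_sections (T : M -> Type) (d : forall x, T x)
    (P : set M -> (forall x, T x) -> Prop) :
  (forall U V r r', P U r -> P V r' -> forall x, U x -> V x -> r x = r' x) ->
  exists r0, forall U r, P U r -> forall x, U x -> r x = r0 x.
Proof.
move=> coh.
have H x : exists y : T x, forall U r, P U r -> U x -> r x = y.
  have [[U [r [Pr Ux]]]|no] := pselect (exists U r, P U r /\ U x).
    by exists (r x) => V r' Pr' Vx; exact: (coh _ _ _ _ Pr' Pr x Vx Ux).
  by exists (d x) => U r Pr Ux; case: no; exists U, r.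
by exists (fun x => projT1 (cid (H x))) => U r Pr x Ux; exact: (projT2 (cid (H x)) U r Pr Ux).
Qed.

Lemma TM_smooth_eq U (X Y : sect (TM M)) : open U -> smooth U X ->
  eq_on U X Y -> smooth U Y.
Proof.
move=> oU sX e V f oV VU sf; apply: (smooth_on_eq oV (sX V f oV VU sf)).
by move=> x /VU Ux; rewrite e.
Qed.

Lemma TM_smooth_sub U V (X : sect (TM M)) : open U -> open V -> V `<=` U ->
  smooth U X -> smooth V X.
Proof. by move=> oU oV VU sX W f oW WV; apply: sX => // x /WV /VU. Qed.

Lemma TM_smooth_local U (X : sect (TM M)) : open U ->
  (forall x, U x -> exists V, [/\ open V, V x, V `<=` U & smooth V X]) ->
  smooth U X.
Proof.
move=> oU H V f oV VU sf; apply: smooth_on_local => x Vx.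
have [W [oW Wx WU sX]] := H x (VU x Vx).
exists (V `&` W); split; [by []|by move=> y []|].
apply: sX; [exact: openI|by move=> y []|].
exact: smooth_onI.
Qed.

Lemma TM_is_vbundle :
  (forall x, exists U r (e : 'I_r -> sect (TM M)), [/\ open U, U x & frame U e]) ->
  is_vbundle (TM M).
Proof.
split=> //.
- by move=> U s t oU sm e; apply: TM_smooth_eq oU sm e.
- by move=> U V s oU oV VU; apply: TM_smooth_sub.
- exact: TM_smooth_local.
Qed.

Section VectorBundle.
Variables (E : prebundle M) (hE : is_vbundle E).
Implicit Types (s t : sect E).

Lemma smooth_eq_on U s t : open U -> smooth U s -> eq_on U s t -> smooth U t.
Proof. by case: hE => H _ _ _; apply: H. Qed.

Lemma smooth_sub U V s : open U -> open V -> V `<=` U -> smooth U s -> smooth V s.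
Proof. by case: hE => _ H _ _; apply: H. Qed.

Lemma smooth_local U s : open U ->
  (forall x, U x -> exists V, [/\ open V, V x, V `<=` U & smooth V s]) -> smooth U s.
Proof. by case: hE => _ _ H _; apply: H. Qed.

Lemma frame_sub U V r (e : 'I_r -> sect E) : V `<=` U -> frame U e -> frame V e.
Proof.
move=> VU [b s]; split; first by move=> x /VU; apply: b.
by move=> W oW WV; apply: s => // x /WV /VU.
Qed.

Lemma local_frame U x : open U -> U x ->
  exists V r (e : 'I_r -> sect E), [/\ open V, V x, V `<=` U & frame V e].
Proof.
move=> oU Ux; case: hE => _ _ _ /(_ x)[V [r [e [oV Vx fr]]]].
exists (U `&` V), r, e; split; [exact: openI|by split|by move=> y []|].
by apply: frame_sub fr => y [].
Qed.

Lemma smooth_comb U (f : M -> R) s t : open U -> smooth_on U f ->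
  smooth U s -> smooth U t -> smooth U (sadd (smul f s) t).
Proof.
move=> oU sf ss st; apply: smooth_local => // x Ux.
have [V [r [e [oV Vx VU [_ fr]]]]] := local_frame oU Ux.
exists V; split=> //.
have [/(_ (smooth_sub oU oV VU ss)) [g sg eg] _] := fr V oV (fun=> id) s.
have [/(_ (smooth_sub oU oV VU st)) [h sh eh] _] := fr V oV (fun=> id) t.
apply/(fr V oV (fun=> id)); exists (fun i y => f y * g i y + h i y).
  move=> i; apply: smoothD => //; apply: smoothM => //.
  exact: smooth_on_sub VU sf.
move=> y Vy; rewrite /sadd /smul eg // eh // scaler_sumr -big_split /=.
by apply: eq_bigr => i _; rewrite scalerDl scalerA.
Qed.

Lemma smooth0 U : open U -> smooth U (fun x => 0 : E x).
Proof.
move=> oU; apply: smooth_local => // x Ux.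
have [V [r [e [oV Vx VU [_ fr]]]]] := local_frame oU Ux.
exists V; split=> //; apply/(fr V oV (fun=> id)).
exists (fun _ _ => 0); first by move=> i; apply: smooth_cst.
by move=> y _; rewrite big1 // => i _; rewrite scale0r.
Qed.

Lemma smooth_sadd U s t : open U -> smooth U s -> smooth U t -> smooth U (sadd s t).
Proof.
move=> oU ss st; apply: (smooth_eq_on oU (smooth_comb oU (smooth_cst U 1) ss st)).
by move=> x _; rewrite /sadd /smul scale1r.
Qed.

Lemma smooth_smul U f s : open U -> smooth_on U f -> smooth U s -> smooth U (smul f s).
Proof.
move=> oU sf ss; apply: (smooth_eq_on oU (smooth_comb oU sf ss (smooth0 oU))).
by move=> x _; rewrite /sadd /smul addr0.
Qed.

Lemma smooth_opp U s : open U -> smooth U s -> smooth U (fun x => - s x).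
Proof.
move=> oU ss; apply: (smooth_eq_on oU (smooth_smul oU (smooth_cst U (-1)) ss)).
by move=> x _; rewrite /smul scaleN1r.
Qed.

Lemma smooth_sub_sect U s t : open U -> smooth U s -> smooth U t ->
  smooth U (fun x => s x - t x).
Proof.
move=> oU ss st.
apply: (smooth_eq_on oU (smooth_sadd oU ss (smooth_opp oU st))).
by [].
Qed.

Lemma smooth_sum_sect U (I : Type) (r : seq I) (P : pred I) (s : I -> sect E) : open U ->
  (forall i, smooth U (s i)) -> smooth U (fun x => \sum_(i <- r | P i) s i x).
Proof.
move=> oU ss; elim: r => [|i r IH].
  by apply: (smooth_eq_on oU (smooth0 oU)) => x _; rewrite big_nil.
have [Pi|nPi] := boolP (P i).
  apply: (smooth_eq_on oU (smooth_sadd oU (ss i) IH)) => x _.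
  by rewrite big_cons Pi.
by apply: (smooth_eq_on oU IH) => x _; rewrite big_cons (negbTE nPi).
Qed.

Lemma frame_coord_eq U r (e : 'I_r -> sect E) x (g h : 'I_r -> R) : frame U e -> U x ->
  \sum_i g i *: e i x = \sum_i h i *: e i x -> forall i, g i = h i.
Proof.
move=> [b _] Ux E1 i.
have [c [_ uc]] := b x Ux (\sum_i g i *: e i x).
have := uc (\row_i g i); have := uc (\row_i h i).
have -> : \sum_j (\row_i h i) 0 j *: e j x = \sum_i h i *: e i x.
  by apply: eq_bigr => j _; rewrite mxE.
have -> : \sum_j (\row_i g i) 0 j *: e j x = \sum_i g i *: e i x.
  by apply: eq_bigr => j _; rewrite mxE.
move=> /(_ E1) c1 /(_ erefl) c2.
by have := congr1 (fun m : 'rV_r => m 0 i) (etrans (esym c2) c1); rewrite !mxE.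
Qed.

Lemma frame_smooth U r (e : 'I_r -> sect E) i : open U -> frame U e -> smooth U (e i).
Proof.
move=> oU [_ fr]; apply/(fr U oU (fun=> id)).
exists (fun j _ => (j == i)%:R); first by move=> j; apply: smooth_cst.
move=> x _; rewrite (bigD1 i) //= eqxx scale1r big1 ?addr0 // => j /negbTE ->.
by rewrite scale0r.
Qed.

Lemma dual_frame U r (e : 'I_r -> sect E) : open U -> frame U e ->
  exists c : 'I_r -> sect (dual_bundle E),
    [/\ forall i, smooth U (c i),
        forall x, U x -> forall v, v = \sum_i c i x v *: e i x
      & forall x i j, U x -> c i x (e j x) = (i == j)%:R].
Proof.
move=> oU fr.
have H x : exists c : 'I_r -> dual (E x), U x -> forall v, v = \sum_i c i v *: e i x.
  have [Ux|nUx] := pselect (U x); last by exists (fun=> 0).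
  have [b _] := fr.
  have /choice [c Hc] : forall v, exists c : 'rV[R]_r, v = \sum_i c 0 i *: e i x.
    by move=> v; have [c [? _]] := b x Ux v; exists c.
  have /choice[d Hd] : forall i, exists phi : dual (E x), forall v, phi v = c v 0 i.
    move=> i; apply: dual_of => a u v.
    apply: (frame_coord_eq (g := fun i => c (a *: u + v) 0 i)
      (h := fun i => a * c u 0 i + c v 0 i) fr Ux).
    rewrite -Hc [in LHS](Hc u) [in LHS](Hc v) scaler_sumr -big_split /=.
    by apply: eq_bigr => j _; rewrite scalerDl scalerA.
  exists d => _ v; rewrite [LHS]Hc; apply: eq_bigr => i _; by rewrite Hd.
pose c i x := projT1 (cid (H x)) i.
have cP x : U x -> forall v, v = \sum_i c i x v *: e i x.
  exact: (projT2 (cid (H x))).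
exists c; split=> //.
  move=> i V s oV VU ss.
  have [/(_ ss) [g sg eg] _] := fr.2 V oV VU s.
  apply: (smooth_on_eq oV (sg i)) => x Vx.
  apply: (frame_coord_eq (g := fun i => g i x) (h := fun i => c i x (s x)) fr (VU x Vx)).
  by rewrite -eg // -cP //; apply: VU.
move=> x i j Ux.
apply: (frame_coord_eq (g := fun i => c i x (e j x)) (h := fun i => (i == j)%:R) fr Ux).
rewrite -cP // (bigD1 j) //= eqxx scale1r big1 ?addr0 // => k /negbTE ->.
by rewrite scale0r.
Qed.

Lemma frame_of_dual_frame U r (e : 'I_r -> sect E) (c : 'I_r -> sect (dual_bundle E)) :
  open U -> frame U e -> (forall i, smooth U (c i)) ->
  (forall x, U x -> forall v, v = \sum_i c i x v *: e i x) ->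
  (forall x i j, U x -> c i x (e j x) = (i == j)%:R) ->
  frame U c.
Proof.
move=> oU fr sc cE ce.
have dec x (phi : dual (E x)) : U x -> phi = \sum_i phi (e i x) *: c i x.
  move=> Ux; apply: dual_ext => v; rewrite [in LHS](cE x Ux v) dual_sum sumd.
  by apply: eq_bigr => i _; rewrite dualZ scaled mulrC.
split.
  move=> x Ux phi; exists (\row_i phi (e i x)); split.
    rewrite [LHS](dec x phi Ux); apply: eq_bigr => i _; by rewrite mxE.
  move=> d dE; have {}dE : phi = \sum_i d 0 i *: c i x :> dual (E x) := dE.
  apply/rowP => i; rewrite mxE dE sumd (bigD1 i) // scaled ce // eqxx mulr1.
  rewrite big1; first exact: addr0.
  by move=> j /negbTE ji; rewrite scaled ce // ji mulr0.
move=> V oV VU a; split.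
  move=> sa; exists (fun i x => a x (e i x)).
    move=> i; apply: sa => //.
    by apply: smooth_sub VU (frame_smooth i oU fr).
  by move=> x /VU Ux; apply: dec.
move=> [g sg eg] W s oW WV ss.
apply: (smooth_on_eq oW (f := fun x => \sum_i g i x * c i x (s x))).
  apply: smooth_sum => // i; apply: smoothM => //.
    exact: smooth_on_sub WV (sg i).
  apply: sc => //; exact: subset_trans WV VU.
by move=> x /WV Vx; rewrite eg // sumd; apply: eq_bigr => i _; rewrite scaled.
Qed.

Lemma dual_is_vbundle : is_vbundle (dual_bundle E).
Proof.
split.
- move=> U a b oU sa e V s oV VU ss; apply: (smooth_on_eq oV (sa V s oV VU ss)).
  by move=> x /VU Ux; rewrite e.
- by move=> U V a oU oV VU sa W s oW WV; apply: sa => // x /WV /VU.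
- move=> U a oU H V s oV VU ss; apply: smooth_on_local => x Vx.
  have [W [oW Wx WU sa]] := H x (VU x Vx).
  exists (V `&` W); split; [by []|by move=> y []|].
  have oVW := openI oV oW.
  apply: sa => //.
  exact: (smooth_sub oV oVW (fun y h => proj1 h) ss).
- move=> x; have [V [r [e [oV Vx _ fr]]]] := local_frame openT (I : setT x).
  have [c [sc cE ce]] := dual_frame oV fr.
  by exists V, r, c; split=> //; apply: frame_of_dual_frame fr sc cE ce.
Qed.

(** Vectors extend with constant coefficients in a local frame. The neighbourhood is common to all
    vectors at [x], and the extension is linear at every point, so identities between vectors become
    identities between sections. *)
Lemma extension : exists ext : forall x, E x -> sect E, forall x,
  [/\ exists U, [/\ open U, U x & forall v, smooth U (ext x v)],
      forall v, ext x v x = v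
    & forall a u v y, ext x (a *: u + v) y = a *: ext x u y + ext x v y].
Proof.
suff H x : exists ext : E x -> sect E,
  [/\ exists U, [/\ open U, U x & forall v, smooth U (ext v)],
      forall v, ext v x = v
    & forall a u v y, ext (a *: u + v) y = a *: ext u y + ext v y].
  by exists (fun x => projT1 (cid (H x))) => x; apply: (projT2 (cid (H x))).
have [U [r [e [oU Ux _ fr]]]] := local_frame openT (I : setT x).
have [c [_ cE _]] := dual_frame oU fr.
exists (fun v y => \sum_i c i x v *: e i y); split.
- exists U; split=> // v; apply: smooth_sum_sect => // i.
  by apply: smooth_smul => //; [exact: smooth_cst|exact: frame_smooth].
- by move=> v; rewrite -cE.
- move=> a u v y; rewrite scaler_sumr -big_split; apply: eq_bigr => i _ /=.
  by rewrite dual_linear scalerDl scalerA.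
Qed.

(** Linearity over functions and locality in one condition: [r] has to agree with the combination
    only near [x]. This replaces the usual argument with bump functions. *)
Definition tensorial x (W : lmodType R) (F : sect E -> W) : Prop :=
  forall U (f : M -> R) s t r, open U -> U x -> smooth_on U f ->
    smooth U s -> smooth U t -> eq_on U r (sadd (smul f s) t) ->
    F r = f x *: F s + F t.

Lemma tensorial_eq_at x (W : lmodType R) (F : sect E -> W) U V s t :
  tensorial x F -> open U -> U x -> smooth U s -> open V -> V x -> smooth V t ->
  s x = t x -> F s = F t.
Proof.
move=> tF oU Ux ss oV Vx st est.
(* Locality: a section that vanishes near [x] equals [(-1) * s0 + s0] there, so its value is
   [- F s0 + F s0]. *)
have F0 s0 D : open D -> D x -> eq_on D s0 (fun=> 0) -> F s0 = 0.
  move=> oD Dx e0; rewrite (tF D (fun=> -1) s0 s0 s0) ?scaleN1r ?addNr //.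
  - exact: smooth_cst.
  - by apply: (smooth_eq_on oD (smooth0 oD)) => y Dy; rewrite e0.
  - by apply: (smooth_eq_on oD (smooth0 oD)) => y Dy; rewrite e0.
  - by move=> y Dy; rewrite /sadd /smul e0 // scaleN1r addNr.
have oUV := openI oU oV.
have [D [r [e [oD Dx DUV fr]]]] := local_frame oUV (conj Ux Vx : (U `&` V) x).
have DU : D `<=` U by move=> y /DUV [].
have DV : D `<=` V by move=> y /DUV [].
have dec s0 (g : 'I_r -> M -> R) (sg : forall i, smooth_on D (g i)) :
    eq_on D s0 (fun y => \sum_i g i y *: e i y) -> F s0 = \sum_i g i x *: F (e i).
  suff H (l : seq 'I_r) s1 :
      eq_on D s1 (fun y => \sum_(i <- l) g i y *: e i y) ->
      F s1 = \sum_(i <- l) g i x *: F (e i).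
    exact: H.
  elim: l s1 => [|i l IH] s1 e1.
    by rewrite big_nil; apply: (F0 s1 D) => // y Dy; rewrite e1 // big_nil.
  rewrite big_cons -(IH _ (fun y _ => erefl)).
  apply: (tF D) => //; first exact: frame_smooth.
    apply: smooth_sum_sect => // j; apply: smooth_smul => //; exact: frame_smooth.
  by move=> y Dy; rewrite e1 // big_cons.
have [/(_ (smooth_sub oU oD DU ss)) [g sg eg] _] := fr.2 D oD (fun=> id) s.
have [/(_ (smooth_sub oV oD DV st)) [h sh eh] _] := fr.2 D oD (fun=> id) t.
rewrite (dec s g) // (dec t h) //; apply: eq_bigr => i _.
congr (_ *: _).
apply: (frame_coord_eq (g := fun i => g i x) (h := fun i => h i x) fr Dx).
by rewrite -eg // -eh.
Qed.

Lemma tensorial_linear x (W : lmodType R) (F : sect E -> W) : tensorial x F ->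
  exists phi : {linear E x -> W},
    forall U s, open U -> U x -> smooth U s -> F s = phi (s x).
Proof.
move=> tF; have [ext /(_ x) [[U [oU Ux sext]] extx extl]] := extension.
have [phi phiE] : exists phi : {linear E x -> W}, forall v, phi v = F (ext x v).
  apply: linear_of => a u v.
  by apply: (tF U (fun=> a)) => //; exact: smooth_cst.
exists phi => V s oV Vx ss; rewrite phiE.
exact: tensorial_eq_at tF oV Vx ss oU Ux (sext _) (esym (extx _)).
Qed.

(** Tensoriality is asked point by point, with the covector 0 where it fails. This gives a single
    total section even if [G] is built from sections that are smooth only somewhere. *)
Lemma tensorial_dual (G : sect E -> M -> R) :
  exists a : sect (dual_bundle E), forall x, tensorial (W := R^o) x (G^~ x) ->
    forall U s, open U -> U x -> smooth U s -> G s x = a x (s x).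
Proof.
suff H x : exists a : dual (E x), tensorial (W := R^o) x (G^~ x) ->
    forall U s, open U -> U x -> smooth U s -> G s x = a (s x).
  by exists (fun x => projT1 (cid (H x))) => x; apply: (projT2 (cid (H x))).
have [tG|nt] := pselect (tensorial (W := R^o) x (G^~ x)); last by exists 0.
have [phi phiE] := tensorial_linear tG.
have [a aE] : exists a : dual (E x), forall v, a v = phi v.
  by apply: dual_of => c u v; rewrite linearP.
by exists a => _ U s oU Ux ss; rewrite aE -(phiE U).
Qed.

Lemma dual_separates x (u v : E x) : (forall a : dual (E x), a u = a v) -> u = v.
Proof.
move=> e; have [U [r [f [oU Ux _ fr]]]] := local_frame openT (I : setT x).
have [c [_ cE _]] := dual_frame oU fr.
by rewrite (cE x Ux u) (cE x Ux v); apply: eq_bigr => i _; rewrite e.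
Qed.

(** Fibres have finite frames, so a functional on the dual is evaluation at the vector with
    coordinates [F (c i)]. This is how sections of $Q$ are obtained from their pairings with degree
    1 functions. *)
Lemma bidual_surj x (F : dual (E x) -> R) :
  (forall a u v, F (a *: u + v) = a * F u + F v) ->
  exists v : E x, forall a, F a = a v.
Proof.
move=> lF; have [U [r [e [oU Ux _ fr]]]] := local_frame openT (I : setT x).
have [c [_ cE ce]] := dual_frame oU fr.
have [phi phiE] := dual_of lF.
exists (\sum_i F (c i x) *: e i x) => a; rewrite dual_sum.
have dec : a = \sum_i a (e i x) *: c i x.
  apply: dual_ext => v; rewrite [in LHS](cE x Ux v) dual_sum sumd.
  by apply: eq_bigr => i _; rewrite dualZ scaled mulrC.
rewrite {1}dec -phiE dual_sum; apply: eq_bigr => i _.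
by rewrite !dualZ phiE mulrC.
Qed.

Lemma smooth_by_pairing U s : open U ->
  (forall V (a : sect (dual_bundle E)), open V -> V `<=` U -> smooth V a ->
     smooth_on V (pairing a s)) -> smooth U s.
Proof.
move=> oU H; apply: smooth_local => // x Ux.
have [V [r [e [oV Vx VU fr]]]] := local_frame oU Ux.
have [c [sc cE _]] := dual_frame oV fr.
exists V; split=> //; apply/(fr.2 V oV (fun=> id)).
exists (fun i => pairing (c i) s); first by move=> i; apply: H.
by move=> y Vy; rewrite [LHS](cE y Vy).
Qed.

End VectorBundle.

Lemma pairing_smooth (E : prebundle M) U (a : sect (dual_bundle E)) (s : sect E) :
  open U -> smooth U a -> smooth U s -> smooth_on U (pairing a s).
Proof. by move=> oU sa ss; apply: sa. Qed.

Lemma tensorial_bhom (E F : prebundle M) (hE : is_vbundle E) (hF : is_vbundle F)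
    (op : sect E -> sect F) :
  (forall x, tensorial x (fun s => op s x)) ->
  (forall U s, open U -> smooth U s -> smooth U (op s)) ->
  exists phi : bhom E F, forall U s, open U -> smooth U s -> eq_on U (app phi s) (op s).
Proof.
move=> tO sO.
pose f x := projT1 (cid (tensorial_linear hE (tO x))).
have fP x : forall U s, open U -> U x -> smooth U s -> op s x = f x (s x).
  exact: (projT2 (cid (tensorial_linear hE (tO x)))).
have sf U (s : sect E) : open U -> smooth U s -> smooth (p := F) U (fun x => f x (s x)).
  by move=> oU ss; apply: (smooth_eq_on hF oU (sO U s oU ss)) => x Ux; rewrite (fP x U).
by exists (BHom sf) => U s oU ss x Ux; rewrite (fP x U).
Qed.

End Bundles.

(** * Graded Poisson brackets and the Euler derivation *)

Section GradedAlgebra.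
Variables (R : realType) (n : nat) (M : manifold R n) (S : symplectic_lie2 M).
Implicit Types (U V W : set M) (f g : M -> R) (k l m : nat).

Local Notation A := (fn S).
Local Notation emb := (emb S).
Local Notation "{{ a , b }}" := (poisson (s := S) a b).
Local Notation QQ := (homological (s := S)).

Section OpenSet.
Variables (U : set M) (oU : open U).
Implicit Types (a b c : A U).

Lemma homN k a : hom k a -> hom k (- a).
Proof. by move=> ha; rewrite -sub0r; apply: homB => //; apply: hom0. Qed.

Lemma homD k a b : hom k a -> hom k b -> hom k (a + b).
Proof. by move=> ha hb; rewrite -[b]opprK; apply: homB => //; apply: homN. Qed.

Lemma hom_mulrn k a i : hom k a -> hom k (a *+ i).
Proof.
move=> ha; elim: i => [|i IH]; first by rewrite mulr0n; apply: hom0.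
by rewrite mulrS; apply: homD.
Qed.

Lemma hom_sum k (I : Type) (r : seq I) (P : pred I) (F : I -> A U) :
  (forall i, P i -> hom k (F i)) -> hom k (\sum_(i <- r | P i) F i).
Proof.
by move=> H; apply: (big_ind (fun a : A U => hom k a)) => //; [exact: hom0|exact: homD].
Qed.

Lemma fn_commE k l a b : ~~ odd (k * l) -> hom k a -> hom l b -> a * b = b * a.
Proof.
by move=> e ha hb; rewrite (fn_comm oU ha hb) -signr_odd (negbTE e) mul1r.
Qed.

Lemma fn_commN k l a b : odd (k * l) -> hom k a -> hom l b -> a * b = - (b * a).
Proof.
by move=> e ha hb; rewrite (fn_comm oU ha hb) -signr_odd e mulN1r.
Qed.

Lemma hom_emb f : smooth_on U f -> hom 0 (emb U f).
Proof. by move=> sf; apply/emb_hom => //; exists f. Qed.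

Lemma emb_inj f g : smooth_on U f -> smooth_on U g -> emb U f = emb U g ->
  forall x, U x -> f x = g x.
Proof. by move=> sf sg /(emb_eq S oU sf sg). Qed.

Lemma emb_ext f g : smooth_on U f -> (forall x, U x -> f x = g x) ->
  emb U f = emb U g.
Proof. by move=> sf e; apply/emb_eq => //; apply: smooth_on_eq oU sf e. Qed.

Lemma emb0 : emb U (fun=> 0) = 0.
Proof.
have s0 := @smooth_cst R n M U 0.
have := embD S oU s0 s0.
rewrite -[LHS]addr0 => /eqP; under eq_fun do rewrite addr0.
by rewrite (inj_eq (addrI _)) eq_sym => /eqP.
Qed.

Lemma embN f : smooth_on U f -> emb U (fun x => - f x) = - emb U f.
Proof.
move=> sf; apply/eqP; rewrite -addr_eq0 -embD //; last exact: smoothN.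
by rewrite -emb0; apply/eqP; congr (emb U _); apply/funext => x; rewrite addNr.
Qed.

Lemma embB f g : smooth_on U f -> smooth_on U g ->
  emb U (fun x => f x - g x) = emb U f - emb U g.
Proof. by move=> sf sg; rewrite -embN // -embD //; apply: smoothN. Qed.

Lemma emb_sum (I : Type) (r : seq I) (P : pred I) (F : I -> M -> R) :
  (forall i, smooth_on U (F i)) ->
  emb U (fun x => \sum_(i <- r | P i) F i x) = \sum_(i <- r | P i) emb U (F i).
Proof.
move=> sF; elim: r => [|i r IH].
  by rewrite big_nil -emb0; congr (emb U _); apply/funext => x; rewrite big_nil.
rewrite big_cons; have [Pi|nPi] := boolP (P i); rewrite -IH -?embD //;
  try by congr (emb U _); apply/funext => x; rewrite big_cons ?Pi ?(negbTE nPi).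
exact: smooth_sum.
Qed.

Lemma hom_one : hom 0 (1 : A U).
Proof. by rewrite -(emb1 S oU); apply: hom_emb; apply: smooth_cst. Qed.

(** Real constants invert [k]. This cancels the factor by which the Euler derivation multiplies a
    function of degree [k]. *)
Lemma mulrn_inj0 k a : (0 < k)%N -> a *+ k = 0 -> a = 0.
Proof.
move=> k0 ak0.
have E : emb U (fun=> k%:R) = 1 *+ k.
  elim: {k0 ak0} k => [|k IH]; first by rewrite !mulr0n emb0.
  rewrite [RHS]mulrS -IH -(emb1 S oU) -embD; try exact: smooth_cst; last by [].
  by congr (emb U _); apply/funext => x; rewrite -mulrS.
have : emb U (fun=> k%:R^-1) * (a *+ k) = a.
  rewrite -[a in LHS]mul1r -mulrnAl -E mulrA -embM; try exact: smooth_cst; last by [].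
  rewrite -[RHS]mul1r -(emb1 S oU); congr (_ * a); congr (emb U _).
  by apply/funext => x; rewrite mulVf // pnatr_eq0 -lt0n.
by rewrite ak0 mulr0.
Qed.

Lemma brDl a b c : {{ a + b, c }} = {{ a, c }} + {{ b, c }}.
Proof. by have [[H _] _ _ _ _] := poissonP S; have [] := H U oU a b c. Qed.

Lemma brDr a b c : {{ a, b + c }} = {{ a, b }} + {{ a, c }}.
Proof. by have [[H _] _ _ _ _] := poissonP S; have [] := H U oU a b c. Qed.

Lemma br0l a : {{ 0, a }} = 0.
Proof. by have /eqP := brDl 0 0 a; rewrite addr0 -{1}[poisson 0 a]addr0 (inj_eq (addrI _)) => /eqP. Qed.

Lemma br0r a : {{ a, 0 }} = 0.
Proof. by have /eqP := brDr a 0 0; rewrite addr0 -{1}[poisson a 0]addr0 (inj_eq (addrI _)) => /eqP. Qed.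

Lemma brNl a b : {{ - a, b }} = - {{ a, b }}.
Proof. by apply/eqP; rewrite -addr_eq0 -brDl addNr br0l. Qed.

Lemma brNr a b : {{ a, - b }} = - {{ a, b }}.
Proof. by apply/eqP; rewrite -addr_eq0 -brDr addNr br0r. Qed.

Lemma brBl a b c : {{ a - b, c }} = {{ a, c }} - {{ b, c }}.
Proof. by rewrite brDl brNl. Qed.

Lemma brBr a b c : {{ a, b - c }} = {{ a, b }} - {{ a, c }}.
Proof. by rewrite brDr brNr. Qed.

Lemma br_suml (I : Type) (r : seq I) (P : pred I) (F : I -> A U) b :
  {{ \sum_(i <- r | P i) F i, b }} = \sum_(i <- r | P i) {{ F i, b }}.
Proof. by apply: (big_morph (fun a => {{ a, b }})) => [x y|]; [exact: brDl|exact: br0l]. Qed.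

Lemma br_sumr (I : Type) (r : seq I) (P : pred I) (F : I -> A U) b :
  {{ b, \sum_(i <- r | P i) F i }} = \sum_(i <- r | P i) {{ b, F i }}.
Proof. by apply: (big_morph (poisson b)) => [x y|]; [exact: brDr|exact: br0r]. Qed.

Lemma br_homz k l a b : hom k a -> hom l b -> homz (k%:Z + l%:Z - 2) {{ a, b }}.
Proof. by have [_ H _ _ _] := poissonP S; apply: H. Qed.

(** The truncated subtraction is harmless: below total degree 2 the bracket is 0, which is
    homogeneous of every degree. *)
Lemma hom_br k l a b : hom k a -> hom l b -> hom (k + l - 2) {{ a, b }}.
Proof.
move=> ha hb; have := br_homz ha hb; rewrite -PoszD.
have [le2|lt2] := leqP 2 (k + l); first by rewrite subzn.
suff [m ->] : exists m, (k + l)%:Z - 2 = Negz m by move=> ->; apply: hom0.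
by case: (k + l)%N lt2 => [|[|]] //= _; [exists 1%N|exists 0%N].
Qed.

Lemma br_low k l a b : (k + l < 2)%N -> hom k a -> hom l b -> {{ a, b }} = 0.
Proof.
move=> lt2 ha hb; have := br_homz ha hb; rewrite -PoszD.
by case: (k + l)%N lt2 => [|[|]].
Qed.

Lemma br00 a b : hom 0 a -> hom 0 b -> {{ a, b }} = 0.
Proof. exact: br_low. Qed.

Lemma br10 a b : hom 1 a -> hom 0 b -> {{ a, b }} = 0.
Proof. exact: br_low. Qed.

Lemma br01 a b : hom 0 a -> hom 1 b -> {{ a, b }} = 0.
Proof. exact: br_low. Qed.

Lemma br_skewE k l a b : ~~ odd (k * l) -> hom k a -> hom l b ->
  {{ a, b }} = - {{ b, a }}.
Proof.
move=> e ha hb; have [_ _ H _ _] := poissonP S.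
by rewrite (H U k l a b oU ha hb) -signr_odd (negbTE e) mul1r.
Qed.

Lemma br_symO k l a b : odd (k * l) -> hom k a -> hom l b -> {{ a, b }} = {{ b, a }}.
Proof.
move=> e ha hb; have [_ _ H _ _] := poissonP S.
by rewrite (H U k l a b oU ha hb) -signr_odd e mulN1r opprK.
Qed.

Lemma br_leibnizE k l a b c : ~~ odd (k * l) -> hom k a -> hom l b ->
  {{ a, b * c }} = {{ a, b }} * c + b * {{ a, c }}.
Proof.
move=> e ha hb; have [_ _ _ H _] := poissonP S.
by rewrite (H U k l a b c oU ha hb) -signr_odd (negbTE e) mul1r.
Qed.

Lemma br_leibnizO k l a b c : odd (k * l) -> hom k a -> hom l b ->
  {{ a, b * c }} = {{ a, b }} * c - b * {{ a, c }}.
Proof.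
move=> e ha hb; have [_ _ _ H _] := poissonP S.
by rewrite (H U k l a b c oU ha hb) -signr_odd e mulN1r.
Qed.

Lemma br_jacobiE k l a b c : ~~ odd (k * l) -> hom k a -> hom l b ->
  {{ a, {{ b, c }} }} = {{ {{ a, b }}, c }} + {{ b, {{ a, c }} }}.
Proof.
move=> e ha hb; have [_ _ _ _ H] := poissonP S.
by rewrite (H U k l a b c oU ha hb) -signr_odd (negbTE e) mul1r.
Qed.

Lemma br_jacobiO k l a b c : odd (k * l) -> hom k a -> hom l b ->
  {{ a, {{ b, c }} }} = {{ {{ a, b }}, c }} - {{ b, {{ a, c }} }}.
Proof.
move=> e ha hb; have [_ _ _ _ H] := poissonP S.
by rewrite (H U k l a b c oU ha hb) -signr_odd e mulN1r.
Qed.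

(** Skew-symmetry, used three times, carries the Leibniz rule to the left argument. The resulting
    signs depend only on parities, and all cancel except $(-1)^{lm}$. *)
Lemma br_leibniz_lE k l m a b c : ~~ odd (l * m) -> hom k a -> hom l b -> hom m c ->
  {{ a * b, c }} = a * {{ b, c }} + {{ a, c }} * b.
Proof.
move=> e ha hb hc; have hab := homM oU ha hb.
have [_ _ sk lb _] := poissonP S.
rewrite (sk U _ _ _ _ oU hab hc) (lb U _ _ _ _ _ oU hc ha).
rewrite (sk U _ _ _ _ oU ha hc) (sk U _ _ _ _ oU hb hc).
rewrite -!(signr_odd _ (_ * _)) !oddM !oddD; move: e; rewrite oddM.
by case: (odd k); case: (odd l); case: (odd m) => //= _;
  rewrite ?mul1r ?mulN1r ?mulNr ?mulrN ?opprK ?opprD ?opprK addrC.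
Qed.

Lemma br_leibniz_lO k l m a b c : odd (l * m) -> hom k a -> hom l b -> hom m c ->
  {{ a * b, c }} = a * {{ b, c }} - {{ a, c }} * b.
Proof.
move=> e ha hb hc; have hab := homM oU ha hb.
have [_ _ sk lb _] := poissonP S.
rewrite (sk U _ _ _ _ oU hab hc) (lb U _ _ _ _ _ oU hc ha).
rewrite (sk U _ _ _ _ oU ha hc) (sk U _ _ _ _ oU hb hc).
rewrite -!(signr_odd _ (_ * _)) !oddM !oddD; move: e; rewrite oddM.
by case: (odd k); case: (odd l); case: (odd m) => //= _;
  rewrite ?mul1r ?mulN1r ?mulNr ?mulrN ?opprK ?opprD ?opprK addrC.
Qed.

Lemma brZr k (f a c : A U) : hom k a -> hom 0 f -> {{ a, f * c }} = {{ a, f }} * c + f * {{ a, c }}.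
Proof. by move=> ha hf; apply: br_leibnizE ha hf; rewrite muln0. Qed.

Lemma brZr0 k (f a c : A U) : hom k a -> hom 0 f -> {{ a, f }} = 0 ->
  {{ a, f * c }} = f * {{ a, c }}.
Proof. by move=> ha hf z; rewrite (brZr _ ha hf) z mul0r add0r. Qed.

Lemma brZl0 k m (f a c : A U) : hom 0 f -> hom k a -> hom m c -> {{ f, c }} = 0 ->
  {{ f * a, c }} = f * {{ a, c }}.
Proof.
move=> hf ha hc z; have [od|e] := boolP (odd (k * m)).
  by rewrite (br_leibniz_lO od hf ha hc) z mul0r subr0.
by rewrite (br_leibniz_lE e hf ha hc) z mul0r addr0.
Qed.

(** The sign is the same for all [k]: the Leibniz rule contributes $(-1)^k$ and moving [{a, c}], of
    degree [k - 1], past [b] contributes $(-1)^{k-1}$. For [k = 0] both sides vanish. *)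
Lemma br_odd_mul k a b c : hom 1 a -> hom 1 b -> hom k c ->
  {{ a * b, c }} = a * {{ b, c }} - b * {{ a, c }}.
Proof.
move=> ha hb hc; have [k0|k0] := posnP k.
  rewrite k0 in hc; rewrite (br_leibniz_lE (l := 1) (m := 0) _ ha hb hc) //.
  by rewrite (br_low _ ha hc) // (br_low _ hb hc) // mul0r !mulr0 subr0 addr0.
have hac := hom_br ha hc.
have ok : (1 + k - 2 = k.-1)%N by case: k k0 {hc hac} => // k _; rewrite add1n subSS subn1.
rewrite ok in hac; have [e|o] := boolP (odd k).
  rewrite (br_leibniz_lO (l := 1) (m := k) _ ha hb hc) ?mul1n //.
  rewrite (fn_commE _ hac hb) //.
  by rewrite muln1; case: k k0 e {hc hac ok}.
rewrite (br_leibniz_lE (l := 1) (m := k) _ ha hb hc) ?mul1n //.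
rewrite (fn_commN _ hac hb) //.
by rewrite muln1; case: k k0 o {hc hac ok} => //= k _; rewrite negbK.
Qed.

Lemma homQ k a : hom k a -> hom k.+1 (QQ a).
Proof.
have [_ _ _ H _] := homological_derivation S; move=> ha.
by have := H U k a oU (@subsetT _ U) ha; rewrite -PoszD addn1.
Qed.

Lemma QD a b : QQ (a + b) = QQ a + QQ b.
Proof. by have [H _ _ _ _] := homological_derivation S; apply: H (@subsetT _ U) _ _. Qed.

Lemma Q0 : QQ (0 : A U) = 0.
Proof. by have /eqP := QD 0 0; rewrite addr0 -{1}[QQ 0]addr0 (inj_eq (addrI _)) => /eqP. Qed.

Lemma Q_leibniz k a b : hom k a -> QQ (a * b) = QQ a * b + (-1) ^+ k * (a * QQ b).
Proof.
have [_ _ _ _ H] := homological_derivation S; move=> ha.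
by rewrite (H U k a b oU (@subsetT _ U) ha) mul1n.
Qed.

Lemma Q_leibniz0 a b : hom 0 a -> QQ (a * b) = QQ a * b + a * QQ b.
Proof. by move=> ha; rewrite (Q_leibniz _ ha) expr0 mul1r. Qed.

Lemma Q_brE k a b : ~~ odd k -> hom k a ->
  QQ {{ a, b }} = {{ QQ a, b }} + {{ a, QQ b }}.
Proof.
by move=> e ha; rewrite (homological_poisson b oU ha) -signr_odd (negbTE e) mul1r.
Qed.

Lemma Q_brO k a b : odd k -> hom k a ->
  QQ {{ a, b }} = {{ QQ a, b }} - {{ a, QQ b }}.
Proof.
by move=> e ha; rewrite (homological_poisson b oU ha) -signr_odd e mulN1r.
Qed.

Lemma Q_one : QQ (1 : A U) = 0.
Proof.
have /eqP := Q_leibniz0 1 hom_one; rewrite !mulr1 mul1r -{1}[QQ 1]addr0.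
by rewrite (inj_eq (addrI _)) eq_sym => /eqP.
Qed.

Lemma Q_cst (t : R) : QQ (emb U (fun=> t)) = 0.
Proof.
have [_ H _ _ _] := homological_derivation S.
by have := H U oU (@subsetT _ U) t 1; rewrite Q_one mulr0 mulr1.
Qed.

Lemma br_cst k (t : R) a : hom k a -> {{ a, emb U (fun=> t) }} = 0.
Proof.
move=> ha.
have b1 : {{ a, 1 }} = 0.
  have e : ~~ odd (k * 0) by rewrite muln0.
  have /eqP := br_leibnizE 1 e ha hom_one; rewrite !mulr1 mul1r.
  by rewrite -{1}[{{ a, 1 }}]addr0 (inj_eq (addrI _)) eq_sym => /eqP.
have [[_ [H _]] _ _ _ _] := poissonP S.
by have [_] := H U oU t a 1; rewrite b1 mulr0 mulr1.
Qed.

End OpenSet.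

Lemma res_br U V (h : V `<=` U) (a b : A U) : open U -> open V ->
  res h {{ a, b }} = {{ res h a, res h b }}.
Proof. by have [[_ [_ H]] _ _ _ _] := poissonP S; apply: H. Qed.

Lemma res_Q U V (h : V `<=` U) (a : A U) : open U -> open V ->
  res h (QQ a) = QQ (res h a).
Proof.
have [_ _ H _ _] := homological_derivation S; move=> oU oV.
by apply: H => //; apply: subsetT.
Qed.

End GradedAlgebra.

(** * Homogeneous components and the Euler derivation *)

Section Euler.
Variables (R : realType) (n : nat) (M : manifold R n) (S : symplectic_lie2 M).
Implicit Types (U V W : set M) (k l m N : nat).

Local Notation A := (fn S).
Local Notation emb := (emb S).
Local Notation "{{ a , b }}" := (poisson (s := S) a b).

Definition decomposes U (a : A U) (c : nat -> A U) : Prop :=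
  (forall k, hom k (c k)) /\
  exists N, (forall k, (N <= k)%N -> c k = 0) /\ a = \sum_(k < N) c k.

Definition component U (a : A U) : nat -> A U := xget (fun=> 0) [set c | decomposes a c].

Section OpenSet.
Variables (U : set M) (oU : open U).
Implicit Types (a b : A U) (c d : nat -> A U).

Lemma sum_widen N N' c : (forall k, (N <= k)%N -> c k = 0) -> (N <= N')%N ->
  \sum_(k < N) c k = \sum_(k < N') c k.
Proof.
move=> z le; rewrite (big_ord_widen _ c le) [RHS](bigID (fun k : 'I_N' => (k < N)%N)) /=.
rewrite [X in _ = _ + X]big1 ?addr0 // => k; rewrite -leqNgt; exact: z.
Qed.

Lemma decomposes_unique a c d : decomposes a c -> decomposes a d -> forall k, c k = d k.
Proof.
move=> [hc [N [zc ac]]] [hd [N' [zd ad]]] k.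
pose K := (N + N' + k.+1)%N.
have := hom_direct (c := fun k => c k - d k) (N := K) oU.
move=> /(_ _ _ k _)/eqP H; apply/eqP; rewrite -subr_eq0; apply: H.
- by move=> j; apply: homB.
- have KN : (N <= K)%N by rewrite /K -addnA leq_addr.
  have KN' : (N' <= K)%N by rewrite /K addnAC leq_addl.
  by rewrite sumrB -(sum_widen zc KN) -(sum_widen zd KN') -ac -ad subrr.
- by rewrite /K leq_addl.
Qed.

Lemma componentP a : decomposes a (component a).
Proof.
have [N [c [hc ac]]] := hom_generate a oU.
rewrite /component; apply: (@xgetPex _ _ [set c | decomposes a c]).
exists (fun k => if (k < N)%N then c k else 0); split.
  by move=> k; case: ifP => // _; apply: hom0.
exists N; split; first by move=> k; rewrite leqNgt => /negbTE ->.
by rewrite ac; apply: eq_bigr => k _; rewrite ltn_ord.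
Qed.

Lemma componentE a c : decomposes a c -> forall k, component a k = c k.
Proof. by move=> dc; apply: decomposes_unique (componentP a) dc. Qed.

Lemma component_hom a k : hom k (component a k).
Proof. by have [] := componentP a. Qed.

Lemma component_sum a : exists N, forall N', (N <= N')%N -> a = \sum_(k < N') component a k.
Proof.
have [_ [N [z e]]] := componentP a.
by exists N => N' le; rewrite -(sum_widen z le).
Qed.

Lemma component_homE l a k : hom l a -> component a k = if k == l then a else 0.
Proof.
move=> ha; apply: (componentE (c := fun k => if k == l then a else 0)); split.
  by move=> j; case: eqP => [->|_] //; apply: hom0.
exists l.+1; split; first by move=> j; case: eqP => // ->; rewrite ltnn.
rewrite (bigD1 (Ordinal (ltnSn l))) //= eqxx big1 ?addr0 // => i.
by rewrite -val_eqE /= => /negbTE ->.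
Qed.

Lemma componentD a b k : component (a + b) k = component a k + component b k.
Proof.
have [ha [N [za ea]]] := componentP a; have [hb [N' [zb eb]]] := componentP b.
apply: (componentE (c := fun k => component a k + component b k)); split.
  by move=> j; apply: homD.
exists (N + N')%N; split.
  move=> j le; rewrite za ?zb ?addr0 //.
    exact: leq_trans (leq_addl _ _) le.
  exact: leq_trans (leq_addr _ _) le.
by rewrite big_split /= -(sum_widen za) ?leq_addr // -(sum_widen zb) ?leq_addl // -ea -eb.
Qed.

Lemma component0 k : component (0 : A U) k = 0.
Proof. by rewrite (component_homE k (hom0 S 0 oU)); case: eqP. Qed.

Lemma component_bigsum (I : Type) (r : seq I) (P : pred I) (F : I -> A U) k :
  component (\sum_(i <- r | P i) F i) k = \sum_(i <- r | P i) component (F i) k.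
Proof.
apply: (big_morph (fun a => component a k)) => [a b|].
  exact: componentD.
exact: component0.
Qed.

Lemma component0M a b k : hom 0 a -> component (a * b) k = a * component b k.
Proof.
move=> ha; have [hb [N [z e]]] := componentP b.
apply: (componentE (c := fun k => a * component b k)); split.
  by move=> j; rewrite -[j in hom j]add0n; apply: homM.
exists N; split; first by move=> j /z ->; rewrite mulr0.
by rewrite -mulr_sumr -e.
Qed.

End OpenSet.

Lemma component_res U V (h : V `<=` U) (a : A U) k : open U -> open V ->
  res h (component a k) = component (res h a) k.
Proof.
move=> oU oV; have [ha [N [z e]]] := componentP oU a.
symmetry; apply: (componentE oV (c := fun k => res h (component a k))); split.
  by move=> j; apply: res_hom.
exists N; split; first by move=> j /z ->; rewrite rmorph0.
by rewrite -rmorph_sum -e.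
Qed.

(** The bound [N] is an arbitrary choice; by [eulerE] every bound beyond the last nonzero component
    gives the same value. *)
Definition euler U (a : A U) : A U :=
  let N := xget 0%N [set N | forall k, (N <= k)%N -> component a k = 0] in
  \sum_(k < N) component a k *+ k.

Section OpenSet.
Variables (U : set M) (oU : open U).
Implicit Types (a b : A U).

Lemma eulerE a N : (forall k, (N <= k)%N -> component a k = 0) ->
  euler a = \sum_(k < N) component a k *+ k.
Proof.
move=> z; rewrite /euler; set N' := xget _ _.
have z' k : (N' <= k)%N -> component a k = 0.
  apply: (@xgetPex _ 0%N [set N | forall k, (N <= k)%N -> component a k = 0]).
  by exists N.
have H := @sum_widen U _ _ (fun k => component a k *+ k).
have [le|/ltnW le] := leqP N N'; [symmetry|]; apply: H => // k.
  by move=> /z ->; rewrite mul0rn.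
by move=> /z' ->; rewrite mul0rn.
Qed.

Lemma euler_bound a : exists N, forall k, (N <= k)%N -> component a k = 0.
Proof. by have [_ [N [z _]]] := componentP oU a; exists N. Qed.

Lemma eulerD a b : euler (a + b) = euler a + euler b.
Proof.
have [N za] := euler_bound a; have [N' zb] := euler_bound b.
have za' k : (N + N' <= k)%N -> component a k = 0.
  by move=> le; apply: za; apply: leq_trans (leq_addr _ _) le.
have zb' k : (N + N' <= k)%N -> component b k = 0.
  by move=> le; apply: zb; apply: leq_trans (leq_addl _ _) le.
rewrite (eulerE za') (eulerE zb') (@eulerE _ (N + N')%N); last first.
  by move=> k le; rewrite componentD // za' // zb' // addr0.
by rewrite -big_split; apply: eq_bigr => k _; rewrite componentD // mulrnDl.
Qed.

Lemma euler_hom k a : hom k a -> euler a = a *+ k.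
Proof.
move=> ha; rewrite (@eulerE _ k.+1); last first.
  by move=> j; rewrite (component_homE oU _ ha); case: eqP => // ->; rewrite ltnn.
rewrite (bigD1 (Ordinal (ltnSn k))) //= (component_homE oU _ ha) eqxx.
rewrite big1 ?addr0 // => i; rewrite -val_eqE /= (component_homE oU _ ha) => /negbTE ->.
by rewrite mul0rn.
Qed.

Lemma euler_bigsum (I : Type) (r : seq I) (P : pred I) (F : I -> A U) :
  euler (\sum_(i <- r | P i) F i) = \sum_(i <- r | P i) euler (F i).
Proof.
apply: (big_morph (@euler U)) => [a b|]; first exact: eulerD.
by rewrite (euler_hom (hom0 S 0 oU)) mulr0n.
Qed.

End OpenSet.

Lemma euler_derivation U : open U -> is_derivation U 0 (@euler).
Proof.
move=> _; split.
- by move=> V oV _ a b; apply: eulerD.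
- move=> V oV _ t a; have ht : hom 0 (emb V (fun=> t)) by apply: hom_emb oV _ _; apply: smooth_cst.
  have [N z] := euler_bound oV a; rewrite (eulerE z) (@eulerE _ _ N).
    by rewrite mulr_sumr; apply: eq_bigr => k _; rewrite component0M // mulrnAr.
  by move=> k /z za; rewrite component0M // za mulr0.
- move=> V W h a oV oW _; have [N z] := euler_bound oV a.
  rewrite (eulerE z) (@eulerE _ _ N).
    by rewrite rmorph_sum; apply: eq_bigr => k _; rewrite rmorphMn component_res.
  by move=> k /z za; rewrite -component_res // za rmorph0.
- move=> V k a oV _ ha; rewrite addr0 /= (euler_hom oV ha).
  exact: hom_mulrn.
- move=> V k a b oV _ ha; rewrite mul0n expr0 mul1r.
  have [hb [N [z e]]] := componentP oV b.
  rewrite e mulr_sumr !(euler_bigsum oV) mulr_sumr mulr_sumr -big_split.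
  apply: eq_bigr => l _ /=; rewrite (euler_hom oV (homM oV ha (hb l))).
  by rewrite (euler_hom oV ha) (euler_hom oV (hb l)) mulrnDr mulrnAl mulrnAr.
Qed.

(** A term [a_p * {x_q, b}] has degree [p + q + k - 2], which is [k] exactly for [p + q = 2]. Hence
    only the three values 0, 1, 2 of [p] contribute. *)
Lemma component_br U (a x b : A U) k : open U -> hom k b ->
  component (a * {{ x, b }}) k =
  \sum_(p < 3) component a p * {{ component x (2 - p), b }}.
Proof.
move=> oU hb.
have [N ea] := component_sum oU a; have [N' ex] := component_sum oU x.
rewrite {1}(ea (3 + N)%N) ?leq_addl // {1}(ex (3 + N')%N) ?leq_addl //.
rewrite mulr_suml component_bigsum //.
have F (p q : nat) : component (component a p * {{ component x q, b }}) k =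
    if (p + q == 2)%N then component a p * {{ component x q, b }} else 0.
  have hp := component_hom oU a p; have hq := component_hom oU x q.
  (* Here [q + k - 2] would be truncated, but the bracket is already zero. *)
  have [lt|le] := ltnP (q + k) 2.
    by rewrite (br_low oU lt hq hb) mulr0 component0 // if_same.
  rewrite (component_homE oU _ (homM oU hp (hom_br oU hq hb))).
  suff -> : (k == p + (q + k - 2))%N = (p + q == 2)%N by [].
  by apply/eqP/eqP; lia.
rewrite big_split_ord /= [X in _ + X]big1 ?addr0.
  apply: eq_bigr => p _; rewrite br_suml // mulr_sumr component_bigsum //.
  have lt : (2 - p < 3 + N')%N by rewrite ltn_addr // ltnS leq_subr.
  rewrite (bigD1 (Ordinal lt)) //= F subnKC ?eqxx; last by rewrite -ltnS.
  rewrite big1 ?addr0 // => q; rewrite F -val_eqE /= => /eqP nq; case: eqP => // e.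
  by case: nq; lia.
move=> p _; rewrite br_suml // mulr_sumr component_bigsum // big1 // => q _; exact: F.
Qed.

(* Writing the Euler derivation as a combination of Hamiltonian ones and keeping
   the terms of matching degree. *)
Lemma euler_hamiltonian U x : open U -> U x -> exists V r (a y : 'I_r -> nat -> A V),
  [/\ open V, V x, V `<=` U, (forall i k, hom k (a i k) /\ hom k (y i k)) &
   forall W (h : W `<=` V) k (b : A W), open W -> hom k b ->
     b *+ k = \sum_(i < r) \sum_(p < 3) res h (a i p) * {{ res h (y i (2 - p)%N), b }}].
Proof.
move=> oU Ux.
have [V [r [a [y [oV Vx VU H]]]]] := poisson_symplectic oU (euler_derivation oU) Ux.
exists V, r, (fun i => component (a i)), (fun i => component (y i)); split=> //.
  by move=> i k; split; apply: component_hom.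
move=> W h k b oW hb; rewrite -(euler_hom oW hb).
have he : hom k (euler b) by rewrite (euler_hom oW hb); apply: hom_mulrn.
have := component_homE oW k he; rewrite eqxx => <-; rewrite H // component_bigsum //.
apply: eq_bigr => i _; rewrite component_br //; apply: eq_bigr => p _.
by rewrite !component_res.
Qed.

End Euler.

(** * Monomials of degrees 1 and 2 *)

Section Monomials.
Variables (R : realType) (n : nat) (M : manifold R n) (A : graded_sheaf M).
Variables (U : set M) (r1 r2 : nat) (xi : 'I_r1 -> fn A U) (eta : 'I_r2 -> fn A U).

Definition linear_expo k (i : 'I_r1) : {set 'I_r1} * {ffun 'I_r2 -> 'I_k.+1} :=
  ([set i]%SET, [ffun=> ord0]).

Lemma expo_deg1 (p : {set 'I_r1} * {ffun 'I_r2 -> 'I_2}) :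
  (expo_deg p == 1%N) = (p \in @linear_expo 1 @: [set: 'I_r1]%SET).
Proof.
apply/idP/imsetP => [/eqP e|[i _ ->]]; last first.
  rewrite /expo_deg cards1 big1 //= => j _; by rewrite ffunE.
rewrite /expo_deg in e.
have s0 : (\sum_j (p.2 j : nat) = 0)%N by lia.
have /cards1P[i ei] : #|p.1| == 1%N by apply/eqP; lia.
exists i => //; case: p ei s0 {e} => A' m /= -> s0; congr pair; apply/ffunP => j.
rewrite ffunE; apply/val_inj => /=; apply/eqP.
by move/eqP: s0; rewrite sum_nat_eq0 => /forallP /(_ j).
Qed.

Lemma monomial_linear k i : monomial xi eta (linear_expo k i) = xi i.
Proof.
rewrite /monomial big_set1 big1 ?mulr1 // => j _; by rewrite ffunE expr0.
Qed.

Lemma monomial_deg2 k (p : {set 'I_r1} * {ffun 'I_r2 -> 'I_k.+1}) :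
  expo_deg p = 2%N ->
  (exists i j, monomial xi eta p = xi i * xi j) \/
  (exists j, monomial xi eta p = eta j).
Proof.
rewrite /expo_deg /monomial => e.
have [s0|s1] : (\sum_j (p.2 j : nat) = 0)%N \/ (\sum_j (p.2 j : nat) = 1)%N by lia.
  left; have c2 : #|p.1| = 2%N by lia.
  rewrite [X in _ * X]big1; last first.
    move=> j _; suff -> : (p.2 j : nat) = 0%N by rewrite expr0.
    by apply/eqP; move/eqP: s0; rewrite sum_nat_eq0 => /forallP /(_ j).
  rewrite mulr1 -big_filter.
  rewrite -sum1_card -big_filter sum1_size in c2.
  case: [seq _ <- _ | _] c2 => [//|i [//|j [|//]]] _.
  by exists i, j; rewrite !big_cons big_nil mulr1.
right; have c0 : #|p.1| = 0%N by lia.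
have /eqP/sum_nat_eq1 := s1.
case=> j [_ pj pk]; exists j.
rewrite big_pred0 ?mul1r; last first.
  by move=> i; move/eqP: c0; rewrite cards_eq0 => /eqP ->; rewrite inE.
rewrite (eq_bigr (fun i => if i == j then eta j else 1)); last first.
  move=> i _; case: eqP => [->|/eqP ij]; first by rewrite pj expr1.
  by rewrite pk // expr0.
by rewrite -big_mkcond big_pred1_eq.
Qed.

End Monomials.

(** * Functions of degrees 1 and 2 *)

Section LocalStructure.
Variables (R : realType) (n : nat) (M : manifold R n) (S : symplectic_lie2 M).
Variables (Q : vbundle M) (sg : splitting S Q).
Implicit Types (U V W : set M) (k l m : nat) (x : M).

Local Notation A := (fn S).
Local Notation emb := (emb S).
Local Notation "{{ a , b }}" := (poisson (s := S) a b).
Local Notation QQ := (homological (s := S)).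
Local Notation Qs := (dual_bundle Q).
Local Notation i1 := (i1 sg).
Local Notation i2 := (i2 sg).

Lemma Q_vbundle : is_vbundle Q. Proof. exact: vbP. Qed.
Lemma Qs_vbundle : is_vbundle Qs. Proof. exact: dual_is_vbundle Q_vbundle. Qed.
(** The local frames of $TM$ are read off from the splitting, not from coordinate vector fields of
    charts. *)
Lemma T_vbundle : is_vbundle (TM M).
Proof.
apply: TM_is_vbundle => x; have [U [_ [r [_ [b [oU Ux _ fb _]]]]]] := split_generate sg x.
by exists U, r, b.
Qed.
Lemma Ts_vbundle : is_vbundle (TstarM M).
Proof. exact: dual_is_vbundle T_vbundle. Qed.

Section OpenSet.
Variables (U : set M) (oU : open U).

Lemma i1_zero : i1 U (fun x => 0) = 0.
Proof.
have s0 := smooth0 Qs_vbundle oU.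
have := i1D sg oU s0 s0.
have -> : sadd (fun x => 0 : Qs x) (fun=> 0) = (fun=> 0).
  by apply: functional_extensionality_dep => x; rewrite /sadd addr0.
by move=> e; apply: (addrI (i1 U (fun=> 0))); rewrite addr0 -e.
Qed.

Lemma i1_opp t : smooth U t -> i1 U (fun x => - t x) = - i1 U t.
Proof.
move=> st; have sN := smooth_opp Qs_vbundle oU st.
apply/eqP; rewrite -addr_eq0 -i1D // -i1_zero; apply/eqP.
congr (i1 U _); apply: functional_extensionality_dep => x; exact: addNr.
Qed.

Lemma i1_sub s t : smooth U s -> smooth U t ->
  i1 U (fun x => s x - t x) = i1 U s - i1 U t.
Proof.
move=> ss st; rewrite -i1_opp // -i1D //.
exact: (smooth_opp Qs_vbundle oU st).
Qed.

Lemma i2_zero : i2 U (fun x => 0) = 0.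
Proof.
have s0 := smooth0 T_vbundle oU.
have := i2D sg oU s0 s0.
have -> : sadd (fun x => 0 : TM M x) (fun=> 0) = (fun=> 0).
  by apply: functional_extensionality_dep => x; rewrite /sadd addr0.
by move=> e; apply: (addrI (i2 U (fun=> 0))); rewrite addr0 -e.
Qed.

Lemma i1_sum (I : Type) (r : seq I) (g : I -> M -> R) (t : I -> sect Qs) (P : pred I) :
  (forall i, smooth_on U (g i)) -> (forall i, smooth U (t i)) ->
  i1 U (fun x => \sum_(i <- r | P i) g i x *: t i x) =
  \sum_(i <- r | P i) emb U (g i) * i1 U (t i).
Proof.
move=> sG st; elim: r => [|i l IH].
  rewrite big_nil -i1_zero; congr (i1 U _).
  by apply: functional_extensionality_dep => x; rewrite big_nil.
rewrite big_cons -IH; case Pi: (P i); last first.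
  congr (i1 U _); apply: functional_extensionality_dep => x.
  by rewrite big_cons Pi.
rewrite -i1Z // -i1D //.
- congr (i1 U _); apply: functional_extensionality_dep => x.
  by rewrite big_cons Pi.
- exact: (smooth_smul Qs_vbundle).
- by apply: (smooth_sum_sect Qs_vbundle) => // j; apply: (smooth_smul Qs_vbundle).
Qed.

Lemma i2_sum (I : Type) (r : seq I) (g : I -> M -> R) (t : I -> sect (TM M)) (P : pred I) :
  (forall i, smooth_on U (g i)) -> (forall i, smooth U (t i)) ->
  i2 U (fun x => \sum_(i <- r | P i) g i x *: t i x) =
  \sum_(i <- r | P i) emb U (g i) * i2 U (t i).
Proof.
move=> sG st; elim: r => [|i l IH].
  rewrite big_nil -i2_zero; congr (i2 U _).
  by apply: functional_extensionality_dep => x; rewrite big_nil.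
rewrite big_cons -IH; case Pi: (P i); last first.
  congr (i2 U _); apply: functional_extensionality_dep => x.
  by rewrite big_cons Pi.
rewrite -i2Z // -i2D //.
- congr (i2 U _); apply: functional_extensionality_dep => x.
  by rewrite big_cons Pi.
- exact: (smooth_smul T_vbundle).
- by apply: (smooth_sum_sect T_vbundle) => // j; apply: (smooth_smul T_vbundle).
Qed.

End OpenSet.

(** These sums are the ambiguity in embedding vector fields into degree 2 functions: they are
    invisible to brackets with functions of degree 0, and conversely [quadratic_of_anchor0] finds
    that nothing else is, locally. *)
Definition quadratic U (a : A U) : Prop :=
  exists l : seq (A U * A U),
    (forall p, p \in l -> hom 1 p.1 /\ hom 1 p.2) /\ a = \sum_(p <- l) p.1 * p.2.

Lemma quadraticD U (a b : A U) : quadratic a -> quadratic b -> quadratic (a + b).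
Proof.
move=> [l [hl ->]] [l' [hl' ->]]; exists (l ++ l'); rewrite big_cat; split=> //.
by move=> p; rewrite mem_cat => /orP[/hl|/hl'].
Qed.

Lemma quadratic0 U : quadratic (0 : A U).
Proof. by exists [::]; rewrite big_nil. Qed.

Lemma quadraticM U (a b : A U) : hom 1 a -> hom 1 b -> quadratic (a * b).
Proof.
move=> ha hb; exists [:: (a, b)]; rewrite big_seq1; split=> // p.
by rewrite inE => /eqP ->.
Qed.

(** Free generation by [i1] and [i2] of local frames, read in degrees 1 and 2. One [V] serves all
    its open subsets because freeness is assumed for every restriction. *)
Lemma splitting_local U x : open U -> U x -> exists V,
  [/\ open V, V x, V `<=` U &
   forall W, open W -> W `<=` V ->
   [/\ forall a : A W, hom 1 a -> exists2 t, smooth W t & a = i1 W t,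
       forall t, smooth W t -> i1 W t = 0 -> forall y, W y -> t y = 0
     & forall a : A W, hom 2 a -> exists2 X, smooth W X & quadratic (a - i2 W X)]].
Proof.
move=> oU Ux.
have [U0 [r1 [r2 [t [b [oU0 U0x ft fb [_ _ fg]]]]]]] := split_generate sg x.
exists (U `&` U0); split; [exact: openI|by []|by move=> y []|].
move=> W oW WUU0; have h : W `<=` U0 by move=> y /WUU0 [].
have st i : smooth W (t i).
  exact: (smooth_sub Qs_vbundle oU0 oW h (frame_smooth i oU0 ft)).
have sb i : smooth W (b i).
  exact: (smooth_sub T_vbundle oU0 oW h (frame_smooth i oU0 fb)).
pose xi i := res h (i1 U0 (t i)); pose eta j := res h (i2 U0 (b j)).
have xiE i : xi i = i1 W (t i).
  by rewrite /xi i1_res //; apply: (frame_smooth).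
have etaE i : eta i = i2 W (b i).
  by rewrite /eta i2_res //; apply: (frame_smooth).
have sum1 (c : {set 'I_r1} * {ffun 'I_r2 -> 'I_2} -> M -> R) :
    \sum_(p | expo_deg p == 1%N) emb W (c p) * monomial xi eta p =
    \sum_(i < r1) emb W (c (linear_expo r2 1 i)) * xi i.
  rewrite (eq_bigl _ _ (@expo_deg1 r1 r2)) big_imset /=; last first.
    by move=> i j _ _ [/set1_inj].
  under eq_bigl do rewrite inE.
  by apply: eq_bigr => i _; rewrite monomial_linear.
have sm0 := smooth_cst; split.
- move=> a ha; have [gen _] := fg W h oW 1%N.
  have [c sc ->] := gen a ha; rewrite sum1.
  exists (fun y => \sum_(i < r1) c (linear_expo r2 1 i) y *: t i y).
    by apply: (smooth_sum_sect Qs_vbundle) => // i; apply: (smooth_smul Qs_vbundle).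
  rewrite (@i1_sum W oW _ _ (fun i => c (linear_expo r2 1 i))) //.
  by apply: eq_bigr => i _; rewrite xiE.
- move=> s ss s0 y Wy; have [_ free] := fg W h oW 1%N.
  have [/(_ ss) [g sG eg] _] := (frame_sub h ft).2 W oW (fun=> id) s.
  have E : i1 W s = \sum_(i < r1) emb W (g i) * i1 W (t i).
    rewrite -(@i1_sum W oW) //; apply: i1_eq => //.
    by apply: (smooth_sum_sect Qs_vbundle) => // i; apply: (smooth_smul Qs_vbundle).
  (* Freeness speaks of families over all exponents. This one has the value [g i] at the exponent of
     the generator [xi i], and in degree 1 there are no other exponents. *)
  pose c (p : {set 'I_r1} * {ffun 'I_r2 -> 'I_2}) z := \sum_(i | i \in p.1) g i z.
  have sc p : smooth_on W (c p) by apply: smooth_sum.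
  have cE i : c (linear_expo r2 1 i) = g i.
    by apply/funext => z; rewrite /c big_set1.
  have := free c sc; rewrite sum1 => H; rewrite eg // big1 // => i _.
  rewrite -cE H ?scale0r //.
    rewrite -[RHS]s0 E; apply: eq_bigr => j _; by rewrite cE xiE.
  by apply/eqP; rewrite expo_deg1; apply/imsetP; exists i.
- move=> a ha; have [gen _] := fg W h oW 2.
  have [c sc ->] := gen a ha.
  apply: (big_ind (fun a => exists2 X, smooth W X & quadratic (a - i2 W X))).
  + exists (fun x => 0); first exact: (smooth0 T_vbundle).
    by rewrite i2_zero // subr0; apply: quadratic0.
  + move=> a1 a2 [X1 s1 q1] [X2 s2 q2]; exists (sadd X1 X2).
      exact: (smooth_sadd T_vbundle).
    rewrite i2D // opprD addrACA; exact: quadraticD.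
  + move=> p /eqP dp; have [[i [j ->]]|[j ->]] := monomial_deg2 xi eta dp.
      exists (fun x => 0); first exact: (smooth0 T_vbundle).
      rewrite i2_zero // subr0 mulrA; apply: quadraticM; rewrite xiE; last exact: i1_hom.
      rewrite -[1%N]add0n; apply: homM => //; last exact: i1_hom.
      exact: hom_emb.
    exists (smul (c p) (b j)); first exact: (smooth_smul T_vbundle).
    by rewrite i2Z // etaE subrr; apply: quadratic0.
Qed.

Lemma fn_local_eq U k (a b : A U) : open U -> hom k a -> hom k b ->
  (forall x, U x -> exists V, [/\ open V, V x, V `<=` U &
     forall h : V `<=` U, res h a = res h b]) -> a = b.
Proof.
move=> oU ha hb H; apply/eqP; rewrite -subr_eq0; apply/eqP.
apply: (sheaf_separated oU (homB oU ha hb)) => x Ux.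
have [V [oV Vx VU e]] := H x Ux; exists V, VU; split=> //.
by rewrite rmorphB e subrr.
Qed.

Lemma i1_inj U s t : open U -> smooth U s -> smooth U t -> i1 U s = i1 U t -> eq_on U s t.
Proof.
move=> oU ss st e x Ux; apply/eqP; rewrite -subr_eq0; apply/eqP.
have [V [oV Vx VU /(_ V oV (fun=> id))[_ inj _]]] := splitting_local oU Ux.
have sd := smooth_sub_sect Qs_vbundle oU ss st.
apply: (inj (fun x => s x - t x)) => //; first exact: (smooth_sub Qs_vbundle oU).
by rewrite -(i1_res sg VU) // i1_sub // e subrr rmorph0.
Qed.

Lemma i1_surj U (a : A U) : open U -> hom 1 a -> exists2 t, smooth U t & i1 U t = a.
Proof.
move=> oU ha.
pose P V (t : sect Qs) := exists h : V `<=` U, [/\ open V, smooth V t & i1 V t = res h a].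
have [|t tP] := glue_sections (T := fun x => Qs x) (fun x => 0) (P := P).
  move=> V W r r' [hV [oV sr er]] [hW [oW sr' er']] x Vx Wx.
  have oVW := openI oV oW.
  have h1 := @subIsetl _ V W; have h2 := @subIsetr _ V W.
  apply: (i1_inj oVW) => //; [exact: (smooth_sub Qs_vbundle oV)|
    exact: (smooth_sub Qs_vbundle oW)|].
  rewrite -(i1_res sg h1) // -(i1_res sg h2) // er er'.
  by rewrite !(res_comp _ _ (subset_trans h1 hV)).
have loc x : U x -> exists V, [/\ open V, V x, V `<=` U &
    smooth V t /\ forall h : V `<=` U, i1 V t = res h a].
  move=> Ux; have [V [oV Vx VU /(_ V oV (fun=> id))[sur _ _]]] := splitting_local oU Ux.
  exists V; split=> //.
  have [s ss es] := sur (res VU a) (res_hom VU oU oV ha).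
  have e : eq_on V s t by apply: tP; exists VU.
  have st := smooth_eq_on Qs_vbundle oV ss e.
  split=> // h; rewrite -(i1_eq sg oV ss st e) -es.
  (* A restriction map takes the inclusion as an argument; any two proofs of it give the same
     map. *)
  by congr (res _ a); apply: Prop_irrelevance.
have st : smooth U t.
  apply: (smooth_local Qs_vbundle) => // x Ux.
  by have [V [oV Vx VU [sV _]]] := loc x Ux; exists V.
exists t => //; apply: (fn_local_eq oU (i1_hom sg oU st) ha) => x Ux.
have [V [oV Vx VU [sV e]]] := loc x Ux; exists V; split=> // h.
by rewrite i1_res.
Qed.

(** Locally [a] is a vector field plus a quadratic function, and the latter commutes with functions
    because [{tau, f}] has negative degree. The local vector fields glue since a tangent vector is
    determined by its action on germs. *)
Lemma anchor_exists U (a : A U) : open U -> hom 2 a ->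
  exists2 X : sect (TM M), smooth U X &
    forall V (h : V `<=` U) f, open V -> smooth_on V f ->
      {{ res h a, emb V f }} = emb V (lie X f).
Proof.
move=> oU ha.
pose P V (X : sect (TM M)) := exists h : V `<=` U, [/\ open V, smooth V X &
  forall W (k : W `<=` U) f, open W -> W `<=` V -> smooth_on W f ->
    {{ res k a, emb W f }} = emb W (lie X f)].
have [|X XP] := glue_sections (T := fun x => TM M x) (fun x => 0) (P := P).
  move=> V W X X' [hV [oV sX eX]] [hW [oW sX' eX']] x Vx Wx.
  apply: tangent_ext => f [D [oD Dx sf]].
  have oE : open (D `&` (V `&` W)) by do 2!apply: openI => //.
  have h1 : D `&` (V `&` W) `<=` V by move=> y [_ []].
  have h2 : D `&` (V `&` W) `<=` W by move=> y [_ []].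
  have h3 := subset_trans h1 hV.
  have sf' : smooth_on (D `&` (V `&` W)) f by apply: smooth_on_sub sf => y [].
  have := emb_inj (S := S) oE (sX _ f oE h1 sf') (sX' _ f oE h2 sf').
  by apply; [rewrite -(eX _ h3) // -(eX' _ h3)|split].
have loc x : U x -> exists V, [/\ open V, V x, V `<=` U & P V X].
  move=> Ux; have [V [oV Vx VU /(_ V oV (fun=> id))[_ _ dec]]] := splitting_local oU Ux.
  exists V; split=> //.
  have [Y sY [l [hl el]]] := dec (res VU a) (res_hom VU oU oV ha).
  suff PY : P V Y.
    have e : eq_on V Y X by apply: XP.
    exists VU; split=> //; first exact: (smooth_eq_on T_vbundle oV sY e).
    move=> W k f oW WV sf; have [_ [_ _ H]] := PY.
    rewrite H //; apply: emb_ext => //.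
      by apply: sY.
    by move=> y Wy; rewrite /lie e //; apply: WV.
  exists VU; split=> // W k f oW WV sf.
  have hf := hom_emb S oW sf.
  rewrite -(res_comp VU WV k) //.
  have -> : res VU a = i2 V Y + \sum_(p <- l) p.1 * p.2 by rewrite -el addrC subrK.
  rewrite rmorphD i2_res // brDl // i2_anchor //; last exact: (smooth_sub T_vbundle oV).
  rewrite rmorph_sum br_suml // big_seq big1 ?addr0 // => p /hl [h1 h2].
  rewrite rmorphM (br_odd_mul oW _ _ hf); try exact: res_hom.
  by rewrite !(br10 oW _ hf) ?mulr0 ?subrr //; exact: res_hom.
exists X.
  apply: (smooth_local T_vbundle) => // x Ux.
  by have [V [oV Vx VU [_ [_ ? _]]]] := loc x Ux; exists V.
move=> V h f oV sf.
have hf := hom_emb S oV sf.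
have lX : smooth_on V (lie X f).
  apply: smooth_on_local => x Vx.
  have [W [oW Wx WU [_ [_ sX _]]]] := loc x (h x Vx).
  exists (V `&` W); split; [by []|by move=> y []|].
  apply: sX; [exact: openI|by move=> y []|exact: smooth_onI].
apply: (fn_local_eq oV (hom_br oV (res_hom h oU oV ha) hf) (hom_emb S oV lX)) => x Vx.
have [W [oW Wx WU [_ [_ sX eX]]]] := loc x (h x Vx).
have oVW := openI oV oW.
exists (V `&` W); split; [by []|by []|by move=> y []|move=> k].
have hW : V `&` W `<=` U by move=> y [/h].
rewrite res_br // (res_comp h k hW) // !emb_res //.
apply: eX => //; exact: smooth_on_sub sf.
Qed.

Lemma anchor_unique (U : set M) (X Y : sect (TM M)) : open U -> smooth U X -> smooth U Y ->
  (forall V f, open V -> V `<=` U -> smooth_on V f -> emb V (lie X f) = emb V (lie Y f)) ->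
  eq_on U X Y.
Proof.
move=> oU sX sY e x Ux; apply: tangent_ext => f [D [oD Dx sf]].
have oE := openI oD oU.
have sf' : smooth_on (D `&` U) f by apply: smooth_onI.
have h : D `&` U `<=` U by move=> y [].
have := emb_inj (S := S) oE (sX _ f oE h sf') (sY _ f oE h sf').
by apply; [exact: e|split].
Qed.

Lemma quadratic_of_anchor0 U x (a : A U) : open U -> U x -> hom 2 a ->
  (forall V (h : V `<=` U) f, open V -> smooth_on V f -> {{ res h a, emb V f }} = 0) ->
  exists V (h : V `<=` U), [/\ open V, V x & quadratic (res h a)].
Proof.
move=> oU Ux ha a0.
have [V [oV Vx VU /(_ V oV (fun=> id))[_ _ dec]]] := splitting_local oU Ux.
have [X sX qX] := dec (res VU a) (res_hom VU oU oV ha).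
exists V, VU; split=> //.
suff X0 : i2 V X = 0 by rewrite X0 subr0 in qX.
rewrite -(i2_zero oV); apply: i2_eq => //; first exact: (smooth0 T_vbundle).
apply: anchor_unique => //; first exact: (smooth0 T_vbundle).
move=> W f oW WV sf; have hf := hom_emb S oW sf.
have sXW := smooth_sub T_vbundle oV oW WV sX.
rewrite -(i2_anchor sg oW sXW sf) -(i2_res sg WV) //.
have [l [hl el]] := qX.
have -> : i2 V X = res VU a - \sum_(p <- l) p.1 * p.2 by rewrite -el opprB addrC subrK.
rewrite rmorphB brBl // (res_comp VU WV (subset_trans WV VU)) // a0 // sub0r.
rewrite rmorph_sum br_suml // big_seq big1 ?oppr0.
  rewrite -(emb0 S oW); apply: emb_ext => //; first exact: smooth_cst.
move=> p /hl [h1 h2].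
rewrite rmorphM (br_odd_mul oW _ _ hf); try exact: res_hom.
by rewrite !(br10 oW _ hf) ?mulr0 ?subrr //; exact: res_hom.
Qed.

(** In [euler_hamiltonian] the terms with [y i 0] vanish on [b], and those with [y i 2] add up to
    [{z, b}] for [z] the sum of the [a i 0 * y i 2]. Applied to a function of degree 0, the
    expansion reads [0 = {z, f}]; so [z] has zero anchor and is locally a sum of products of degree
    1 functions. Its Hamiltonian derivation is then also a combination of brackets with degree 1
    functions. *)
Lemma euler_linear U x : open U -> U x -> exists V (l : seq (A V * A V)),
  [/\ open V, V x, V `<=` U, forall p, p \in l -> hom 1 p.1 /\ hom 1 p.2 &
   forall W (h : W `<=` V) k (b : A W), open W -> hom k b ->
     (forall f : A W, hom 0 f -> {{ f, b }} = 0) ->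
     b *+ k = \sum_(p <- l) res h p.1 * {{ res h p.2, b }}].
Proof.
move=> oU Ux.
have [V1 [r [a [y [oV1 V1x V1U hay H]]]]] := euler_hamiltonian S oU Ux.
pose z := \sum_(i < r) a i 0%N * y i 2%N.
have hz : hom 2 z.
  apply: hom_sum => // i _; rewrite -[2%N]add0n; apply: homM => //;
    by have [] := hay i 0%N; have [] := hay i 2%N.
have ha i k : hom k (a i k) by have [] := hay i k.
have hy i k : hom k (y i k) by have [] := hay i k.
have lead W (h : W `<=` V1) k (b : A W) : open W -> hom k b ->
    (forall f : A W, hom 0 f -> {{ f, b }} = 0) ->
    \sum_(i < r) res h (a i 0%N) * {{ res h (y i 2%N), b }} = {{ res h z, b }}.
  move=> oW hb b0; rewrite rmorph_sum br_suml //; apply: eq_bigr => i _.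
  have h0 := res_hom h oV1 oW (ha i 0%N); have h2 := res_hom h oV1 oW (hy i 2%N).
  have e : ~~ odd (2 * k) by rewrite oddM.
  by rewrite rmorphM (br_leibniz_lE oW e h0 h2 hb) (b0 _ h0) mul0r addr0.
have expand W (h : W `<=` V1) k (b : A W) : open W -> hom k b ->
    (forall f : A W, hom 0 f -> {{ f, b }} = 0) ->
    b *+ k = {{ res h z, b }} + \sum_(i < r) res h (a i 1%N) * {{ res h (y i 1%N), b }}.
  move=> oW hb b0; rewrite (H W h k b oW hb) -(lead W h k b oW hb b0) -big_split /=.
  apply: eq_bigr => i _; rewrite !big_ord_recl big_ord0 /= addr0.
  by rewrite [in X in _ + (_ + X)]b0 ?mulr0 ?addr0 //; apply: res_hom.
have [V [VV1 [oV Vx [l [hl el]]]]] : exists V (h : V `<=` V1),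
    [/\ open V, V x & quadratic (res h z)].
  apply: quadratic_of_anchor0 => // W h f oW sf; have hf := hom_emb S oW sf.
  have f0 g : hom 0 g -> {{ g, emb W f }} = 0 by move=> hg; exact: br00.
  have := expand W h 0%N _ oW hf f0; rewrite mulr0n big1 ?addr0 //.
  move=> i _; rewrite (br10 oW _ hf) ?mulr0 //; exact: res_hom.
(* The first two lists come from [{p1 * p2, b} = p1 * {p2, b} - p2 * {p1, b}], summed over the
   products in [z]; the third holds the original degree 1 terms. *)
exists V, (l ++ [seq (- p.2, p.1) | p <- l] ++
  [seq (res VV1 (a i 1%N), res VV1 (y i 1%N)) | i <- index_enum 'I_r]); split=> //.
- exact: subset_trans VV1 V1U.
- move=> p; rewrite !mem_cat => /or3P[/hl //|/mapP[q /hl[h1 h2] ->] /=|/mapP[i _ ->] /=].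
    by split=> //; apply: homN.
  by split; apply: res_hom.
move=> W h k b oW hb b0; have hV1 := subset_trans h VV1.
rewrite (expand W hV1 k b oW hb b0) !big_cat /= !big_map addrA.
congr (_ + _); last by apply: eq_bigr => i _ /=; rewrite !(res_comp VV1 h hV1).
rewrite -(res_comp VV1 h hV1) // el rmorph_sum br_suml // -big_split /= big_seq [RHS]big_seq.
apply: eq_bigr => p /hl [h1 h2].
rewrite rmorphM (br_odd_mul oW _ _ hb); try exact: res_hom.
by rewrite rmorphN mulNr.
Qed.

Lemma fn_eq0 U k (a : A U) : open U -> (0 < k)%N -> hom k a ->
  (forall V (h : V `<=` U) f, open V -> smooth_on V f -> {{ emb V f, res h a }} = 0) ->
  (forall V (h : V `<=` U) t, open V -> smooth V t -> {{ i1 V t, res h a }} = 0) ->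
  a = 0.
Proof.
move=> oU k0 ha a0 a1; apply: (sheaf_separated oU ha) => x Ux.
have [V [l [oV Vx VU hl H]]] := euler_linear oU Ux.
exists V, VU; split=> //.
have hr := res_hom VU oU oV ha.
apply: (mulrn_inj0 oV k0); rewrite (H V (fun=> id) k _ oV hr); last first.
  by move=> f /(emb_hom _ oV) [g sG ->]; apply: a0.
rewrite big_seq big1 // => p /hl [_ h2].
have [t st <-] := i1_surj oV (res_hom (fun=> id) oV oV h2).
by rewrite a1 // mulr0.
Qed.

End LocalStructure.

(** * Gluing of local data; the maps [dQ] and [dT] *)

Section Gluing.
Variables (R : realType) (n : nat) (M : manifold R n) (S : symplectic_lie2 M).
Variables (Q : vbundle M) (sg : splitting S Q).
Implicit Types (U V W : set M) (k l m : nat) (x : M).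

Local Notation A := (fn S).
Local Notation emb := (emb S).
Local Notation "{{ a , b }}" := (poisson (s := S) a b).
Local Notation QQ := (homological (s := S)).
Local Notation Qs := (dual_bundle Q).
Local Notation i1 := (i1 sg).
Local Notation i2 := (i2 sg).

Lemma local_section (E : prebundle M) (hE : is_vbundle E) U x (v : E x) : open U -> U x ->
  exists V s, [/\ open V, V x, V `<=` U, smooth V s & s x = v].
Proof.
move=> oU Ux; have [ext /(_ x)[[W [oW Wx se]] ex _]] := extension hE.
have oV := openI oU oW; exists (U `&` W), (ext x v); split=> //.
exact: (smooth_sub hE oW oV (@subIsetr _ U W)).
Qed.

(** The family lives on a class [dom] of open sets closed under passing to open subsets, typically
    those on which given total sections are smooth; elsewhere [e] may be anything. *)
Definition coherent k (dom : set M -> Prop) (e : forall U, A U) : Prop :=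
  forall U, dom U -> [/\ open U, hom k (e U) &
    forall V (h : V `<=` U), open V -> dom V /\ res h (e U) = e V].

Lemma glue_functions dom e : coherent 0 dom e ->
  exists f, forall U, dom U -> smooth_on U f /\ emb U f = e U.
Proof.
move=> co; pose P U (f : M -> R) := [/\ dom U, smooth_on U f & emb U f = e U].
have [|f fP] := glue_sections (T := fun=> R) (fun=> 0) (P := P).
  move=> U V f g [dU sf ef] [dV sG eg] x Ux Vx.
  have [oU _ rU] := co U dU; have [oV _ rV] := co V dV.
  have oUV := openI oU oV.
  have h1 := @subIsetl _ U V; have h2 := @subIsetr _ U V.
  have := emb_inj (S := S) oUV (smooth_on_sub h1 sf) (smooth_on_sub h2 sG).
  apply; last by split.
  rewrite -(emb_res S h1) // -(emb_res S h2) // ef eg.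
  by have [_ ->] := rU _ h1 oUV; have [_ ->] := rV _ h2 oUV.
exists f => U dU; have [oU hU _] := co U dU.
have [g sG eg] := (emb_hom _ oU).1 hU.
have Pg : P U g by split.
have E x : U x -> g x = f x by apply: fP Pg x.
by split; [apply: smooth_on_eq oU sG E|rewrite -(emb_ext S oU sG E)].
Qed.

Lemma glue_deg1 dom e : coherent 1 dom e ->
  exists t : sect Qs, forall U, dom U -> smooth U t /\ i1 U t = e U.
Proof.
move=> co; pose P U (t : sect Qs) := [/\ dom U, smooth U t & i1 U t = e U].
have [|f fP] := glue_sections (T := fun x => Qs x) (fun x => 0) (P := P).
  move=> U V f g [dU sf ef] [dV sG eg] x Ux Vx.
  have [oU _ rU] := co U dU; have [oV _ rV] := co V dV.
  have oUV := openI oU oV.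
  have h1 := @subIsetl _ U V; have h2 := @subIsetr _ U V.
  have s1 := smooth_sub (Qs_vbundle Q) oU oUV h1 sf.
  have s2 := smooth_sub (Qs_vbundle Q) oV oUV h2 sG.
  have := i1_inj (sg := sg) oUV s1 s2; apply; last by split.
  rewrite -(i1_res sg h1) // -(i1_res sg h2) // ef eg.
  by have [_ ->] := rU _ h1 oUV; have [_ ->] := rV _ h2 oUV.
exists f => U dU; have [oU hU _] := co U dU.
have [g sG eg] := i1_surj sg oU hU.
have Pg : P U g by split.
have E : eq_on U g f by apply: fP Pg.
have sf := smooth_eq_on (Qs_vbundle Q) oU sG E.
by split=> //; rewrite -(i1_eq sg oU sG sf E).
Qed.

Lemma glue_anchor dom e : coherent 2 dom e ->
  exists X : sect (TM M), forall U, dom U -> smooth U X /\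
    forall f, smooth_on U f -> {{ e U, emb U f }} = emb U (lie X f).
Proof.
move=> co.
pose P U (X : sect (TM M)) := [/\ dom U, smooth U X &
  forall V f, open V -> V `<=` U -> smooth_on V f ->
   {{ e V, emb V f }} = emb V (lie X f)].
have [|X XP] := glue_sections (T := fun x => TM M x) (fun x => 0) (P := P).
  move=> U V f g [dU sf ef] [dV sG eg] x Ux Vx.
  have [oU _ rU] := co U dU; have [oV _ rV] := co V dV.
  have oUV := openI oU oV.
  have h1 := @subIsetl _ U V; have h2 := @subIsetr _ U V.
  have s1 := smooth_sub (T_vbundle sg) oU oUV h1 sf.
  have s2 := smooth_sub (T_vbundle sg) oV oUV h2 sG.
  have := anchor_unique (S := S) oUV s1 s2; apply; last by split.
  move=> W k oW WUV sk; rewrite -ef // -?eg //; exact: subset_trans WUV _.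
exists X => U dU; have [oU hU rU] := co U dU.
have [Y sY eY] := anchor_exists sg oU hU.
have PY : P U Y.
  split=> // V f oV VU sf; rewrite -(eY V VU f oV sf).
  by have [_ ->] := rU V VU oV.
have E : eq_on U Y X by apply: XP PY.
split; first exact: (smooth_eq_on (T_vbundle sg) oU sY E).
move=> f sf; have [_ _ ->] := PY; [|by []|by []|by []].
apply: emb_ext => //; first exact: sY.
by move=> x Ux; rewrite /lie E.
Qed.

(** The last hypothesis is tensoriality with values in degree 0 functions. It includes locality,
    since [u] is compared with the combination over [U] only. *)
Lemma glue_dual (E : prebundle M) (hE : is_vbundle E) (dom : set M -> Prop)
    (e : forall U, sect E -> A U) :
  (forall U, dom U -> open U) ->
  (forall U V, dom U -> open V -> V `<=` U -> dom V) ->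
  (forall U s, dom U -> smooth U s -> hom 0 (e U s)) ->
  (forall U V (h : V `<=` U) s, dom U -> open V -> smooth U s -> res h (e U s) = e V s) ->
  (forall U f s t u, dom U -> smooth_on U f -> smooth U s -> smooth U t ->
     eq_on U u (sadd (smul f s) t) -> e U u = emb U f * e U s + e U t) ->
  exists a : sect (dual_bundle E), forall U, dom U ->
    smooth U a /\ forall s, smooth U s -> emb U (pairing a s) = e U s.
Proof.
move=> dO dS he re ce.
(* The values over the various domains are first glued, for each total section [s], to a single
   function [K s], on which tensoriality at a point makes sense. *)
have /choice[K KP] : forall s, exists f, forall U, dom U /\ smooth U s ->
    smooth_on U f /\ emb U f = e U s.
  move=> s; apply: glue_functions => U [dU ss]; have oU := dO U dU.
  split; [exact: oU|exact: he|move=> V h oV].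
  have ssV := smooth_sub hE oU oV h ss.
  by split; [split=> //; apply: dS h|apply: re].
have [a aP] := tensorial_dual hE K.
have aE U s x : dom U -> smooth U s -> U x -> K s x = a x (s x).
  move=> dU ss Ux; have oU := dO U dU; apply: (aP x _ U) => // V f s1 t u oV Vx sf s1s st eu.
  have oW := openI oU oV; set W := U `&` V in oW.
  have h1 : W `<=` U by move=> y [].
  have h2 : W `<=` V by move=> y [].
  have dW := dS U W dU oW h1; have sfW := smooth_on_sub h2 sf.
  have s1W := smooth_sub hE oV oW h2 s1s; have stW := smooth_sub hE oV oW h2 st.
  have euW : eq_on W u (sadd (smul f s1) t) by move=> y /h2; apply: eu.
  have suW : smooth W u.
    by apply: (smooth_eq_on hE oW (smooth_comb hE oW sfW s1W stW)) => y Wy; rewrite euW.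
  have [k1 e1] := KP s1 W (conj dW s1W); have [k2 e2] := KP t W (conj dW stW).
  have [k3 e3] := KP u W (conj dW suW).
  have := emb_inj (S := S) oW k3 (smoothD oW (smoothM oW sfW k1) k2); apply; last by split.
  by rewrite embD ?embM // ?e1 ?e2 ?e3; [apply: ce|apply: smoothM].
exists a => U dU; have oU := dO U dU; split=> [V s oV VU ss|s ss].
  have dV := dS U V dU oV VU; have [k _] := KP s V (conj dV ss).
  by apply: (smooth_on_eq oV k) => x Vx; apply: (aE V).
have [k <-] := KP s U (conj dU ss); symmetry; apply: emb_ext => // x Ux.
exact: (aE U).
Qed.

Lemma glue_bidual (E : prebundle M) (hE : is_vbundle E) (dom : set M -> Prop)
    (e : forall U, sect (dual_bundle E) -> A U) :
  (forall U, dom U -> open U) ->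
  (forall U V, dom U -> open V -> V `<=` U -> dom V) ->
  (forall U s, dom U -> smooth U s -> hom 0 (e U s)) ->
  (forall U V (h : V `<=` U) s, dom U -> open V -> smooth U s -> res h (e U s) = e V s) ->
  (forall U f s t u, dom U -> smooth_on U f -> smooth U s -> smooth U t ->
     eq_on U u (sadd (smul f s) t) -> e U u = emb U f * e U s + e U t) ->
  exists q : sect E, forall U, dom U ->
    smooth U q /\ forall t, smooth U t -> emb U (pairing t q) = e U t.
Proof.
move=> dO dS he re ce.
have [a aP] := glue_dual (dual_is_vbundle hE) dO dS he re ce.
have H x : exists v : E x, forall tau : dual (E x), a x tau = tau v.
  by apply: (bidual_surj hE) => c u v; apply: dual_linear.
have qE x : forall tau : dual (E x), a x tau = tau (projT1 (cid (H x))).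
  exact: projT2 (cid (H x)).
exists (fun x => projT1 (cid (H x))) => U dU; have oU := dO U dU.
have pE t x : pairing t (fun x => projT1 (cid (H x))) x = pairing a t x by rewrite /pairing qE.
have [sa ea] := aP U dU; split=> [|t st].
  apply: (smooth_by_pairing hE) => // V t oV VU st.
  by apply: (smooth_on_eq oV (sa V t oV VU st)) => x _; rewrite pE.
by rewrite -ea //; congr (emb U _); apply/funext => x; rewrite pE.
Qed.

Lemma covector_ext (E : prebundle M) (hE : is_vbundle E) U (a c : sect (dual_bundle E)) :
  open U -> smooth U a -> smooth U c ->
  (forall V s, open V -> V `<=` U -> smooth V s ->
     emb V (pairing a s) = emb V (pairing c s)) -> eq_on U a c.
Proof.
move=> oU sa sc H x Ux; apply: dual_ext => v.
have [V [s [oV Vx VU ss <-]]] := local_section hE v oU Ux.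
have saV := sa V s oV VU ss; have scV := sc V s oV VU ss.
exact: (emb_inj (S := S) oV saV scV (H V s oV VU ss) Vx).
Qed.

Lemma section_ext U (p q : sect Q) : open U -> smooth U p -> smooth U q ->
  (forall V t, open V -> V `<=` U -> smooth V t ->
     emb V (pairing t p) = emb V (pairing t q)) -> eq_on U p q.
Proof.
move=> oU sp sq H x Ux; apply: (dual_separates (Q_vbundle Q)) => a.
have [V [t [oV Vx VU st <-]]] := local_section (Qs_vbundle Q) (a : Qs x) oU Ux.
have spV := smooth_sub (Q_vbundle Q) oU oV VU sp.
have sqV := smooth_sub (Q_vbundle Q) oU oV VU sq.
exact: (emb_inj (S := S) oV (pairing_smooth oV st spV) (pairing_smooth oV st sqV) (H V t oV VU st) Vx).
Qed.

Lemma dQ_exists : exists dQ : bhom Qs Q, is_dQ sg dQ.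
Proof.
have hQ := Q_vbundle Q; have hQs := Qs_vbundle Q.
have /choice[op opP] : forall s : sect Qs, exists q : sect Q, forall U, open U /\ smooth U s ->
    smooth U q /\ forall t, smooth U t -> emb U (pairing t q) = {{ i1 U s, i1 U t }}.
  move=> s; apply: (glue_bidual hQ).
  - by move=> U [].
  - by move=> U V [oU ss] oV VU; split=> //; apply: (smooth_sub hQs oU oV).
  - by move=> U t [oU ss] st; apply: (@hom_br _ _ _ _ _ oU 1 1); apply: i1_hom.
  - by move=> U V h t [oU ss] oV st; rewrite res_br // !i1_res.
  move=> U f t t' u [oU ss] sf st st' e.
  have sft := smooth_smul hQs oU sf st; have sc := smooth_sadd hQs oU sft st'.
  have su : smooth U u by apply: (smooth_eq_on hQs oU sc) => y Uy; rewrite e.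
  have hs := i1_hom sg oU ss; have hf := hom_emb S oU sf.
  by rewrite (i1_eq sg oU su sc e) i1D // i1Z // brDr // (brZr0 oU _ hs hf (br10 oU hs hf)).
have [dQ dQE] : exists phi : bhom Qs Q,
    forall U s, open U -> smooth U s -> eq_on U (app phi s) (op s).
  apply: (tensorial_bhom hQs hQ); last by move=> U s oU ss; have [] := opP s U (conj oU ss).
  move=> x U f s s' u oU Ux sf ss ss' e.
  have sc := smooth_comb hQs oU sf ss ss'.
  have su : smooth U u by apply: (smooth_eq_on hQs oU sc) => y Uy; rewrite e.
  have [k1 _] := opP s U (conj oU ss); have [k2 _] := opP s' U (conj oU ss').
  have [k3 _] := opP u U (conj oU su).
  suff : eq_on U (op u) (sadd (smul f (op s)) (op s')) by apply.
  apply: section_ext => //; first exact: (smooth_comb hQ).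
  move=> V t oV VU st; have sfV := smooth_on_sub VU sf.
  have ssV := smooth_sub hQs oU oV VU ss; have ssV' := smooth_sub hQs oU oV VU ss'.
  have suV := smooth_sub hQs oU oV VU su; have scV := smooth_sub hQs oU oV VU sc.
  have sfs := smooth_smul hQs oV sfV ssV.
  have eV : eq_on V u (sadd (smul f s) s') by move=> y /VU; apply: e.
  have [j1 e1] := opP s V (conj oV ssV); have [j2 e2] := opP s' V (conj oV ssV').
  have [_ -> //] := opP u V (conj oV suV).
  have hf := hom_emb S oV sfV; have hs := i1_hom sg oV ssV; have ht := i1_hom sg oV st.
  rewrite (i1_eq sg oV suV scV eV) i1D // i1Z // brDl // (brZl0 oV hf hs ht (br01 oV hf ht)).
  have p1 := pairing_smooth oV st j1; have p2 := pairing_smooth oV st j2.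
  have m1 := smoothM oV sfV p1.
  rewrite -e1 // -e2 // -embM // -embD //; apply: emb_ext; [exact: oV|exact: smoothD|].
  by move=> y Vy; rewrite /pairing /sadd /smul dualD dualZ.
exists dQ => U s t oU ss st; have [sq <-] := opP s U (conj oU ss); last by [].
apply: emb_ext; [exact: oU|exact: pairing_smooth|].
by move=> x Ux; rewrite /pairing (dQE U s oU ss x Ux).
Qed.

Section Inverse.
Variables (dQ : bhom Qs Q) (dQP : is_dQ sg dQ).

Lemma app_smooth (E F : prebundle M) (phi : bhom E F) U s : open U -> smooth U s ->
  smooth (p := F) U (app phi s).
Proof. exact: bmap_smooth. Qed.

Lemma dQ_pairing_smooth U s t : open U -> smooth U s -> smooth U t ->
  smooth_on U (pairing t (app dQ s)).
Proof. by move=> oU ss st; apply: pairing_smooth => //; apply: app_smooth. Qed.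

Lemma dQ_sym x (s t : dual (Q x)) : t (dQ x s) = s (dQ x t).
Proof.
have hQs := Qs_vbundle Q.
have [U [s' [oU Ux _ ss <-]]] := local_section hQs (s : Qs x) openT I.
have [V [t' [oV Vx VU st <-]]] := local_section hQs (t : Qs x) oU Ux.
have ssV := smooth_sub hQs oU oV VU ss.
have := emb_inj (S := S) oV (dQ_pairing_smooth oV ssV st) (dQ_pairing_smooth oV st ssV).
apply=> //; rewrite -!dQP //; by apply: (br_symO oV (k := 1) (l := 1)) => //; exact: i1_hom.
Qed.

Lemma dQ_local_inverse x : exists V (I : Type) (l : seq I) (a s : I -> sect Qs),
  [/\ open V, V x, forall i, smooth V (a i) /\ smooth V (s i) &
   forall y, V y -> forall t : dual (Q y),
     t = \sum_(i <- l) t (dQ y (s i y)) *: (a i y : dual (Q y))].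
Proof.
have hQs := Qs_vbundle Q.
have [V [l [oV Vx _ hl H]]] := euler_linear sg openT (I : setT x).
(* The index type consists of all pairs of elements, homogeneous or not; elements not of degree 1
   receive the section 0. *)
have sec (a : A V) : exists t, smooth V t /\ (hom 1 a -> i1 V t = a).
  have [/(i1_surj sg oV)[t st et]|na] := pselect (hom 1 a); first by exists t.
  by exists (fun=> 0); split=> //; apply: (smooth0 hQs).
have [sc scP] := choice sec.
exists V, _, l, (fun p => sc p.1), (fun p => sc p.2); split=> //.
  by move=> p; split; [have [] := scP p.1|have [] := scP p.2].
move=> y Vy t.
have [W [t' [oW Wy WV st <-]]] := local_section hQs (t : Qs y) oV Vy.
have sc1 p : smooth W (sc p) by have [? _] := scP p; apply: (smooth_sub hQs oV).
pose g (p : A V * A V) := pairing t' (app dQ (sc p.2)).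
have sG p : smooth_on W (g p) by apply: dQ_pairing_smooth.
have E : eq_on W t' (fun x => \sum_(p <- l) g p x *: sc p.1 x).
  apply: (i1_inj (sg := sg) oW) => //.
    by apply: (smooth_sum_sect hQs) => // p; apply: (smooth_smul hQs).
  rewrite (@i1_sum _ _ _ _ _ _ _ oW _ _ g (fun p => sc p.1)) //.
  have ht := i1_hom sg oW st.
  have := H _ WV 1%N _ oW ht; rewrite mulr1n => -> //; last by move=> f hf; apply: br01.
  rewrite big_seq [RHS]big_seq; apply: eq_bigr => p /hl [p1 p2].
  have [s1 e1] := scP p.1; have [s2 e2] := scP p.2.
  have eg : emb W (g p) = {{ res WV p.2, i1 W t' }}.
    by rewrite -dQP // -(i1_res sg WV) // e2.
  rewrite -(i1_res sg WV oV oW s1) e1 // eg.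
  have q1 := res_hom WV oV oW p1; have q2 := res_hom WV oV oW p2.
  exact: (fn_commE oW (k := 1) (l := 0) isT q1 (hom_br oW q2 ht)).
exact: (E y).
Qed.

Lemma dQ_inj x (s t : dual (Q x)) : dQ x s = dQ x t -> s = t.
Proof.
move=> e; have [V [I [l [a [u [oV Vx _ H]]]]]] := dQ_local_inverse x.
rewrite (H x Vx s) (H x Vx t); apply: eq_bigr => i _.
by rewrite !(dQ_sym (u i x)) e.
Qed.

(** Transposing the formula of [dQ_local_inverse] gives [q = dQ] of the sum of [a i (q) * s i],
    which is surjectivity. By injectivity the inverses chosen in each fibre are given by this
    formula on a whole neighbourhood, hence are smooth. *)
Lemma dQ_inverse : exists psi : bhom Q Qs,
  (forall x, cancel (dQ x) (psi x)) /\ (forall x, cancel (psi x) (dQ x)).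
Proof.
have hQs := Qs_vbundle Q.
have sur V (I : Type) (l : seq I) (a s : I -> sect Qs) y : (forall t : dual (Q y),
     t = \sum_(i <- l) t (dQ y (s i y)) *: (a i y : dual (Q y))) ->
   forall q, q = dQ y (\sum_(i <- l) (a i y : dual (Q y)) q *: s i y).
  move=> H q; apply: (dual_separates (Q_vbundle Q)) => t.
  rewrite linear_sum dual_sum {1}(H t) sumd; apply: eq_bigr => i _.
  by rewrite linearZ dualZ scaled mulrC.
have ex x : exists psi : {linear Q x -> Qs x}, cancel (psi) (dQ x).
  have [V [I [l [a [u [oV Vx _ H]]]]]] := dQ_local_inverse x.
  have [|psi psiE] := linear_of (W := Qs x) (f := fun q : Q x =>
      \sum_(i <- l) (a i x : dual (Q x)) q *: u i x).
    move=> c v w; rewrite scaler_sumr -big_split; apply: eq_bigr => i _ /=.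
    by rewrite dual_linear scalerDl scalerA.
  by exists psi => q; rewrite psiE -(sur V I l a u x (H x Vx)).
pose psi x := projT1 (cid (ex x)).
have psiK x : cancel (psi x) (dQ x) by exact: (projT2 (cid (ex x))).
have spsi U (q : sect Q) : open U -> smooth U q -> smooth (p := Qs) U (fun x => psi x (q x)).
  move=> oU sq; apply: (smooth_local hQs) => // x Ux.
  have [V [I [l [a [u [oV Vx sau H]]]]]] := dQ_local_inverse x.
  have oVU := openI oV oU.
  have h1 := @subIsetl _ V U; have h2 := @subIsetr _ V U.
  exists (V `&` U); split=> //.
  have s1 : smooth (p := Qs) (V `&` U)
      (fun y => \sum_(i <- l) pairing (a i) q y *: u i y).
    apply: (smooth_sum_sect hQs) => // i; have [sa su] := sau i.
    apply: (smooth_smul hQs) => //; last exact: (smooth_sub hQs oV).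
    apply: pairing_smooth => //; first exact: (smooth_sub hQs oV).
    exact: (smooth_sub (Q_vbundle Q) oU).
  apply: (smooth_eq_on hQs oVU s1) => y [Vy Uy].
  by apply: dQ_inj; rewrite psiK -(sur V I l a u y (H y Vy)).
exists (BHom spsi); split=> // x t; apply: dQ_inj; exact: psiK.
Qed.

Lemma dQ_biso : is_biso dQ.
Proof. by have [psi [k1 k2]] := dQ_inverse; exists psi. Qed.

End Inverse.

(** A description of $\partial_{TM}$ that refers to no structure maps. It can thus be used both to
    construct them and, through [data_dTM], to compute with given ones. *)
Definition is_dTM (dT : bhom Qs (TM M)) : Prop := forall U t f,
  open U -> smooth U t -> smooth_on U f ->
  {{ QQ (i1 U t), emb U f }} = emb U (lie (app dT t) f).

Lemma dTM_exists : exists dT : bhom Qs (TM M), is_dTM dT.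
Proof.
have hQs := Qs_vbundle Q; have hT := T_vbundle sg.
have /choice[op opP'] : forall t : sect Qs, exists X : sect (TM M), forall U,
    open U /\ smooth U t -> smooth U X /\
    forall f, smooth_on U f -> {{ QQ (i1 U t), emb U f }} = emb U (lie X f).
  move=> t; apply: glue_anchor => U [oU st]; split=> //.
    exact: (homQ oU (i1_hom sg oU st)).
  move=> V h oV; split; last by rewrite res_Q // i1_res.
  by split=> //; apply: (smooth_sub hQs oU oV).
have opP U t oU st := opP' t U (conj oU st).
have [dT dTE] : exists phi : bhom Qs (TM M),
    forall U s, open U -> smooth U s -> eq_on U (app phi s) (op s).
  apply: (tensorial_bhom hQs hT).
    move=> x U f s t r oU Ux sf ss st e.
    have sc := smooth_comb hQs oU sf ss st.
    have sr : smooth U r by apply: (smooth_eq_on hQs oU sc) => y Uy; rewrite e.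
    have [sop _] := opP U r oU sr; have [sop1 _] := opP U s oU ss; have [sop2 _] := opP U t oU st.
    suff : eq_on U (op r) (sadd (smul f (op s)) (op t)) by apply.
    apply: (anchor_unique (S := S)) => //; first exact: (smooth_comb hT).
    move=> V g oV VU sG.
    have sf1 := smooth_on_sub VU sf.
    have ss1 := smooth_sub hQs oU oV VU ss; have st1 := smooth_sub hQs oU oV VU st.
    have sr1 := smooth_sub hQs oU oV VU sr; have sc1 := smooth_sub hQs oU oV VU sc.
    have [_ <- //] := opP V r oV sr1.
    have [p1 e1] := opP V s oV ss1; have [p2 e2] := opP V t oV st1.
    have -> : emb V (lie (sadd (smul f (op s)) (op t)) g) =
        emb V f * emb V (lie (op s) g) + emb V (lie (op t) g).
      rewrite -embM // -?embD //; try exact: p1; try exact: p2.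
      by apply: smoothM => //; apply: p1.
    have e' : eq_on V r (sadd (smul f s) t) by move=> y /VU; apply: e.
    rewrite (i1_eq sg oV sr1 sc1 e') i1D //; last exact: (smooth_smul hQs).
    have hf := hom_emb S oV sf1; have hg := hom_emb S oV sG.
    have hs := i1_hom sg oV ss1.
    rewrite i1Z // QD // Q_leibniz0 // !brDl // -e1 // -e2 //; congr (_ + _).
    (* The derivative term [Q f * s] in [Q (f * s)] is a product of degree 1 functions and commutes
       with [g]; this is why the anchor is linear over functions. *)
    rewrite (br_odd_mul oV (homQ oV hf) hs hg) (br10 oV hs hg) (br10 oV (homQ oV hf) hg).
    rewrite !mulr0 subr0 add0r (brZl0 oV hf (homQ oV hs) hg) //; exact: br00.
  by move=> U s oU ss; have [] := opP U s oU ss.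
exists dT => U t f oU st sf; have [sop ->] := opP U t oU st; last by [].
apply: emb_ext => //; first exact: sop.
by move=> x Ux; rewrite /lie (dTE U t oU st).
Qed.

End Gluing.

(** * Contraction of alternating coefficients with Kronecker deltas *)

Section FrameSums.
Variables (R : comNzRingType) (r : nat).

Lemma sum_lt2 (c : 'I_r -> 'I_r -> R) (a b : 'I_r) :
  \sum_(i < r) \sum_(j < r | (i < j)%N) c i j * ((i == a)%:R * (j == b)%:R) =
  if (a < b)%N then c a b else 0.
Proof.
rewrite (bigD1 a) //= [X in _ + X]big1 ?addr0; last first.
  by move=> i /negbTE na; rewrite big1 // => j _; rewrite na mul0r mulr0.
case: ifP => ab; last first.
  rewrite big1 // => j aj; rewrite eqxx; case: eqP => [e|_]; last by rewrite !mulr0.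
  by rewrite e ab in aj.
rewrite (bigD1 b) //= !eqxx !mulr1 big1 ?addr0 // => j /andP[_ /negbTE ->].
by rewrite !mulr0.
Qed.

Lemma sum_lt3 (w : 'I_r -> 'I_r -> 'I_r -> R) (a b c : 'I_r) :
  \sum_(i < r) \sum_(j < r | (i < j)%N) \sum_(k < r | (j < k)%N)
    w i j k * ((i == a)%:R * ((j == b)%:R * (k == c)%:R)) =
  if (a < b < c)%N then w a b c else 0.
Proof.
rewrite (eq_bigr (fun i : 'I_r => \sum_(j < r | (i < j)%N)
    (if (j < c)%N then w i j c else 0) * ((i == a)%:R * (j == b)%:R))).
  rewrite sum_lt2; by case: (a < b)%N.
move=> i _; apply: eq_bigr => j _.
rewrite (eq_bigr (fun k : 'I_r => ((i == a)%:R * (j == b)%:R) * (w i j k * (k == c)%:R))).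
  rewrite -mulr_sumr [RHS]mulrC; congr (_ * _).
  case: ifP => jc; last first.
    rewrite big1 // => k jk; case: eqP => [e|_]; last by rewrite !mulr0.
    by rewrite e jc in jk.
  rewrite (bigD1 c) //= !eqxx !mulr1 big1 ?addr0 // => k /andP[_ /negbTE ->].
  by rewrite !mulr0.
by move=> k _; ring.
Qed.

End FrameSums.

Section AlternatingSums.
Variables (R : realType) (r : nat).

(** Only one of the two deltas meets the range [i < j], according to the order of [a] and [b], and
    skew-symmetry corrects the sign. For [a = b] no term survives and [c a a] is zero. *)
Lemma alternating_sum2 (c : 'I_r -> 'I_r -> R) (a b : 'I_r) :
  (forall i j, c i j = - c j i) ->
  \sum_(i < r) \sum_(j < r | (i < j)%N)
    c i j * ((i == a)%:R * (j == b)%:R - (j == a)%:R * (i == b)%:R) = c a b.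
Proof.
move=> sk.
rewrite (eq_bigr (fun i : 'I_r => \sum_(j < r | (i < j)%N) c i j * ((i == a)%:R * (j == b)%:R)
  - \sum_(j < r | (i < j)%N) c i j * ((i == b)%:R * (j == a)%:R))); last first.
  by move=> i _; rewrite -sumrB; apply: eq_bigr => j _; rewrite mulrBr [(j == a)%:R * _]mulrC.
rewrite sumrB !sum_lt2; case: (ltngtP a b) => ab.
- by rewrite subr0.
- by rewrite sub0r -sk.
have -> : a = b by apply: val_inj.
rewrite subr0; have := sk b b; lra.
Qed.

(** The six products are the signed permutations of three deltas, grouped as the Leibniz rule
    produces them in [adapted_br3]. For distinct [a], [b], [c] exactly one of them meets
    [i < j < k]; otherwise none does, and [w a b c] vanishes by skew-symmetry. *)
Lemma alternating_sum3 (w : 'I_r -> 'I_r -> 'I_r -> R) (a b c : 'I_r) :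
  (forall i j k, w i j k = - w j i k) -> (forall i j k, w i j k = - w i k j) ->
  \sum_(i < r) \sum_(j < r | (i < j)%N) \sum_(k < r | (j < k)%N) w i j k *
    ((i == a)%:R * ((j == b)%:R * (k == c)%:R - (k == b)%:R * (j == c)%:R)
     - ((i == b)%:R * ((j == a)%:R * (k == c)%:R) - (i == c)%:R * ((j == a)%:R * (k == b)%:R))
     + ((i == b)%:R * ((j == c)%:R * (k == a)%:R) - (i == c)%:R * ((j == b)%:R * (k == a)%:R)))
  = w a b c.
Proof.
move=> s12 s23.
transitivity (
  (if (a < b < c)%N then w a b c else 0) - (if (a < c < b)%N then w a c b else 0)
  - (if (b < a < c)%N then w b a c else 0) + (if (c < a < b)%N then w c a b else 0)
  + (if (b < c < a)%N then w b c a else 0) - (if (c < b < a)%N then w c b a else 0)).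
  rewrite -!sum_lt3 -!(sumrB, big_split) /=; apply: eq_bigr => i _.
  rewrite -!(sumrB, big_split) /=; apply: eq_bigr => j _.
  rewrite -!(sumrB, big_split) /=; apply: eq_bigr => k _; ring.
have e1 : w a c b = - w a b c by rewrite s23.
have e2 : w b a c = - w a b c by rewrite s12.
have e3 : w c a b = w a b c by rewrite s12 s23 opprK.
have e4 : w b c a = w a b c by rewrite s23 e2 opprK.
have e5 : w c b a = - w a b c by rewrite s12 e4.
rewrite e1 e2 e3 e4 e5.
have dab : a = b :> nat -> w a b c = 0.
  by move=> /val_inj e; have := s12 a b c; rewrite -e; lra.
have dbc : b = c :> nat -> w a b c = 0.
  by move=> /val_inj e; have := s23 a b c; rewrite -e; lra.
have dac : a = c :> nat -> w a b c = 0.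
  move=> /val_inj e; have := e5; rewrite -e; lra.
case: (ltngtP a b) => ab; case: (ltngtP b c) => bc; case: (ltngtP a c) => ac /=;
  rewrite ?(dab ab) ?(dbc bc) ?(dac ac); first [lra | exfalso; lia].
Qed.

End AlternatingSums.

(** * Degree bookkeeping *)

Section HomogeneousDegrees.
Variables (R : realType) (n : nat) (M : manifold R n) (S : symplectic_lie2 M).
Variables (U : set M).
Implicit Types (a b : fn S U).
Local Notation "{{ a , b }}" := (poisson (s := S) a b).

(** Instances at the degrees that occur, for proof search: unification cannot solve for the degrees
    in [k + l - 2]. *)
Lemma hom_br11 a b : open U -> hom 1 a -> hom 1 b -> hom 0 {{ a, b }}.
Proof. by move=> oU; apply: (@hom_br _ _ _ _ _ oU 1 1). Qed.
Lemma hom_br20 a b : open U -> hom 2 a -> hom 0 b -> hom 0 {{ a, b }}.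
Proof. by move=> oU; apply: (@hom_br _ _ _ _ _ oU 2 0). Qed.
Lemma hom_br02 a b : open U -> hom 0 a -> hom 2 b -> hom 0 {{ a, b }}.
Proof. by move=> oU; apply: (@hom_br _ _ _ _ _ oU 0 2). Qed.
Lemma hom_br21 a b : open U -> hom 2 a -> hom 1 b -> hom 1 {{ a, b }}.
Proof. by move=> oU; apply: (@hom_br _ _ _ _ _ oU 2 1). Qed.
Lemma hom_br12 a b : open U -> hom 1 a -> hom 2 b -> hom 1 {{ a, b }}.
Proof. by move=> oU; apply: (@hom_br _ _ _ _ _ oU 1 2). Qed.
Lemma hom_br22 a b : open U -> hom 2 a -> hom 2 b -> hom 2 {{ a, b }}.
Proof. by move=> oU; apply: (@hom_br _ _ _ _ _ oU 2 2). Qed.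
Lemma hom_br13 a b : open U -> hom 1 a -> hom 3 b -> hom 2 {{ a, b }}.
Proof. by move=> oU; apply: (@hom_br _ _ _ _ _ oU 1 3). Qed.
Lemma hom_br30 a b : open U -> hom 3 a -> hom 0 b -> hom 1 {{ a, b }}.
Proof. by move=> oU; apply: (@hom_br _ _ _ _ _ oU 3 0). Qed.
Lemma hom_br03 a b : open U -> hom 0 a -> hom 3 b -> hom 1 {{ a, b }}.
Proof. by move=> oU; apply: (@hom_br _ _ _ _ _ oU 0 3). Qed.
Lemma homQ0 a : open U -> hom 0 a -> hom 1 (homological a).
Proof. by move=> oU; apply: homQ. Qed.
Lemma homQ1 a : open U -> hom 1 a -> hom 2 (homological a).
Proof. by move=> oU; apply: homQ. Qed.
Lemma homQ2 a : open U -> hom 2 a -> hom 3 (homological a).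
Proof. by move=> oU; apply: homQ. Qed.
Lemma homM0 k a b : open U -> hom 0 a -> hom k b -> hom k (a * b).
Proof. by move=> oU ha hb; rewrite -[k]add0n; apply: homM. Qed.
Lemma homM11 a b : open U -> hom 1 a -> hom 1 b -> hom 2 (a * b).
Proof. by move=> oU; apply: (@homM _ _ _ S U 1 1). Qed.
Lemma homM12 a b : open U -> hom 1 a -> hom 2 b -> hom 3 (a * b).
Proof. by move=> oU; apply: (@homM _ _ _ S U 1 2). Qed.
Lemma homM21 a b : open U -> hom 2 a -> hom 1 b -> hom 3 (a * b).
Proof. by move=> oU; apply: (@homM _ _ _ S U 2 1). Qed.

Lemma br11C a b : open U -> hom 1 a -> hom 1 b -> {{ a, b }} = {{ b, a }}.
Proof. by move=> oU ha hb; apply: (br_symO oU _ ha hb). Qed.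
Lemma br2skew k a b : open U -> hom 2 a -> hom k b -> {{ a, b }} = - {{ b, a }}.
Proof. by move=> oU ha hb; apply: (br_skewE oU _ ha hb); rewrite oddM. Qed.
Lemma br0skew k a b : open U -> hom 0 a -> hom k b -> {{ a, b }} = - {{ b, a }}.
Proof. by move=> oU ha hb; apply: (br_skewE oU _ ha hb); rewrite oddM. Qed.
Lemma br2jacobi k a b c : open U -> hom 2 a -> hom k b ->
  {{ a, {{ b, c }} }} = {{ {{ a, b }}, c }} + {{ b, {{ a, c }} }}.
Proof. by move=> oU ha hb; apply: (br_jacobiE oU _ _ ha hb); rewrite oddM. Qed.
Lemma br11jacobi a b c : open U -> hom 1 a -> hom 1 b ->
  {{ a, {{ b, c }} }} = {{ {{ a, b }}, c }} - {{ b, {{ a, c }} }}.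
Proof. by move=> oU ha hb; apply: (br_jacobiO oU _ _ ha hb). Qed.

End HomogeneousDegrees.

Create HintDb homdb.
#[export] Hint Resolve hom_br11 hom_br20 hom_br02 hom_br21 hom_br12 hom_br22 hom_br13
  hom_br30 hom_br03 homQ0 homQ1 homQ2 homM0 homM11 homM12 homM21
  hom_emb i1_hom i2_hom homN homD homB : homdb.
Ltac hm := solve [eauto 15 with homdb].

Section FrameInduction.
Variables (R : realType) (n : nat) (M : manifold R n) (E : prebundle M) (hE : is_vbundle E).

Lemma frame_ind V r (e : 'I_r -> sect E) (P : sect E -> Prop) : open V -> frame V e ->
  (forall s, eq_on V s (fun=> 0) -> P s) -> (forall i, P (e i)) ->
  (forall f s t u, smooth_on V f -> smooth V s -> smooth V t -> P s -> P t ->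
     eq_on V u (sadd (smul f s) t) -> P u) ->
  forall s, smooth V s -> P s.
Proof.
move=> oV fr P0 Pe Pc s ss.
have [/(_ ss) [g sg eg] _] := fr.2 V oV (fun=> id) s.
suff H (l : seq 'I_r) u : eq_on V u (fun y => \sum_(i <- l) g i y *: e i y) -> P u.
  exact: H eg.
elim: l u => [|i l IH] u eu.
  by apply: P0 => y Vy; rewrite eu // big_nil.
apply: (Pc (g i) (e i) (fun y => \sum_(i <- l) g i y *: e i y)) => //.
- exact: frame_smooth.
- apply: (smooth_sum_sect hE) => // j; apply: (smooth_smul hE) => //.
  exact: frame_smooth.
- exact: IH.
- by move=> y Vy; rewrite eu // big_cons.
Qed.

End FrameInduction.

(** * The Courant algebroid of a splitting *)

Section Core.
Variables (R : realType) (n : nat) (M : manifold R n) (S : symplectic_lie2 M).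
Variables (Q : vbundle M) (sg : splitting S Q).
Implicit Types (U V W : set M) (k l m : nat) (x : M).

Local Notation A := (fn S).
Local Notation emb := (emb S).
Local Notation "{{ a , b }}" := (poisson (s := S) a b).
Local Notation QQ := (homological (s := S)).
Local Notation Qs := (dual_bundle Q).
Local Notation i1 := (i1 sg).
Local Notation i2 := (i2 sg).

(** The frames over which [lie2_expression] gives the components of $\mathcal Q$. *)
Record adapted V r1 r2 (q : 'I_r1 -> sect Q) (t : 'I_r1 -> sect Qs)
    (b : 'I_r2 -> sect (TM M)) (beta : 'I_r2 -> sect (TstarM M)) : Prop := Adapted {
  adapted_open : open V;
  adapted_q : frame V q;
  adapted_b : frame V b;
  adapted_t : forall i, smooth V (t i);
  adapted_beta : forall j, smooth V (beta j);
  adapted_tq : forall x i j, V x -> pairing (t i) (q j) x = (i == j)%:R;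
  adapted_betab : forall x i j, V x -> pairing (beta i) (b j) x = (i == j)%:R }.

Lemma adapted_exists U x : open U -> U x -> exists V r1 r2 q t b beta,
  [/\ V x, V `<=` U & @adapted V r1 r2 q t b beta].
Proof.
move=> oU Ux.
have [V1 [r1 [q [oV1 V1x V1U fq]]]] := local_frame (Q_vbundle Q) oU Ux.
have [V2 [r2 [b [oV2 V2x V2U fb]]]] := local_frame (T_vbundle sg) oU Ux.
have [t [st _ tq]] := dual_frame oV1 fq.
have [beta [sbeta _ betab]] := dual_frame oV2 fb.
have oV := openI oV1 oV2.
have h1 := @subIsetl _ V1 V2; have h2 := @subIsetr _ V1 V2.
exists (V1 `&` V2), r1, r2, q, t, b, beta; split=> //; first exact: subset_trans h1 V1U.
split=> //.
- exact: frame_sub fq.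
- exact: frame_sub fb.
- by move=> i; apply: (smooth_sub (Qs_vbundle Q) oV1).
- by move=> i; apply: (smooth_sub (Ts_vbundle sg) oV2).
- by move=> y i j /h1; apply: tq.
- by move=> y i j /h2; apply: betab.
Qed.

Lemma adapted_sub V W r1 r2 q t b beta : open W -> W `<=` V ->
  @adapted V r1 r2 q t b beta -> adapted W q t b beta.
Proof.
move=> oW WV [oV fq fb st sbeta tq betab]; split=> //.
- exact: frame_sub fq.
- exact: frame_sub fb.
- by move=> i; apply: (smooth_sub (Qs_vbundle Q) oV).
- by move=> i; apply: (smooth_sub (Ts_vbundle sg) oV).
- by move=> y i j /WV; apply: tq.
- by move=> y i j /WV; apply: betab.
Qed.

Section Adapted.
Variables (V : set M) (r1 r2 : nat) (q : 'I_r1 -> sect Q) (t : 'I_r1 -> sect Qs)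
  (b : 'I_r2 -> sect (TM M)) (beta : 'I_r2 -> sect (TstarM M)).
Hypothesis ad : adapted V q t b beta.

Lemma adapted_decQ x (v : Q x) : V x -> v = \sum_i (t i x : dual (Q x)) v *: q i x.
Proof.
move=> Vx; have [c [vE _]] := (adapted_q ad).1 x Vx v.
rewrite {1}vE; apply: eq_bigr => i _; congr (_ *: _).
rewrite vE dual_sum (bigD1 i) // dualZ.
have -> : (t i x : dual (Q x)) (q i x) = 1 by rewrite [LHS](adapted_tq ad) // eqxx.
rewrite mulr1 big1; first exact/esym/addr0.
move=> j ji; rewrite dualZ.
have -> : (t i x : dual (Q x)) (q j x) = 0.
  by rewrite [LHS](adapted_tq ad) // eq_sym (negbTE ji).
exact: mulr0.
Qed.

Lemma adapted_decT x (v : tangent x) : V x ->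
  v = \sum_i (beta i x : dual (tangent x)) v *: b i x.
Proof.
move=> Vx; have [c [vE _]] := (adapted_b ad).1 x Vx v.
rewrite {1}vE; apply: eq_bigr => i _; congr (_ *: _).
rewrite vE dual_sum (bigD1 i) // dualZ.
have -> : (beta i x : dual (tangent x)) (b i x) = 1.
  by rewrite [LHS](adapted_betab ad) // eqxx.
rewrite mulr1 big1; first exact/esym/addr0.
move=> j ji; rewrite dualZ.
have -> : (beta i x : dual (tangent x)) (b j x) = 0.
  by rewrite [LHS](adapted_betab ad) // eq_sym (negbTE ji).
exact: mulr0.
Qed.

Lemma adapted_decQs x (a : dual (Q x)) : V x ->
  a = \sum_i a (q i x) *: (t i x : dual (Q x)).
Proof.
move=> Vx; apply: dual_ext => v; rewrite [in LHS](adapted_decQ v Vx) dual_sum sumd.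
by apply: eq_bigr => i _; rewrite dualZ scaled mulrC.
Qed.

End Adapted.

Variables (dQ : bhom Qs Q) (dQP : is_dQ sg dQ) (psi : bhom Q Qs).
Hypotheses (psiK : forall x, cancel (dQ x) (psi x)) (dQK : forall x, cancel (psi x) (dQ x)).
Variable dT : bhom Qs (TM M).
Hypothesis dTP : is_dTM sg dT.

Lemma app_dQ_psi (q : sect Q) : app dQ (app psi q) = q.
Proof. by apply: functional_extensionality_dep => x; apply: dQK. Qed.

Lemma app_psi_dQ (s : sect Qs) : app psi (app dQ s) = s.
Proof. by apply: functional_extensionality_dep => x; apply: psiK. Qed.

Section OpenSet.
Variables (U : set M) (oU : open U).
Implicit Types (s t : sect Qs) (X : sect (TM M)).

Lemma lie_smooth X f : smooth U X -> smooth_on U f -> smooth_on U (lie X f).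
Proof. by move=> sX sf; apply: sX. Qed.

(** Since [{s, f}] is zero for degree reasons, applying [Q] to it gives [{Q s, f} = {s, Q f}]. *)
Lemma i1_QembE s f : smooth U s -> smooth_on U f ->
  {{ i1 U s, QQ (emb U f) }} = emb U (lie (app dT s) f).
Proof.
move=> ss sf; rewrite -dTP //.
have hs : hom 1 (i1 U s) by hm.
have hf : hom 0 (emb U f) by hm.
have := Q_brO oU (emb U f) (isT : odd 1) hs; rewrite (br10 oU hs hf) Q0 //.
by move/esym/eqP; rewrite subr_eq0 => /eqP.
Qed.

Lemma br_Qemb t f : smooth U t -> smooth_on U f ->
  {{ QQ (emb U f), i1 U t }} = emb U (lie (app dT t) f).
Proof. by move=> st sf; rewrite br11C ?i1_QembE //; hm. Qed.

(* The value on [t] of the dull bracket of [dQ s1] and [dQ s2]. *)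
Definition dull_form t s1 s2 : A U :=
  {{ {{ QQ (i1 U s1), i1 U s2 }}, i1 U t }} - {{ {{ i2 U (app dT t), i1 U s1 }}, i1 U s2 }}.

Lemma dT_smooth t : smooth U t -> smooth U (app dT t).
Proof. exact: app_smooth. Qed.

Lemma hom_dull_form t s1 s2 : smooth U t -> smooth U s1 -> smooth U s2 ->
  hom 0 (dull_form t s1 s2).
Proof.
by move=> st ss1 ss2; have sX := dT_smooth st; rewrite /dull_form; hm.
Qed.

(** Symmetrized in [s1] and [s2], both terms of [dull_form] become the derivative of the function
    [{s1, s2}] along [dT t]: the first because the derived bracket has symmetric part [Q {s1, s2}],
    the second by the Jacobi identity. They cancel. *)
Lemma dull_form_skew t s1 s2 : smooth U t -> smooth U s1 -> smooth U s2 ->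
  dull_form t s2 s1 = - dull_form t s1 s2.
Proof.
move=> st ss1 ss2; have sX := dT_smooth st.
have h1 : hom 1 (i1 U s1) by hm.
have h2 : hom 1 (i1 U s2) by hm.
have ht : hom 1 (i1 U t) by hm.
have hX : hom 2 (i2 U (app dT t)) by hm.
apply/eqP; rewrite -addr_eq0 /dull_form; apply/eqP.
pose g := pairing s2 (app dQ s1).
have sG : smooth_on U g by apply: dQ_pairing_smooth.
have e1 : {{ {{ QQ (i1 U s2), i1 U s1 }}, i1 U t }} + {{ {{ QQ (i1 U s1), i1 U s2 }}, i1 U t }}
    = emb U (lie (app dT t) g).
  rewrite -br_Qemb // -dQP // (Q_brO oU _ (isT : odd 1) h1) brBl // addrC.
  rewrite [in RHS](br_skewE oU (k := 1) (l := 2) _ h1) //; last hm.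
  by rewrite brNl // opprK.
have e2 : {{ {{ i2 U (app dT t), i1 U s2 }}, i1 U s1 }} +
    {{ {{ i2 U (app dT t), i1 U s1 }}, i1 U s2 }} = emb U (lie (app dT t) g).
  rewrite -(i2_anchor sg oU sX sG) -dQP // (br2jacobi _ oU hX h1) addrC; congr (_ + _).
  by rewrite br11C //; hm.
by rewrite addrACA -opprD e1 e2 subrr.
Qed.

Lemma dull_form_combt f t t' u s1 s2 : smooth_on U f -> smooth U t -> smooth U t' ->
  smooth U s1 -> smooth U s2 -> eq_on U u (sadd (smul f t) t') ->
  dull_form u s1 s2 = emb U f * dull_form t s1 s2 + dull_form t' s1 s2.
Proof.
move=> sf st st' ss1 ss2 e.
have hQs := Qs_vbundle Q; have hT := T_vbundle sg.
have sft := smooth_smul hQs oU sf st; have sc := smooth_sadd hQs oU sft st'.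
have su : smooth U u by apply: (smooth_eq_on hQs oU sc) => y Uy; rewrite e.
have hf : hom 0 (emb U f) by hm.
have sX := dT_smooth st; have sX' := dT_smooth st'.
have sfX := smooth_smul hT oU sf sX; have scX := smooth_sadd hT oU sfX sX'.
have eX : eq_on U (app dT u) (sadd (smul f (app dT t)) (app dT t')).
  by move=> x Ux; rewrite /app e // /sadd /smul linearD linearZ.
have ht : hom 1 (i1 U t) by hm.
have h1 : hom 1 (i1 U s1) by hm.
have h2 : hom 1 (i1 U s2) by hm.
have hX : hom 2 (i2 U (app dT t)) by hm.
have hX1 : hom 1 {{ i2 U (app dT t), i1 U s1 }} by hm.
have hq : hom 1 {{ QQ (i1 U s1), i1 U s2 }} by hm.
rewrite /dull_form (i1_eq sg oU su sc e) i1D // i1Z //.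
rewrite (i2_eq sg oU (dT_smooth su) scX eX) i2D // i2Z //.
rewrite brDr // (brZr0 oU _ hq hf); last exact: br10.
rewrite brDl // (brZl0 oU hf hX h1); last exact: br01.
rewrite brDl // (brZl0 oU hf hX1 h2); last exact: br01.
by rewrite opprD addrACA mulrBr.
Qed.

Lemma dull_form_comb2 f t u s1 s2 s2' : smooth_on U f -> smooth U t -> smooth U s2 ->
  smooth U s2' -> smooth U s1 -> eq_on U u (sadd (smul f s2) s2') ->
  dull_form t s1 u = emb U f * dull_form t s1 s2 + dull_form t s1 s2'
    + emb U (lie (app dT s1) f) * {{ i1 U s2, i1 U t }}.
Proof.
move=> sf st ss ss' s1s e.
have hQs := Qs_vbundle Q.
have sft := smooth_smul hQs oU sf ss; have sc := smooth_sadd hQs oU sft ss'.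
have su : smooth U u by apply: (smooth_eq_on hQs oU sc) => y Uy; rewrite e.
have hf : hom 0 (emb U f) by hm.
have sX := dT_smooth st.
have ht : hom 1 (i1 U t) by hm.
have h1 : hom 1 (i1 U s1) by hm.
have h2 : hom 1 (i1 U s2) by hm.
have hX : hom 2 (i2 U (app dT t)) by hm.
have hX1 : hom 1 {{ i2 U (app dT t), i1 U s1 }} by hm.
have hQ1 : hom 2 (QQ (i1 U s1)) by hm.
have hq : hom 1 {{ QQ (i1 U s1), i1 U s2 }} by hm.
have sl : smooth_on U (lie (app dT s1) f) by apply: lie_smooth => //; apply: dT_smooth.
have hl : hom 0 (emb U (lie (app dT s1) f)) by hm.
rewrite /dull_form (i1_eq sg oU su sc e) i1D // i1Z //.
rewrite !brDr // !brDl // (brZr oU _ hQ1 hf) dTP //.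
rewrite brDl // (brZl0 oU hl h2 ht); last exact: br01.
rewrite (brZl0 oU hf hq ht); last exact: br01.
rewrite (brZr0 oU _ hX1 hf); last exact: br10.
by rewrite mulrBr; zmod.
Qed.

(** [Q t - X_t] is the part of [Q t] quadratic in degree 1 functions, and the double bracket
    extracts its coefficients. On dual frames the pairings [{t, s2}] and [{s1, t}] are constant, so
    only [- dull_form] remains. *)
Lemma dull_formE t s1 s2 : smooth U t -> smooth U s1 -> smooth U s2 ->
  {{ i1 U s2, {{ i1 U s1, QQ (i1 U t) - i2 U (app dT t) }} }} =
  {{ QQ (i1 U s1), {{ i1 U t, i1 U s2 }} }} - {{ i1 U s2, QQ {{ i1 U s1, i1 U t }} }}
  - dull_form t s1 s2.
Proof.
move=> st ss1 ss2; have sX := dT_smooth st.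
have h1 : hom 1 (i1 U s1) by hm.
have h2 : hom 1 (i1 U s2) by hm.
have ht : hom 1 (i1 U t) by hm.
have hX : hom 2 (i2 U (app dT t)) by hm.
have hQ1 : hom 2 (QQ (i1 U s1)) by hm.
rewrite /dull_form brBr // (Q_brO oU _ (isT : odd 1) h1) !brBr // (br2jacobi _ oU hQ1 ht).
have -> : {{ i1 U s1, i2 U (app dT t) }} = - {{ i2 U (app dT t), i1 U s1 }}.
  by rewrite (br2skew oU hX h1) opprK.
rewrite brNr // !opprK.
have -> : {{ i1 U s2, {{ i2 U (app dT t), i1 U s1 }} }} =
          {{ {{ i2 U (app dT t), i1 U s1 }}, i1 U s2 }} by rewrite br11C //; hm.
have -> : {{ i1 U t, {{ QQ (i1 U s1), i1 U s2 }} }} =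
          {{ {{ QQ (i1 U s1), i1 U s2 }}, i1 U t }} by rewrite br11C //; hm.
have -> : {{ {{ QQ (i1 U s1), i1 U t }}, i1 U s2 }} =
          {{ i1 U s2, {{ QQ (i1 U s1), i1 U t }} }} by rewrite br11C //; hm.
set a := {{ i1 U s2, {{ i1 U s1, _ }} }}; set b := {{ i1 U s2, {{ QQ _, _ }} }}.
set c := {{ {{ QQ _, _ }}, _ }}; set d := {{ {{ i2 _ _, _ }}, _ }}.
by zmod.
Qed.

End OpenSet.

Lemma emb_natr U k : open U -> emb U (fun=> k%:R) = k%:R.
Proof.
move=> oU; elim: k => [|k IH]; first by rewrite !mulr0n emb0.
rewrite [RHS]mulrS -IH -(emb1 S oU) -embD; try exact: smooth_cst; last by [].
by congr (emb U _); apply/funext => x; rewrite -mulrS.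
Qed.

Lemma br_mulrn U (a b : A U) k : open U -> {{ a, b *+ k }} = {{ a, b }} *+ k.
Proof.
by move=> oU; elim: k => [|k IH]; rewrite ?mulr0n ?br0r // !mulrS brDr // IH.
Qed.

(** * Extraction of coefficients in adapted frames *)

Section AdaptedBrackets.
Variables (V : set M) (r1 r2 : nat) (q : 'I_r1 -> sect Q) (t : 'I_r1 -> sect Qs)
  (b : 'I_r2 -> sect (TM M)) (beta : 'I_r2 -> sect (TstarM M)).
Hypothesis ad : adapted V q t b beta.
Let oV := adapted_open ad.
Let s a : sect Qs := app psi (q a).

Lemma adapted_q_smooth a : smooth V (q a).
Proof. exact: frame_smooth oV (adapted_q ad). Qed.

Lemma adapted_b_smooth a : smooth V (b a).
Proof. exact: frame_smooth oV (adapted_b ad). Qed.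

Lemma adapted_s_smooth a : smooth V (s a).
Proof. exact: app_smooth oV (adapted_q_smooth a). Qed.

Lemma adapted_hom_t i : hom 1 (i1 V (t i)).
Proof. exact: i1_hom oV (adapted_t ad i). Qed.

Lemma adapted_hom_s i : hom 1 (i1 V (s i)).
Proof. exact: i1_hom oV (adapted_s_smooth i). Qed.

Hint Resolve oV adapted_q_smooth adapted_b_smooth adapted_s_smooth adapted_hom_t
  adapted_hom_s : homdb.

(** As [dQ (s a) = q a], bracketing with [s a] acts on polynomials in the [t i] as the odd partial
    derivative in [t a]. Iterated brackets therefore read off coefficients. *)
Lemma adapted_br a i : {{ i1 V (s a), i1 V (t i) }} = (i == a)%:R.
Proof.
rewrite dQP; [|exact: oV|exact: adapted_s_smooth|exact: adapted_t ad i].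
rewrite app_dQ_psi -emb_natr //; apply: emb_ext => //.
  exact: pairing_smooth oV (adapted_t ad i) (adapted_q_smooth a).
by move=> x Vx; rewrite (adapted_tq ad).
Qed.

Lemma adapted_br2 a c i j :
  {{ i1 V (s c), {{ i1 V (s a), i1 V (t i) * i1 V (t j) }} }} =
  emb V (fun=> (i == a)%:R * (j == c)%:R - (j == a)%:R * (i == c)%:R).
Proof.
rewrite (br_leibnizO oV _ (isT : odd (1 * 1)) (adapted_hom_s a) (adapted_hom_t i)).
rewrite !adapted_br mulr_natl mulr_natr brBr // !br_mulrn // !adapted_br.
rewrite embB // ?embM // ?emb_natr ?mulr_natl //; exact: smooth_cst.
Qed.

Lemma adapted_br_emb a (f : M -> R) k (x : A V) : smooth_on V f -> hom k x ->
  {{ i1 V (s a), emb V f * x }} = emb V f * {{ i1 V (s a), x }}.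
Proof.
move=> sf hx; have hf := hom_emb S oV sf.
exact: (brZr0 oV _ (adapted_hom_s a) hf (br10 oV (adapted_hom_s a) hf)).
Qed.

Lemma adapted_quadratic (c : 'I_r1 -> 'I_r1 -> M -> R) a d :
  (forall i j, smooth_on V (c i j)) ->
  (forall i j x, V x -> c i j x = - c j i x) ->
  {{ i1 V (s d), {{ i1 V (s a), \sum_(i < r1) \sum_(j < r1 | (i < j)%N)
      emb V (c i j) * (i1 V (t i) * i1 V (t j)) }} }} = emb V (c a d).
Proof.
move=> sc sk; rewrite !br_sumr //.
transitivity (\sum_(i < r1) \sum_(j < r1 | (i < j)%N) emb V (fun x => c i j x *
    ((i == a)%:R * (j == d)%:R - (j == a)%:R * (i == d)%:R))).
  apply: eq_bigr => i _; rewrite !br_sumr //; apply: eq_bigr => j _.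
  rewrite (adapted_br_emb a (k := 2)) //; last hm.
  rewrite (adapted_br_emb d (k := 1)) //; last hm.
  by rewrite adapted_br2 -embM //; apply: smooth_cst.
have sm i j : smooth_on V (fun x => c i j x *
    ((i == a)%:R * (j == d)%:R - (j == a)%:R * (i == d)%:R)).
  by apply: smoothM => //; exact: smooth_cst.
under eq_bigr => i _ do rewrite -emb_sum //.
rewrite -emb_sum //; last by move=> i; apply: smooth_sum.
apply: emb_ext => //; first by apply: smooth_sum => // i; apply: smooth_sum.
move=> x Vx; apply: (alternating_sum2 (c := fun i j => c i j x)) => i j; exact: sk.
Qed.

Lemma adapted_br3 a c d i j (k : 'I_r1) :
  {{ i1 V (s d), {{ i1 V (s c), {{ i1 V (s a), i1 V (t i) * i1 V (t j) * i1 V (t k) }} }} }} =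
  emb V (fun=>
    ((i == a)%:R * ((j == c)%:R * (k == d)%:R - (k == c)%:R * (j == d)%:R)
     - ((i == c)%:R * ((j == a)%:R * (k == d)%:R) - (i == d)%:R * ((j == a)%:R * (k == c)%:R))
     + ((i == c)%:R * ((j == d)%:R * (k == a)%:R) - (i == d)%:R * ((j == c)%:R * (k == a)%:R)))).
Proof.
have L (x : 'I_r1) (y z : A V) : hom 1 y -> {{ i1 V (s x), y * z }} =
    {{ i1 V (s x), y }} * z - y * {{ i1 V (s x), z }}.
  by move=> hy; rewrite (br_leibnizO oV _ (isT : odd (1 * 1)) (adapted_hom_s x) hy).
have ht := adapted_hom_t.
rewrite -mulrA (L a) // (L a) // !adapted_br !mulr_natl !mulr_natr.
rewrite mulrBr !(mulrnAr, mulrnAl) !brBr // !br_mulrn //.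
rewrite !(L c) // !adapted_br !mulr_natl !mulr_natr.
rewrite !brBr // !br_mulrn // !adapted_br.
(* The deltas have appeared as integer multiples of 1. Turning them into embedded constant functions
   moves the identity to real numbers, where it can be computed. *)
pose e m l (p : nat) : A V := emb V (fun=> m%:R * (l%:R * p%:R)).
have eE m l (p : nat) : e m l p = (1 *+ p) *+ l *+ m.
  by rewrite /e !embM ?emb_natr ?mulr_natl //; exact: smooth_cst.
rewrite !mulrnBl -!eE /e -!embB -?embD; do ?[exact: oV | exact: smooth_cst | apply: smoothB].
by congr (emb V _); apply/funext => x; ring.
Qed.

Lemma adapted_cubic (w : 'I_r1 -> 'I_r1 -> 'I_r1 -> M -> R) a c d :
  (forall i j (k : 'I_r1), smooth_on V (w i j k)) ->
  (forall i j (k : 'I_r1) x, V x -> w i j k x = - w j i k x) ->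
  (forall i j (k : 'I_r1) x, V x -> w i j k x = - w i k j x) ->
  {{ i1 V (s d), {{ i1 V (s c), {{ i1 V (s a),
    \sum_(i < r1) \sum_(j < r1 | (i < j)%N) \sum_(k < r1 | (j < k)%N)
      emb V (w i j k) * (i1 V (t i) * i1 V (t j) * i1 V (t k)) }} }} }} = emb V (w a c d).
Proof.
move=> sw s12 s23; rewrite !br_sumr //.
pose D (i j k : 'I_r1) : R := (i == a)%:R * ((j == c)%:R * (k == d)%:R - (k == c)%:R * (j == d)%:R)
     - ((i == c)%:R * ((j == a)%:R * (k == d)%:R) - (i == d)%:R * ((j == a)%:R * (k == c)%:R))
     + ((i == c)%:R * ((j == d)%:R * (k == a)%:R) - (i == d)%:R * ((j == c)%:R * (k == a)%:R)).
have sm i j (k : 'I_r1) : smooth_on V (fun x => w i j k x * D i j k).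
  by apply: smoothM => //; exact: smooth_cst.
have sm2 i (j : 'I_r1) : smooth_on V (fun x => \sum_(k < r1 | (j < k)%N) w i j k x * D i j k).
  exact: smooth_sum.
have sm3 (i : 'I_r1) : smooth_on V (fun x =>
    \sum_(j < r1 | (i < j)%N) \sum_(k < r1 | (j < k)%N) w i j k x * D i j k).
  exact: smooth_sum.
transitivity (emb V (fun x => \sum_(i < r1) \sum_(j < r1 | (i < j)%N)
    \sum_(k < r1 | (j < k)%N) w i j k x * D i j k)).
  rewrite emb_sum //; apply: eq_bigr => i _; rewrite !br_sumr // emb_sum //.
  apply: eq_bigr => j _; rewrite !br_sumr // emb_sum //; apply: eq_bigr => k _.
  rewrite (adapted_br_emb a (k := 3)) //; last hm.
  rewrite (adapted_br_emb c (k := 2)) //; last hm.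
  rewrite (adapted_br_emb d (k := 1)) //; last hm.
  by rewrite adapted_br3 -embM //; apply: smooth_cst.
apply: emb_ext => //; first exact: smooth_sum.
move=> x Vx; apply: (alternating_sum3 (w := fun i j (k : 'I_r1) => w i j k x)) => *.
  exact: s12.
exact: s23.
Qed.

End AdaptedBrackets.

Lemma smoothT_sub V W (X : sect (TM M)) : open V -> smooth V X -> W `<=` V -> open W -> smooth W X.
Proof. by move=> oV sX WV oW; apply: (smooth_sub (T_vbundle sg) oV oW WV). Qed.

Lemma smoothQs_sub V W (t : sect Qs) : open V -> smooth V t -> W `<=` V -> open W -> smooth W t.
Proof. by move=> oV sX WV oW; apply: (smooth_sub (Qs_vbundle Q) oV oW WV). Qed.

Lemma smoothQ_sub V W (t : sect Q) : open V -> smooth V t -> W `<=` V -> open W -> smooth W t.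
Proof. by move=> oV sX WV oW; apply: (smooth_sub (Q_vbundle Q) oV oW WV). Qed.

Lemma app_rho (rho : bhom Q (TM M)) (q : sect Q) :
  (forall x v, rho x v = dT x (psi x v)) -> app rho q = app dT (app psi q).
Proof. by move=> rhoE; apply: functional_extensionality_dep => x; rewrite /app rhoE. Qed.

Definition is_dull (dl : sect Q -> sect Q -> sect Q) : Prop :=
  forall U p q, open U -> smooth U p -> smooth U q -> smooth U (dl p q) /\
    forall t, smooth U t ->
      emb U (pairing t (dl p q)) = dull_form U t (app psi p) (app psi q).

Lemma dull_exists : exists dl, is_dull dl.
Proof.
have /choice[dl dlP] : forall pq : sect Q * sect Q, exists q : sect Q, forall U,
    [/\ open U, smooth U pq.1 & smooth U pq.2] -> smooth U q /\
    forall t, smooth U t ->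
      emb U (pairing t q) = dull_form U t (app psi pq.1) (app psi pq.2).
  move=> pq; apply: (glue_bidual (Q_vbundle Q)).
  - by move=> U [].
  - move=> U V [oU sp sq] oV VU; split=> //; first exact: smoothQ_sub oU sp VU oV.
    exact: smoothQ_sub oU sq VU oV.
  - by move=> U t [oU sp sq] st; apply: hom_dull_form => //; apply: app_smooth.
  - move=> U V h t [oU sp sq] oV st.
    have s1 := app_smooth psi oU sp; have s2 := app_smooth psi oU sq.
    rewrite /dull_form rmorphB !res_br // res_Q // !i1_res // i2_res //; exact: dT_smooth.
  move=> U f t t' u [oU sp sq] sf st st' e.
  by apply: dull_form_combt e => //; apply: app_smooth.
by exists (fun p q => dl (p, q)) => U p q oU sp sq; apply: (dlP (p, q)).
Qed.

(** * The dull bracket *)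

Section Dull.
Variable dl : sect Q -> sect Q -> sect Q.
Hypothesis dlP : is_dull dl.
Variable rho : bhom Q (TM M).
Hypothesis rhoE : forall x v, rho x v = dT x (psi x v).

Lemma dl_smooth U p q : open U -> smooth U p -> smooth U q -> smooth U (dl p q).
Proof. by move=> oU sp sq; have [] := dlP oU sp sq. Qed.

Lemma dl_skew U p q : open U -> smooth U p -> smooth U q ->
  eq_on U (dl p q) (smul (fun=> -1) (dl q p)).
Proof.
move=> oU sp sq; have sm := smooth_cst (M := M) U (-1).
have s1 := dl_smooth oU sp sq; have s2 := dl_smooth oU sq sp.
apply: (section_ext (S := S)) => //; first exact: (smooth_smul (Q_vbundle Q)).
move=> V t oV VU st.
have spV := smoothQ_sub oU sp VU oV; have sqV := smoothQ_sub oU sq VU oV.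
have [d1 -> //] := dlP oV spV sqV; have [d2 e2] := dlP oV sqV spV.
have sp1 := app_smooth psi oV spV; have sp2 := app_smooth psi oV sqV.
rewrite dull_form_skew // -e2 // -embN //; last exact: pairing_smooth.
apply: emb_ext => //; first by apply: smoothN => //; apply: pairing_smooth.
by move=> x Vx; rewrite /pairing /smul scaleN1r dualN.
Qed.

(** Locality, additivity, homogeneity and the Leibniz rule in the second argument are all instances,
    with [f] equal to 0, 1 or another constant, or with [q'] zero. Skew-symmetry carries them to the
    first argument as needed. *)
Lemma dl_comb2 U f p q q' u : open U -> smooth_on U f -> smooth U p ->
  smooth U q -> smooth U q' -> eq_on U u (sadd (smul f q) q') ->
  eq_on U (dl p u) (sadd (sadd (smul f (dl p q)) (dl p q')) (smul (lie (app rho p) f) q)).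
Proof.
move=> oU sf sp sq sq' e; have hQ := Q_vbundle Q; have hQs := Qs_vbundle Q.
have sc := smooth_comb hQ oU sf sq sq'.
have su : smooth U u by apply: (smooth_eq_on hQ oU sc) => x Ux; rewrite e.
have s1 := dl_smooth oU sp sq; have s2 := dl_smooth oU sp sq'.
have sl : smooth_on U (lie (app rho p) f) by apply: lie_smooth => //; apply: app_smooth.
have s3 : smooth U (sadd (sadd (smul f (dl p q)) (dl p q')) (smul (lie (app rho p) f) q)).
  by apply: (smooth_sadd hQ) => //; [exact: smooth_comb|exact: smooth_smul].
apply: (section_ext (S := S)) => //; first exact: dl_smooth.
move=> V t oV VU st.
have spV := smoothQ_sub oU sp VU oV; have sqV := smoothQ_sub oU sq VU oV.
have sqV' := smoothQ_sub oU sq' VU oV; have suV := smoothQ_sub oU su VU oV.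
have sfV := smooth_on_sub VU sf; have slV := smooth_on_sub VU sl.
have [d1 -> //] := dlP oV spV suV; have [d2 e2] := dlP oV spV sqV.
have [d3 e3] := dlP oV spV sqV'.
have sp1 := app_smooth psi oV spV; have sp2 := app_smooth psi oV sqV.
have sp3 := app_smooth psi oV sqV'.
have eV : eq_on V (app psi u) (sadd (smul f (app psi q)) (app psi q')).
  by move=> x /VU Ux; rewrite /app e // /sadd /smul linearD linearZ.
rewrite (dull_form_comb2 oV sfV st sp2 sp3 sp1 eV) -e2 // -e3 // dQP // app_dQ_psi.
rewrite -(app_rho _ rhoE).
have p1 := pairing_smooth oV st d2; have p2 := pairing_smooth oV st d3.
have p3 := pairing_smooth oV st sqV.
have m1 := smoothM oV sfV p1; have m3 := smoothM oV slV p3; have a12 := smoothD oV m1 p2.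
rewrite -!embM // -!embD //; apply: emb_ext => //; first exact: smoothD.
by move=> x Vx; rewrite /pairing /sadd /smul !dualD !dualZ.
Qed.

Lemma dl_local : local_op dl.
Proof.
have hQ := Q_vbundle Q.
have right U s t t' : open U -> smooth U s -> smooth U t -> eq_on U t' t ->
    eq_on U (dl s t') (dl s t).
  move=> oU ss st e x Ux; have sm0 := smooth_cst (M := M) U 0.
  rewrite (dl_comb2 oU sm0 ss st st _ Ux) /sadd /smul /lie.
    by rewrite tangent_cst !scale0r addr0 add0r.
  by move=> y Uy; rewrite scale0r add0r e.
move=> U s s' t t' oU ss st es et; split; first exact: dl_smooth.
have ss' := smooth_eq_on hQ oU ss es; have st' := smooth_eq_on hQ oU st et.
move=> x Ux; rewrite -(right U s t t') //; last by move=> y Uy; rewrite et.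
rewrite (dl_skew oU ss st' Ux) (dl_skew oU ss' st' Ux) /smul; congr (_ *: _).
exact: (right U t' s' s oU st' ss' es x Ux).
Qed.

Lemma dl0r U p : open U -> smooth U p -> eq_on U (dl p (fun=> 0)) (fun=> 0).
Proof.
move=> oU sp x Ux; have sm1 := smooth_cst (M := M) U (-1).
have s0 := smooth0 (Q_vbundle Q) oU.
rewrite (dl_comb2 oU sm1 sp s0 s0 _ Ux) /sadd /smul /lie.
  by rewrite tangent_cst scale0r addr0 scaleN1r addNr.
by move=> y _; rewrite /sadd /smul scaler0 addr0.
Qed.

Lemma dl_bilinear : Rbilinear dl.
Proof.
have hQ := Q_vbundle Q.
have addr_ U s t t' : open U -> smooth U s -> smooth U t -> smooth U t' ->
    eq_on U (dl s (sadd t t')) (sadd (dl s t) (dl s t')).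
  move=> oU ss st st' x Ux; have sm1 := smooth_cst (M := M) U 1.
  rewrite (dl_comb2 oU sm1 ss st st' _ Ux) /sadd /smul /lie.
    by rewrite tangent_cst scale0r addr0 scale1r.
  by move=> y _; rewrite scale1r.
have zr U s t (a : R) : open U -> smooth U s -> smooth U t ->
    eq_on U (dl s (smul (fun=> a) t)) (smul (fun=> a) (dl s t)).
  move=> oU ss st x Ux; have sma := smooth_cst (M := M) U a.
  have s0 := smooth0 hQ oU.
  rewrite (dl_comb2 oU sma ss st s0 _ Ux) /sadd /smul /lie.
    by rewrite (dl0r oU ss Ux) tangent_cst scale0r !addr0.
  by move=> y _; rewrite addr0.
split.
  move=> U oU; split=> [s s' t ss ss' st x Ux|s t t' ss st st']; last exact: addr_.
  have sss := smooth_sadd hQ oU ss ss'.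
  rewrite (dl_skew oU sss st Ux) /smul (addr_ U t s s' oU st ss ss' x Ux) /sadd scalerDr.
  by rewrite (dl_skew oU ss st Ux) (dl_skew oU ss' st Ux).
move=> U a s t oU ss st; split; last exact: zr.
have sas := smooth_smul hQ oU (smooth_cst (M := M) U a) ss.
move=> x Ux; rewrite (dl_skew oU sas st Ux) /smul (zr U t s a oU st ss x Ux) /smul.
by rewrite (dl_skew oU ss st Ux) /smul !scalerA mulrC.
Qed.

Lemma dl_leibniz U f p q : open U -> smooth_on U f -> smooth U p -> smooth U q ->
  eq_on U (dl p (smul f q)) (sadd (smul f (dl p q)) (smul (lie (app rho p) f) q)).
Proof.
move=> oU sf sp sq x Ux; have s0 := smooth0 (Q_vbundle Q) oU.
rewrite (dl_comb2 oU sf sp sq s0 _ Ux); last by move=> y _; rewrite /sadd addr0.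
by rewrite /sadd (dl0r oU sp Ux) addr0.
Qed.

End Dull.

(** * Structure maps forced by the coordinate expression *)

Section Data.
Variables (L : split_lie2 Q) (D : dorfman Q).
Hypothesis data : splitting_data sg dQ L D.
Let dd := data_dorfman data.
Let ll := data_lie2 data.

Lemma data_Q_t V r1 r2 q t b beta (ad : @adapted V r1 r2 q t b beta) (k : 'I_r1) :
  QQ (i1 V (t k)) = i2 V (app (dTM D) (t k)) -
    \sum_(i < r1) \sum_(j < r1 | (i < j)%N)
      emb V (pairing (t k) (dull L (q i) (q j))) * (i1 V (t i) * i1 V (t j)).
Proof.
have [oV fq fb st sbeta tq betab] := ad.
have [_ -> _] := data_expression data oV fq fb st sbeta tq betab.
rewrite addrC; congr (_ + _); symmetry.
have sp r : smooth_on V (pairing (t k) (app (l1 L) (beta r))).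
  by apply: pairing_smooth => //; apply: app_smooth.
have sb i := frame_smooth i oV fb.
rewrite -(@i2_sum _ _ _ _ _ _ _ oV _ _
  (fun r x => - pairing (t k) (app (l1 L) (beta r)) x) b) //; last by move=> r; apply: smoothN.
have sX : smooth V (app (dTM D) (t k)) by apply: app_smooth.
apply: i2_eq => //.
  by apply: (smooth_sum_sect (T_vbundle sg)) => // r; apply: (smooth_smul (T_vbundle sg)) => //;
    exact: smoothN.
move=> x Vx; rewrite [LHS](adapted_decT ad _ Vx); apply: eq_bigr => r _.
by rewrite /app (dTM_dual dd).
Qed.

(** A bracket of [Q (t k)] with a function does not see the quadratic part of the expression, so it
    is the derivative along [dTM D (t k)]; by [dTP] it is also the derivative along [dT (t k)]. *)
Lemma data_dTM x (tau : dual (Q x)) : dTM D x tau = dT x tau.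
Proof.
have [V [r1 [r2 [q [t [b [beta [Vx _ ad]]]]]]]] := adapted_exists openT (I : setT x).
have oV := adapted_open ad; have st := adapted_t ad.
suff H (k : 'I_r1) : eq_on V (app (dTM D) (t k)) (app dT (t k)).
  rewrite (adapted_decQs ad tau Vx) !linear_sum; apply: eq_bigr => k _.
  by rewrite !linearZ; congr (_ *: _); apply: H.
apply: (anchor_unique (S := S)) => //; try exact: app_smooth.
move=> W f oW WV sf; have adW := adapted_sub oW WV ad.
have stW := adapted_t adW k; have sX := app_smooth (dTM D) oW stW.
rewrite -dTP // (data_Q_t adW) brBl // i2_anchor // br_suml //.
have hf := hom_emb S oW sf.
rewrite big1 ?subr0 // => i _; rewrite br_suml // big1 // => j _.
have hi := adapted_hom_t adW i; have hj := adapted_hom_t adW j.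
have se : smooth_on W (pairing (t k) (dull L (q i) (q j))).
  apply: pairing_smooth => //.
  by have [] := dull_local ll oW (adapted_q_smooth adW i) (adapted_q_smooth adW j)
    (fun _ _ => erefl) (fun _ _ => erefl).
have he := hom_emb S oW se.
rewrite (brZl0 oW he (homM11 oW hi hj) hf (br00 oW he hf)).
by rewrite (br_odd_mul oW hi hj hf) !(br10 oW _ hf) // !mulr0 subr0 mulr0.
Qed.

(** Contract the expression for [Q f] with the section corresponding to [q a]: only the derivative
    of [f] along [rhoQ L (q a)] survives, and [i1_QembE] evaluates the same bracket by [dT]. *)
Lemma data_rhoQ x (v : Q x) : rhoQ L x v = dT x (psi x v).
Proof.
have [V [r1 [r2 [q [t [b [beta [Vx _ ad]]]]]]]] := adapted_exists openT (I : setT x).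
have oV := adapted_open ad.
suff H a : eq_on V (app (rhoQ L) (q a)) (app dT (app psi (q a))).
  rewrite (adapted_decQ ad v Vx) !linear_sum; apply: eq_bigr => k _.
  by rewrite !linearZ; congr (_ *: _); apply: H.
have sq := adapted_q_smooth ad.
apply: (anchor_unique (S := S)) => //; try exact: app_smooth.
  by apply: app_smooth => //; apply: app_smooth.
move=> W f oW WV sf; have adW := adapted_sub oW WV ad.
have sqW := adapted_q_smooth adW; have ssW := adapted_s_smooth adW.
rewrite -i1_QembE //; have [_ fq fb st sbeta tq betab] := adW.
have [-> // _ _] := data_expression data oW fq fb st sbeta tq betab.
have sl i : smooth_on W (lie (app (rhoQ L) (q i)) f) by apply: lie_smooth => //; apply: app_smooth.
rewrite br_sumr // (bigD1 a) //= big1 ?addr0.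
  rewrite (adapted_br_emb adW a (k := 1)) ?(adapted_br adW) ?eqxx ?mulr1 //.
  exact: (adapted_hom_t adW).
move=> i /negbTE ia; rewrite (adapted_br_emb adW a (k := 1)) ?(adapted_br adW) ?ia ?mulr0 //.
exact: (adapted_hom_t adW).
Qed.

Lemma data_dull_smooth U p q : open U -> smooth U p -> smooth U q -> smooth U (dull L p q).
Proof.
by move=> oU sp sq; have [] := dull_local ll oU sp sq (fun _ _ => erefl) (fun _ _ => erefl).
Qed.

Lemma data_dull_eq U p p' q q' : open U -> smooth U p -> smooth U q ->
  eq_on U p p' -> eq_on U q q' -> eq_on U (dull L p q) (dull L p' q').
Proof. by move=> oU sp sq ep eq; have [] := dull_local ll oU sp sq ep eq. Qed.

Lemma data_dull_comb2 U f p q q' u : open U -> smooth_on U f -> smooth U p ->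
  smooth U q -> smooth U q' -> eq_on U u (sadd (smul f q) q') ->
  eq_on U (dull L p u)
    (sadd (sadd (smul f (dull L p q)) (dull L p q')) (smul (lie (app (rhoQ L) p) f) q)).
Proof.
move=> oU sf sp sq sq' e x Ux; have hQ := Q_vbundle Q.
have sfq := smooth_smul hQ oU sf sq; have sc := smooth_sadd hQ oU sfq sq'.
have su : smooth U u by apply: (smooth_eq_on hQ oU sc) => y Uy; rewrite e.
rewrite (data_dull_eq oU sp su (fun _ _ => erefl) e Ux).
have [_ /(_ _ _ _ sp sfq sq' x Ux) ->] := (dull_bilinear ll).1 U oU.
by rewrite /sadd (dull_leibniz ll oU sf sp sq Ux) /sadd addrAC.
Qed.

(** Both sides are minus a double contraction of the quadratic part of [Q (t k)]: for [dl] by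
    [dull_formE], whose extra terms are derivatives of constants on dual frames, and for [dull L] by
    the coordinate expression. *)
Lemma data_dull_frame dl V r1 r2 q t b beta (ad : @adapted V r1 r2 q t b beta) a c :
  is_dull dl -> eq_on V (dull L (q a) (q c)) (dl (q a) (q c)).
Proof.
move=> dlP; have oV := adapted_open ad; have sq := adapted_q_smooth ad.
have ss := adapted_s_smooth ad; have st := adapted_t ad.
have [sd ed] := dlP V _ _ oV (sq a) (sq c).
have sp (k : 'I_r1) i j := pairing_smooth oV (st k) (data_dull_smooth oV (sq i) (sq j)).
suff H (k : 'I_r1) : eq_on V (pairing (t k) (dull L (q a) (q c))) (pairing (t k) (dl (q a) (q c))).
  move=> x Vx; rewrite [LHS](adapted_decQ ad _ Vx) [RHS](adapted_decQ ad _ Vx).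
  by apply: eq_bigr => k _; congr (_ *: _); apply: H.
apply: (emb_inj (S := S) oV) => //; first exact: pairing_smooth.
rewrite ed //.
have E := dull_formE oV (st k) (ss a) (ss c).
have eX : i2 V (app dT (t k)) = i2 V (app (dTM D) (t k)).
  apply: i2_eq => //; try by apply: app_smooth.
  by move=> x _; rewrite /app data_dTM.
have hQ : hom 2 (QQ (i1 V (app psi (q a)))) by have := ss a; hm.
have e1 : {{ i1 V (t k), i1 V (app psi (q c)) }} = (k == c)%:R.
  by rewrite (br11C oV (adapted_hom_t ad k) (adapted_hom_s ad c)) (adapted_br ad).
move: E; rewrite e1 (adapted_br ad) -!emb_natr // (br_cst oV _ hQ) Q_cst // br0r // subrr sub0r eX.
rewrite (data_Q_t ad) addrC addKr brNr // brNr //.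
rewrite (@adapted_quadratic _ _ _ _ _ _ _ ad (fun i j => pairing (t k) (dull L (q i) (q j)))) //.
  exact: oppr_inj.
move=> i j x Vx; rewrite /pairing (dull_skew ll oV (sq i) (sq j) Vx) /smul scaleN1r.
exact: dualN.
Qed.

(** Both brackets are skew and obey the same Leibniz rule, with equal anchors by [data_rhoQ].
    Agreement on a frame therefore spreads to all sections, one argument after the other. *)
Lemma data_dull_dl dl U p q : is_dull dl -> open U -> smooth U p -> smooth U q ->
  eq_on U (dull L p q) (dl p q).
Proof.
move=> dlP oU sp sq x Ux; have hQ := Q_vbundle Q.
have [V [r1 [r2 [e [t [b [beta [Vx VU ad]]]]]]]] := adapted_exists oU Ux.
have oV := adapted_open ad; have se := adapted_q_smooth ad.
pose agree p q := eq_on V (dull L p q) (dl p q).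
have skew p1 p2 : smooth V p1 -> smooth V p2 -> agree p1 p2 -> agree p2 p1.
  move=> s1 s2 g y Vy.
  by rewrite (dull_skew ll oV s2 s1 Vy) (dl_skew dlP oV s2 s1 Vy) /smul g.
have comb p1 f p2 p2' u : smooth V p1 -> smooth_on V f -> smooth V p2 -> smooth V p2' ->
    agree p1 p2 -> agree p1 p2' -> eq_on V u (sadd (smul f p2) p2') -> agree p1 u.
  move=> s1 sf s2 s2' g g' eu y Vy; rewrite (data_dull_comb2 oV sf s1 s2 s2' eu Vy).
  by rewrite (dl_comb2 dlP data_rhoQ oV sf s1 s2 s2' eu Vy) /sadd /smul g // g'.
have zero p1 u : smooth V p1 -> eq_on V u (fun=> 0) -> agree p1 u.
  move=> s1 u0 y Vy; have sm1 := smooth_cst (M := M) V (-1).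
  have su : smooth V u by apply: (smooth_eq_on hQ oV (smooth0 hQ oV)) => z Vz; rewrite u0.
  have eu : eq_on V u (sadd (smul (fun=> -1) u) u).
    by move=> z Vz; rewrite /sadd /smul scaleN1r addNr u0.
  rewrite (data_dull_comb2 oV sm1 s1 su su eu Vy) (dl_comb2 dlP data_rhoQ oV sm1 s1 su su eu Vy).
  by rewrite /sadd /smul !scaleN1r !addNr.
have ind p1 : smooth V p1 -> (forall i, agree p1 (e i)) -> forall u, smooth V u -> agree p1 u.
  move=> s1 g; apply: (frame_ind hQ oV (adapted_q ad)) => //; first by move=> u; apply: zero.
  by move=> f s s' u sf s2 s2' g1 g2; apply: comb.
apply: (ind p _ _ q); [exact: smoothQ_sub oU sp VU oV| |exact: smoothQ_sub oU sq VU oV|by []].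
move=> i; apply: skew => //; first exact: smoothQ_sub oU sp VU oV.
apply: ind => //; last exact: smoothQ_sub oU sp VU oV.
by move=> j; apply: data_dull_frame ad _ _ dlP.
Qed.

Lemma data_dull U t s1 s2 : open U -> smooth U t -> smooth U s1 -> smooth U s2 ->
  emb U (pairing t (dull L (app dQ s1) (app dQ s2))) = dull_form U t s1 s2.
Proof.
move=> oU st ss1 ss2; have [dl dlP] := dull_exists.
have sq1 := app_smooth dQ oU ss1; have sq2 := app_smooth dQ oU ss2.
have [sd ed] := dlP U _ _ oU sq1 sq2; have := ed t st; rewrite !app_psi_dQ => <-.
apply: emb_ext => //; first by apply: pairing_smooth => //; apply: data_dull_smooth.
by move=> x Ux; rewrite /pairing (data_dull_dl dlP oU sq1 sq2 Ux).
Qed.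

Lemma data_Delta U s t : open U -> smooth U s -> smooth U t ->
  smooth U (Delta D (app dQ s) t) /\
  i1 U (Delta D (app dQ s) t) =
  {{ QQ (i1 U s), i1 U t }} + {{ i2 U (app dT t), i1 U s }}.
Proof.
move=> oU ss st; have sq := app_smooth dQ oU ss; have sX := dT_smooth oU st.
have [sD _] := Delta_local dd oU sq st (fun _ _ => erefl) (fun _ _ => erefl).
split=> //.
have hr : hom 1 ({{ QQ (i1 U s), i1 U t }} + {{ i2 U (app dT t), i1 U s }}).
  by apply: homD => //; hm.
have [r sr er] := i1_surj sg oU hr; rewrite -er; apply: i1_eq => //.
apply: (covector_ext (S := S) (Q_vbundle Q)) => // V p oV VU spV.
have s2s := app_smooth psi oV spV.
have srV := smoothQs_sub oU sr VU oV; have stV := smoothQs_sub oU st VU oV.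
have ssV := smoothQs_sub oU ss VU oV; have sqV := smoothQ_sub oU sq VU oV.
have sDV := smoothQs_sub oU sD VU oV; have sXV := dT_smooth oV stV.
pose s2 := app psi p; have pE : p = app dQ s2 by rewrite app_dQ_psi.
have stp := pairing_smooth oV stV spV.
have sl : smooth_on V (lie (app dT s) (pairing t p)).
  by apply: lie_smooth => //; apply: dT_smooth.
have sdl := pairing_smooth oV stV (data_dull_smooth oV sqV spV).
(* Paired with [p = dQ s2], the duality between [Delta] and the dull bracket becomes an identity of
   brackets, which the Jacobi identity for [Q s] closes. *)
transitivity (emb V (lie (app dT s) (pairing t p)) - dull_form V t s s2).
  rewrite -data_dull // -/s2 -?pE -?embB //.
  apply: (emb_ext S oV (pairing_smooth oV sDV spV)) => y Vy.
  rewrite (Delta_dual dd oV sqV spV stV Vy).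
  by rewrite /lie /app data_rhoQ psiK.
rewrite -(dTP oV ssV stp).
have hs2 : hom 1 (i1 V s2) by hm.
have ht' : hom 1 (i1 V t) by hm.
have hr' : hom 1 (i1 V r) by hm.
have eP u : smooth V u -> emb V (pairing u p) = {{ i1 V u, i1 V s2 }}.
  by move=> su; rewrite br11C ?dQP -?pE //; hm.
rewrite !eP //.
have hs : hom 1 (i1 V s) by hm.
have ht : hom 1 (i1 V t) by hm.
rewrite -(i1_res sg VU oU oV sr) er rmorphD !res_br // res_Q // !i1_res // i2_res //.
rewrite /dull_form (br2jacobi _ oV (homQ1 oV hs) ht) brDl //.
have hq : hom 1 {{ QQ (i1 V s), i1 V s2 }} by hm.
rewrite (br11C oV ht hq); zmod.
Qed.

End Data.

Lemma bhom_comp (E F G : prebundle M) (phi : bhom E F) (chi : bhom F G) :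
  exists c : bhom E G, forall x v, c x v = chi x (phi x v).
Proof.
have sc U (s : sect E) : open U -> smooth U s ->
    smooth (p := G) U (fun x => (chi x \o phi x) (s x)).
  by move=> oU ss; exact: (app_smooth chi oU (app_smooth phi oU ss)).
by exists (@BHom _ _ _ E G (fun x => chi x \o phi x : {linear E x -> G x}) sc).
Qed.

Lemma derived_bracket_exists : exists br : sect Qs -> sect Qs -> sect Qs,
  forall U s t, open U -> smooth U s -> smooth U t ->
    smooth U (br s t) /\ i1 U (br s t) = {{ QQ (i1 U s), i1 U t }}.
Proof.
have /choice[br brP] : forall st : sect Qs * sect Qs, exists r : sect Qs, forall U,
    [/\ open U, smooth U st.1 & smooth U st.2] ->
    smooth U r /\ i1 U r = {{ QQ (i1 U st.1), i1 U st.2 }}.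
  move=> st; apply: glue_deg1 => U [oU s1 s2]; split=> //; first hm.
  move=> V h oV; split; last by rewrite res_br // res_Q // !i1_res.
  split=> //; first exact: smoothQs_sub oU s1 h oV.
  exact: smoothQs_sub oU s2 h oV.
by exists (fun s t => br (s, t)) => U s t oU ss st; apply: (brP (s, t)).
Qed.

Lemma Qfunction_exists : exists del : (M -> R) -> sect Qs,
  forall U f, open U -> smooth_on U f -> smooth U (del f) /\ i1 U (del f) = QQ (emb U f).
Proof.
have /choice[del delP] : forall f : M -> R, exists r : sect Qs, forall U,
    open U /\ smooth_on U f -> smooth U r /\ i1 U r = QQ (emb U f).
  move=> f; apply: glue_deg1 => U [oU sf]; split=> //; first hm.
  move=> V h oV; split; last by rewrite res_Q // emb_res.
  by split=> //; apply: smooth_on_sub sf.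
by exists del => U f oU sf; apply: delP.
Qed.

(** * The Courant algebroid axioms *)

Section CourantStructure.
Variables (L : split_lie2 Q) (D : dorfman Q).
Hypothesis data : splitting_data sg dQ L D.

Lemma i2_dTM U t : open U -> smooth U t -> i2 U (app (dTM D) t) = i2 U (app dT t).
Proof.
move=> oU st; apply: i2_eq => //; try exact: app_smooth.
by move=> x _; rewrite /app (data_dTM data).
Qed.

Lemma courant_formulas_exist : exists C : courant Q, courant_formulas sg dQ D C.
Proof.
have [br brP] := derived_bracket_exists.
have [an anE] := bhom_comp psi dT.
have hQs := Qs_vbundle Q.
exists (Courant (fun x (u v : Q x) => (psi x u : dual (Q x)) v) an
  (fun q1 q2 => app dQ (br (app psi q1) (app psi q2)))).
split=> /=.
- by move=> x t1 t2; rewrite psiK.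
- by move=> x t; rewrite anE psiK (data_dTM data).
- move=> U s s' t t' oU ss st es et.
  have s1 := app_smooth psi oU ss; have s2 := app_smooth psi oU st.
  have [sb eb] := brP U _ _ oU s1 s2.
  split; first exact: app_smooth.
  have ss' : smooth U s' by apply: (smooth_eq_on (Q_vbundle Q) oU ss).
  have st' : smooth U t' by apply: (smooth_eq_on (Q_vbundle Q) oU st).
  have s1' := app_smooth psi oU ss'; have s2' := app_smooth psi oU st'.
  have [sb' eb'] := brP U _ _ oU s1' s2'.
  suff e : eq_on U (br (app psi s) (app psi t)) (br (app psi s') (app psi t')).
    by move=> x Ux; rewrite /app e.
  apply: (i1_inj (sg := sg) oU) => //; rewrite eb eb'.
  rewrite (i1_eq sg oU s1 s1'); last by move=> x Ux; rewrite /app es.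
  by rewrite (i1_eq sg oU s2 s2') // => x Ux; rewrite /app et.
- move=> U t1 t2 oU s1 s2; have [sb eb] := brP U _ _ oU s1 s2.
  have [sD eD] := data_Delta data oU s1 s2.
  (* By [data_Delta] this difference of [Delta] and the derived bracket is the section whose
     function is [{d_TM t2, t1}]. *)
  exists (fun x => Delta D (app dQ t1) t2 x - br t1 t2 x); split.
  + exact: (smooth_sub_sect hQs).
  + rewrite i1_sub // eD eb i2_dTM //; zmod.
  + by move=> x Ux; rewrite !app_psi_dQ /app opprB addrC subrK.
Qed.

Variable C : courant Q.
Hypothesis cf : courant_formulas sg dQ D C.

Lemma formula_derived U t1 t2 : open U -> smooth U t1 -> smooth U t2 ->
  exists s : sect Qs, [/\ smooth U s, i1 U s = {{ QQ (i1 U t1), i1 U t2 }}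
    & eq_on U (cbr C (app dQ t1) (app dQ t2)) (app dQ s)].
Proof.
move=> oU s1 s2; have [s [ss es eb]] := formula_bracket cf oU s1 s2.
have [sD eD] := data_Delta data oU s1 s2.
exists (fun x => Delta D (app dQ t1) t2 x - s x); split=> //.
  exact: (smooth_sub_sect (Qs_vbundle Q)).
rewrite i1_sub // eD es i2_dTM //; zmod.
Qed.

(** Being injective and linear over functions, [Phi] lets the identities between sections of $Q$ be
    verified for degree 1 functions. *)
Let Phi U (q : sect Q) : A U := i1 U (app psi q).

Lemma courant_br U q1 q2 : open U -> smooth U q1 -> smooth U q2 ->
  smooth U (cbr C q1 q2) /\ Phi U (cbr C q1 q2) = {{ QQ (Phi U q1), Phi U q2 }}.
Proof.
move=> oU s1 s2.
have [sb _] := formula_local cf oU s1 s2 (fun _ _ => erefl) (fun _ _ => erefl).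
split=> //.
have [s [ss es eb]] := formula_derived oU (app_smooth psi oU s1) (app_smooth psi oU s2).
rewrite /Phi -es; apply: i1_eq => //; first exact: app_smooth.
by move=> x Ux; rewrite /app -[q1]app_dQ_psi -[q2]app_dQ_psi eb // /app psiK.
Qed.

Lemma courant_pairE x (u v : Q x) : cpair C u v = (psi x u : dual (Q x)) v.
Proof. by rewrite -[in LHS](dQK u) -[in LHS](dQK v) (formula_pair cf) dQK. Qed.

Lemma courant_anchorE x (u : Q x) : canchor C x u = dT x (psi x u).
Proof. by rewrite -[in LHS](dQK u) (formula_anchor cf) (data_dTM data). Qed.

Lemma hom_Phi U q : open U -> smooth U q -> hom 1 (Phi U q).
Proof. by move=> oU sq; apply: i1_hom => //; apply: app_smooth. Qed.

Lemma Phi_inj U q1 q2 : open U -> smooth U q1 -> smooth U q2 ->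
  Phi U q1 = Phi U q2 -> eq_on U q1 q2.
Proof.
move=> oU s1 s2 e x Ux.
have := i1_inj oU (app_smooth psi oU s1) (app_smooth psi oU s2) e Ux.
by rewrite /app => /(congr1 (dQ x)); rewrite !dQK.
Qed.

Lemma PhiD U q1 q2 : open U -> smooth U q1 -> smooth U q2 ->
  Phi U (sadd q1 q2) = Phi U q1 + Phi U q2.
Proof.
move=> oU s1 s2; rewrite /Phi -i1D //; try exact: app_smooth.
by congr (i1 U _); apply: functional_extensionality_dep => x; rewrite /app /sadd linearD.
Qed.

Lemma PhiZ U f q : open U -> smooth_on U f -> smooth U q ->
  Phi U (smul f q) = emb U f * Phi U q.
Proof.
move=> oU sf s; rewrite /Phi -i1Z //; try exact: app_smooth.
by congr (i1 U _); apply: functional_extensionality_dep => x; rewrite /app /smul linearZ.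
Qed.

Lemma courant_pairs_smooth U q1 q2 : open U -> smooth U q1 -> smooth U q2 ->
  smooth_on U (cpairs C q1 q2).
Proof.
move=> oU s1 s2; apply: (smooth_on_eq oU (pairing_smooth oU (app_smooth psi oU s1) s2)).
by move=> x Ux; rewrite /cpairs courant_pairE.
Qed.

Lemma emb_cpairs U q1 q2 : open U -> smooth U q1 -> smooth U q2 ->
  emb U (cpairs C q1 q2) = {{ Phi U q1, Phi U q2 }}.
Proof.
move=> oU s1 s2; have sp1 := app_smooth psi oU s1; have sp2 := app_smooth psi oU s2.
rewrite br11C ?dQP //; try exact: i1_hom.
apply: emb_ext => //; first exact: courant_pairs_smooth.
by move=> x Ux; rewrite /cpairs courant_pairE app_dQ_psi.
Qed.

Lemma lie_anchor q f : lie (app (canchor C) q) f = lie (app dT (app psi q)) f.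
Proof. by apply/funext => x; rewrite /lie /app courant_anchorE. Qed.

Lemma br_symmetric_part U q1 q2 : open U -> smooth U q1 -> smooth U q2 ->
  {{ QQ (Phi U q1), Phi U q2 }} + {{ QQ (Phi U q2), Phi U q1 }} = QQ {{ Phi U q1, Phi U q2 }}.
Proof.
move=> oU s1 s2; have h1 := hom_Phi oU s1; have h2 := hom_Phi oU s2.
by rewrite (Q_brO oU _ (isT : odd 1) h1) (br2skew oU (homQ1 oU h2) h1).
Qed.

Lemma is_courant_formulas : is_courant C.
Proof.
have hQ := Q_vbundle Q; have hQs := Qs_vbundle Q.
split.
- by move=> x a u v w; rewrite !courant_pairE linearP.
- move=> x u v; rewrite !courant_pairE -[in LHS](dQK v) (dQ_sym dQP).
  by rewrite dQK.
- move=> x u H; suff e : psi x u = 0 by rewrite -(dQK u) e linear0.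
  by apply: dual_ext => v; rewrite -courant_pairE H.
- exact: courant_pairs_smooth.
- exact: formula_local cf.
- split.
    move=> U oU; split=> s s' t ss ss' st.
      have [b1 e1] := courant_br oU ss st; have [b2 e2] := courant_br oU ss' st.
      have [b3 e3] := courant_br oU (smooth_sadd hQ oU ss ss') st.
      apply: Phi_inj => //; first exact: (smooth_sadd hQ).
      by rewrite e3 !PhiD // e1 e2 QD // brDl.
    have [b1 e1] := courant_br oU ss ss'; have [b2 e2] := courant_br oU ss st.
    have [b3 e3] := courant_br oU ss (smooth_sadd hQ oU ss' st).
    apply: Phi_inj => //; first exact: (smooth_sadd hQ).
    by rewrite e3 !PhiD // e1 e2 brDr.
  move=> U a s t oU ss st; have sa := smooth_cst (M := M) U a.
  have hs := hom_Phi oU ss; have ht := hom_Phi oU st; have ha := hom_emb S oU sa.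
  have [b1 e1] := courant_br oU ss st; split.
    have [b2 e2] := courant_br oU (smooth_smul hQ oU sa ss) st.
    apply: Phi_inj => //; first exact: (smooth_smul hQ).
    rewrite e2 !PhiZ // e1 Q_leibniz0 // Q_cst // mul0r add0r.
    by rewrite (brZl0 oU ha (homQ1 oU hs) ht) // (br01 oU ha ht).
  have [b2 e2] := courant_br oU ss (smooth_smul hQ oU sa st).
  apply: Phi_inj => //; first exact: (smooth_smul hQ).
  by rewrite e2 !PhiZ // e1 (brZr0 oU _ (homQ1 oU hs) ha) // (br_cst oU _ (homQ1 oU hs)).
- move=> U q1 q2 q3 oU s1 s2 s3.
  have [b12 e12] := courant_br oU s1 s2; have [b13 e13] := courant_br oU s1 s3.
  have [b23 e23] := courant_br oU s2 s3.
  have [b4 e4] := courant_br oU s1 b23; have [b5 e5] := courant_br oU b12 s3.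
  have [b6 e6] := courant_br oU s2 b13.
  apply: Phi_inj => //; first exact: (smooth_sadd hQ).
  have h1 := homQ1 oU (hom_Phi oU s1); have h2 := homQ1 oU (hom_Phi oU s2).
  (* Since [Q] squares to zero, [Q {Q a, b} = {Q a, Q b}], and the Jacobi identity for the even
     functions [Q a], [Q b] carries no sign. *)
  rewrite PhiD // e4 e5 e6 e12 e13 e23 (Q_brE oU _ (isT : ~~ odd 2) h1).
  by rewrite homological_square // br0l // add0r -(br2jacobi _ oU h1 h2).
- move=> U q1 q2 q3 oU s1 s2 s3.
  have [b12 e12] := courant_br oU s1 s2; have [b13 e13] := courant_br oU s1 s3.
  have sp1 := app_smooth psi oU s1.
  have c23 := courant_pairs_smooth oU s2 s3.
  have c1 := courant_pairs_smooth oU b12 s3; have c2 := courant_pairs_smooth oU s2 b13.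
  have sl : smooth_on U (lie (app dT (app psi q1)) (cpairs C q2 q3)).
    by apply: lie_smooth => //; apply: app_smooth.
  move=> x Ux; rewrite lie_anchor; move: x Ux.
  apply: (emb_inj (S := S) oU) => //; first exact: smoothD.
  rewrite -dTP // embD // !emb_cpairs // e12 e13.
  exact: (br2jacobi _ oU (homQ1 oU (hom_Phi oU s1)) (hom_Phi oU s2)).
(* The section $\mathcal D f$ is the one whose degree 1 function is [Q f]. *)
- have [del delP] := Qfunction_exists.
  exists (fun f => app dQ (del f)); split.
    move=> U f oU sf; have [sd ed] := delP U f oU sf.
    split; first exact: app_smooth.
    move=> x Ux v; rewrite courant_pairE courant_anchorE /app psiK.
    have [V [p [oV Vx VU spV <-]]] := local_section hQ v oU Ux.
    have sfV := smooth_on_sub VU sf; have sdV := smoothQs_sub oU sd VU oV.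
    have sppV := app_smooth psi oV spV.
    have sl : smooth_on V (lie (app dT (app psi p)) f).
      by apply: lie_smooth => //; apply: app_smooth.
    have := emb_inj (S := S) oV (pairing_smooth oV sdV spV) sl; apply=> //.
    rewrite -br_Qemb // -(emb_res S VU oU oV sf) -res_Q // -ed i1_res //.
    by rewrite br11C ?dQP ?app_dQ_psi //; exact: i1_hom.
  move=> U q1 q2 oU s1 s2; have [b1 e1] := courant_br oU s1 s2.
  have [b2 e2] := courant_br oU s2 s1.
  have [sd ed] := delP U _ oU (courant_pairs_smooth oU s1 s2).
  apply: Phi_inj => //; [exact: (smooth_sadd hQ)|exact: app_smooth|].
  rewrite PhiD // e1 e2 br_symmetric_part // /Phi app_psi_dQ ed.
  by rewrite emb_cpairs.
Qed.

Lemma corresponds_formulas : corresponds sg dQ C.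
Proof.
split.
- move=> U t1 t2 oU s1 s2; rewrite emb_cpairs //; try exact: app_smooth.
  by rewrite /Phi !app_psi_dQ.
- by move=> U t f oU st sf; rewrite lie_anchor app_psi_dQ dTP.
- exact: formula_derived.
Qed.

End CourantStructure.

(** * Existence of the structure maps *)

Section ConnectionFromLinearity.
Variables (E : prebundle M) (hE : is_vbundle E) (rho : bhom Q (TM M)).
Variable nb : sect Q -> sect E -> sect E.
Hypothesis nb_smooth : forall U q e, open U -> smooth U q -> smooth U e -> smooth U (nb q e).
Hypothesis nb_left : forall U f q q' u e, open U -> smooth_on U f ->
  smooth U q -> smooth U q' -> smooth U e -> eq_on U u (sadd (smul f q) q') ->
  eq_on U (nb u e) (sadd (smul f (nb q e)) (nb q' e)).
Hypothesis nb_right : forall U f q e e' u, open U -> smooth_on U f ->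
  smooth U q -> smooth U e -> smooth U e' -> eq_on U u (sadd (smul f e) e') ->
  eq_on U (nb q u) (sadd (sadd (smul f (nb q e)) (nb q e')) (smul (lie (app rho q) f) e)).

(** As for the dull bracket, one rule per argument, stated with equality over [U], already contains
    locality and additivity. *)
Lemma connection_of_linear : is_connection rho nb.
Proof.
have hQ := Q_vbundle Q.
have nb0 U e : open U -> smooth U e -> eq_on U (nb (fun=> 0) e) (fun=> 0).
  move=> oU se x Ux; have s0 := smooth0 hQ oU.
  rewrite (nb_left oU (smooth_cst U (-1)) s0 s0 se _ Ux) /sadd /smul.
    by rewrite scaleN1r addNr.
  by move=> y _; rewrite /sadd /smul scaler0 addr0.
have nb0r U q : open U -> smooth U q -> eq_on U (nb q (fun=> 0)) (fun=> 0).
  move=> oU sq x Ux; have s0 := smooth0 hE oU.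
  rewrite (nb_right oU (smooth_cst U (-1)) sq s0 s0 _ Ux) /sadd /smul.
    by rewrite scaleN1r addNr scaler0 addr0.
  by move=> y _; rewrite /sadd /smul scaler0 addr0.
split.
- move=> U s s' e e' oU ss se es ee; split; first exact: nb_smooth.
  have se' := smooth_eq_on hE oU se ee.
  have sm0 := smooth_cst (M := M) U 0.
  move=> x Ux.
  have -> : nb s' e' x = nb s e' x.
    rewrite (nb_left oU sm0 ss ss se' _ Ux) /sadd /smul; first by rewrite scale0r add0r.
    by move=> y Uy; rewrite /sadd /smul scale0r add0r es.
  rewrite [RHS](nb_right oU sm0 ss se se _ Ux) /sadd /smul /lie.
    by rewrite tangent_cst !scale0r addr0 add0r.
  by move=> y Uy; rewrite /sadd /smul scale0r add0r ee.
- move=> U oU; have sm1 := smooth_cst (M := M) U 1; split.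
    move=> s s' e ss ss' se x Ux.
    rewrite (nb_left oU sm1 ss ss' se _ Ux) /sadd /smul ?scale1r // => y _.
    by rewrite scale1r.
  move=> s e e' ss se se' x Ux.
  rewrite (nb_right oU sm1 ss se se' _ Ux) /sadd /smul /lie.
    by rewrite tangent_cst scale0r addr0 scale1r.
  by move=> y _; rewrite scale1r.
- move=> U f q e oU sf sq se x Ux; have s0 := smooth0 hQ oU.
  rewrite (nb_left oU sf sq s0 se _ Ux) /sadd /smul ?(nb0 U e oU se x Ux) ?addr0 // => y _.
  by rewrite addr0.
- move=> U f q e oU sf sq se x Ux; have s0 := smooth0 hE oU.
  rewrite (nb_right oU sf sq se s0 _ Ux) /sadd /smul ?(nb0r U q oU sq x Ux) ?addr0 // => y _.
  by rewrite addr0.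
Qed.

End ConnectionFromLinearity.

(** Finitely many tests replace those of [fn_eq0]: every degree 1 function is a combination of the
    ones tested, and its coefficients pass through the bracket because [a] commutes with functions
    of degree 0. *)
Lemma adapted_eq0 V r1 r2 q t b beta (ad : @adapted V r1 r2 q t b beta) k (a : A V) :
  (0 < k)%N -> hom k a ->
  (forall W (h : W `<=` V) f, open W -> smooth_on W f -> {{ emb W f, res h a }} = 0) ->
  (forall i, {{ i1 V (app psi (q i)), a }} = 0) -> a = 0.
Proof.
move=> k0 ha a0 a1; have oV := adapted_open ad.
apply: (fn_eq0 (sg := sg) oV k0 ha a0) => W h s oW ss.
have adW := adapted_sub oW h ad; have ssW := adapted_s_smooth adW.
have sq := app_smooth dQ oW ss.
have sp i : smooth_on W (pairing (t i) (app dQ s)).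
  by apply: pairing_smooth => //; apply: (adapted_t adW).
have E : eq_on W s (fun x => \sum_i pairing (t i) (app dQ s) x *: app psi (q i) x).
  move=> x Wx; rewrite -[LHS]psiK [in LHS](adapted_decQ adW (dQ x (s x)) Wx) linear_sum.
  by apply: eq_bigr => i _; rewrite linearZ.
have sS : smooth (p := Qs) W (fun x => \sum_i pairing (t i) (app dQ s) x *: app psi (q i) x).
  by apply: (smooth_eq_on (Qs_vbundle Q) oW ss).
rewrite (i1_eq sg oW ss sS E).
rewrite (@i1_sum _ _ _ _ _ _ _ oW _ _ (fun i => pairing (t i) (app dQ s))
  (fun i => app psi (q i))) // br_suml // big1 // => i _.
rewrite (brZl0 oW (hom_emb S oW (sp i)) (adapted_hom_s adW i) (res_hom h oV oW ha)).
  by rewrite -(i1_res sg h oV oW (adapted_s_smooth ad i)) -res_br // a1 rmorph0 mulr0.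
exact: a0.
Qed.

Lemma br_emb_deg1 U f (a : A U) : open U -> smooth_on U f -> hom 1 a -> {{ emb U f, a }} = 0.
Proof. by move=> oU sf ha; apply: br01 => //; exact: hom_emb. Qed.

Lemma delta_pairing U t s s2 : open U -> smooth U t -> smooth U s -> smooth U s2 ->
  {{ {{ QQ (i1 U s), i1 U t }} + {{ i2 U (app dT t), i1 U s }}, i1 U s2 }} =
  {{ QQ (i1 U s), {{ i1 U t, i1 U s2 }} }} - dull_form U t s s2.
Proof.
move=> oU st ss ss2; have sX := dT_smooth oU st.
have hs : hom 1 (i1 U s) by hm.
have ht : hom 1 (i1 U t) by hm.
have hs2 : hom 1 (i1 U s2) by hm.
have hq : hom 1 {{ QQ (i1 U s), i1 U s2 }} by hm.
by rewrite /dull_form (br2jacobi _ oU (homQ1 oU hs) ht) brDl // (br11C oU ht hq); zmod.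
Qed.

Definition is_nabla (nb : sect Q -> sect (TM M) -> sect (TM M)) : Prop :=
  forall U q X, open U -> smooth U q -> smooth U X -> smooth U (nb q X) /\
    forall f, smooth_on U f ->
      {{ {{ i1 U (app psi q), QQ (i2 U X) }}, emb U f }} = emb U (lie (nb q X) f).

Lemma nabla_exists : exists nb, is_nabla nb.
Proof.
have /choice[nb nbP] : forall qX : sect Q * sect (TM M), exists Y : sect (TM M), forall U,
    [/\ open U, smooth U qX.1 & smooth U qX.2] -> smooth U Y /\
    forall f, smooth_on U f ->
      {{ {{ i1 U (app psi qX.1), QQ (i2 U qX.2) }}, emb U f }} = emb U (lie Y f).
  move=> qX; apply: (glue_anchor sg) => U [oU sq sX]; have sp := app_smooth psi oU sq.
  split=> //; first hm.
  move=> V h oV; split; last by rewrite res_br // res_Q // i1_res // i2_res.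
  split=> //; first exact: smoothQ_sub oU sq h oV.
  exact: smoothT_sub oU sX h oV.
by exists (fun q X => nb (q, X)) => U q X oU sq sX; apply: (nbP (q, X)).
Qed.

(** * The connection *)

Section Nabla.
Variable nb : sect Q -> sect (TM M) -> sect (TM M).
Hypothesis nbP : is_nabla nb.
Variable rho : bhom Q (TM M).
Hypothesis rhoE : forall x v, rho x v = dT x (psi x v).

Lemma nb_smooth U q X : open U -> smooth U q -> smooth U X -> smooth U (nb q X).
Proof. by move=> oU sq sX; have [] := nbP oU sq sX. Qed.

(** The bracket [{f * s, Q X}] differs from [f * {s, Q X}] by [{f, Q X} * s], a product of degree 1
    functions, which has zero anchor. *)
Lemma nb_left U f q q' u X : open U -> smooth_on U f ->
  smooth U q -> smooth U q' -> smooth U X -> eq_on U u (sadd (smul f q) q') ->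
  eq_on U (nb u X) (sadd (smul f (nb q X)) (nb q' X)).
Proof.
move=> oU sf sq sq' sX e; have hQ := Q_vbundle Q; have hT := T_vbundle sg.
have sc := smooth_comb hQ oU sf sq sq'.
have su : smooth U u by apply: (smooth_eq_on hQ oU sc) => x Ux; rewrite e.
have n1 := nb_smooth oU sq sX; have n2 := nb_smooth oU sq' sX.
apply: (anchor_unique (S := S)) => //; [exact: nb_smooth|exact: smooth_comb|].
move=> V g oV VU sG.
have suV := smoothQ_sub oU su VU oV; have sXV := smoothT_sub oU sX VU oV.
have sqV := smoothQ_sub oU sq VU oV; have sqV' := smoothQ_sub oU sq' VU oV.
have sfV := smooth_on_sub VU sf; have spV := app_smooth psi oV sqV.
have spV' := app_smooth psi oV sqV'; have spu := app_smooth psi oV suV.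
have [n1V e1] := nbP oV sqV sXV; have [n2V e2] := nbP oV sqV' sXV.
have [_ <- //] := nbP oV suV sXV.
have -> : i1 V (app psi u) = emb V f * i1 V (app psi q) + i1 V (app psi q').
  have s1 := smooth_smul (Qs_vbundle Q) oV sfV spV.
  rewrite -i1Z // -i1D //; apply: i1_eq => //; first exact: (smooth_sadd (Qs_vbundle Q)).
  by move=> x /VU Ux; rewrite /app e // /sadd /smul linearD linearZ.
have hf := hom_emb S oV sfV; have hg := hom_emb S oV sG.
have hp : hom 1 (i1 V (app psi q)) by hm.
have hc : hom 3 (QQ (i2 V X)) by hm.
have hpc : hom 2 {{ i1 V (app psi q), QQ (i2 V X) }} by hm.
have hfc : hom 1 {{ emb V f, QQ (i2 V X) }} by hm.
rewrite brDl // (br_leibniz_lO oV (isT : odd (1 * 3)) hf hp hc) brDl // brBl //.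
rewrite (brZl0 oV hf hpc hg (br00 oV hf hg)) (br_odd_mul oV hfc hp hg).
rewrite (br10 oV hp hg) (br10 oV hfc hg) !mulr0 !subr0 e1 // e2 //.
rewrite -embM // -?embD //; try exact: lie_smooth.
by apply: smoothM => //; exact: lie_smooth.
Qed.

(** [Q (f * X)] contains [Q f * X]. Its bracket with [s] consists of [{s, Q f} * X], which is the
    derivative term of a connection, and of a product of degree 1 functions, which has zero
    anchor. *)
Lemma nb_right U f q X X' u : open U -> smooth_on U f ->
  smooth U q -> smooth U X -> smooth U X' -> eq_on U u (sadd (smul f X) X') ->
  eq_on U (nb q u) (sadd (sadd (smul f (nb q X)) (nb q X')) (smul (lie (app rho q) f) X)).
Proof.
move=> oU sf sq sX sX' e; have hQ := Q_vbundle Q; have hT := T_vbundle sg.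
have sc := smooth_comb hT oU sf sX sX'.
have su : smooth U u by apply: (smooth_eq_on hT oU sc) => x Ux; rewrite e.
have n1 := nb_smooth oU sq sX; have n2 := nb_smooth oU sq sX'.
have sl : smooth_on U (lie (app rho q) f) by apply: lie_smooth => //; apply: app_smooth.
apply: (anchor_unique (S := S)) => //; first exact: nb_smooth.
  by apply: (smooth_sadd hT) => //; [exact: smooth_comb|exact: smooth_smul].
move=> V g oV VU sG.
have suV := smoothT_sub oU su VU oV; have sXV := smoothT_sub oU sX VU oV.
have sqV := smoothQ_sub oU sq VU oV; have sXV' := smoothT_sub oU sX' VU oV.
have sfV := smooth_on_sub VU sf; have spV := app_smooth psi oV sqV.
have slV := smooth_on_sub VU sl.
have [n1V e1] := nbP oV sqV sXV; have [n2V e2] := nbP oV sqV sXV'.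
have [_ <- //] := nbP oV sqV suV.
have -> : i2 V u = emb V f * i2 V X + i2 V X'.
  have s1 := smooth_smul hT oV sfV sXV.
  rewrite -i2Z // -i2D //; apply: i2_eq => //; first exact: (smooth_sadd hT).
  by move=> x /VU Ux; rewrite e.
have hf := hom_emb S oV sfV; have hg := hom_emb S oV sG.
have hp : hom 1 (i1 V (app psi q)) by hm.
have hX : hom 2 (i2 V X) by hm.
have hQf := homQ0 oV hf.
have hpc : hom 2 {{ i1 V (app psi q), QQ (i2 V X) }} by hm.
have hpX : hom 1 {{ i1 V (app psi q), i2 V X }} by hm.
have hl := hom_emb S oV slV.
rewrite QD // Q_leibniz0 // !brDr //.
rewrite (br_leibnizO oV _ (isT : odd (1 * 1)) hp hQf) i1_QembE // -(app_rho _ rhoE).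
rewrite (brZr0 oV _ hp hf (br10 oV hp hf)) !brDl // brNl //.
rewrite (brZl0 oV hf hpc hg (br00 oV hf hg)) (brZl0 oV hl hX hg (br00 oV hl hg)).
rewrite (br_odd_mul oV hQf hpX hg) (br10 oV hpX hg) (br10 oV hQf hg) !mulr0 subr0 oppr0.
rewrite addr0 e1 // e2 // i2_anchor // -!embM //; try exact: lie_smooth.
have m1 : smooth_on V (fun x => f x * lie (nb q X) g x) by apply: smoothM => //; exact: lie_smooth.
have m2 : smooth_on V (fun x => lie (app rho q) f x * lie X g x).
  by apply: smoothM => //; exact: lie_smooth.
have m3 : smooth_on V (lie (nb q X') g) by exact: lie_smooth.
rewrite -!embD //; last by apply: smoothD.
apply: emb_ext => //; first by apply: smoothD => //; apply: smoothD.
by move=> x Vx; rewrite addrC [RHS]addrAC -addrA addrC -addrA addrCA.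
Qed.

End Nabla.

Lemma l1_exists : exists l : bhom (TstarM M) Q,
  forall x (beta : dual (tangent x)) (tau : dual (Q x)), tau (l x beta) = - beta (dT x tau).
Proof.
have H x (beta : TstarM M x) : exists v : Q x, forall tau : dual (Q x),
    - (beta : dual (tangent x)) (dT x tau) = tau v.
  apply: (bidual_surj (Q_vbundle Q)) => a u v.
  by rewrite linearP dualD dualZ opprD mulrN.
pose l x beta := projT1 (cid (H x beta)).
have lE x beta (tau : dual (Q x)) : tau (l x beta) = - (beta : dual (tangent x)) (dT x tau).
  by rewrite -(projT2 (cid (H x beta)) tau).
have /= ex x := @linear_of R (TstarM M x) (Q x) (l x).
have ll x : exists phi : {linear TstarM M x -> Q x}, forall v, phi v = l x v.
  apply: ex => a u v; apply: (dual_separates (Q_vbundle Q)) => tau.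
  by rewrite lE dualD dualZ !lE addd scaled opprD mulrN.
pose phi x := projT1 (cid (ll x)).
have phiE x v : phi x v = l x v by exact: (projT2 (cid (ll x))).
have sm U (s : sect (TstarM M)) : open U -> smooth U s -> smooth (p := Q) U (fun x => phi x (s x)).
  move=> oU ss; apply: (smooth_by_pairing (Q_vbundle Q)) => // V a oV VU sa.
  have sX := app_smooth dT oV sa.
  have sp : smooth_on V (pairing s (app dT a)) by apply: ss.
  apply: (smooth_on_eq oV (smoothN oV sp)) => x Vx.
  by rewrite /pairing phiE lE.
by exists (BHom sm) => x beta tau; rewrite -lE -phiE.
Qed.

Definition is_Delta (Del : sect Q -> sect Qs -> sect Qs) : Prop :=
  forall U q t, open U -> smooth U q -> smooth U t -> smooth U (Del q t) /\
    i1 U (Del q t) = {{ QQ (i1 U (app psi q)), i1 U t }}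
                   + {{ i2 U (app dT t), i1 U (app psi q) }}.

Lemma Delta_exists : exists Del, is_Delta Del.
Proof.
have /choice[Del DelP] : forall qt : sect Q * sect Qs, exists r : sect Qs, forall U,
    [/\ open U, smooth U qt.1 & smooth U qt.2] -> smooth U r /\
    i1 U r = {{ QQ (i1 U (app psi qt.1)), i1 U qt.2 }}
                   + {{ i2 U (app dT qt.2), i1 U (app psi qt.1) }}.
  move=> qt; apply: glue_deg1 => U [oU sq st]; have sp := app_smooth psi oU sq.
  have sX := dT_smooth oU st.
  split=> //; first by apply: homD => //; hm.
  move=> V h oV; split.
    split=> //; first exact: smoothQ_sub oU sq h oV.
    exact: smoothQs_sub oU st h oV.
  by rewrite rmorphD !res_br // res_Q // !i1_res // i2_res.
by exists (fun q t => Del (q, t)) => U q t oU sq st; apply: (DelP (q, t)).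
Qed.

(** Commuting with functions survives a bracket with a degree 1 function, so the test of
    [adapted_eq0] can be iterated down to degree 1. *)
Lemma br_emb_br U f t (a : A U) : open U -> smooth_on U f -> smooth U t ->
  {{ emb U f, a }} = 0 -> {{ emb U f, {{ i1 U t, a }} }} = 0.
Proof.
move=> oU sf st z; have hf := hom_emb S oU sf; have ht := i1_hom sg oU st.
by rewrite (br_jacobiE oU _ (isT : ~~ odd (0 * 1)) hf ht) (br01 oU hf ht) z br0l // br0r // addr0.
Qed.

Lemma br_fun_mul2 U (f a c : A U) : open U -> hom 0 f -> hom 1 a -> hom 1 c ->
  {{ f, a * c }} = 0.
Proof.
move=> oU hf ha hc; rewrite (br_leibnizE oU _ (isT : ~~ odd (0 * 1)) hf ha).
by rewrite (br01 oU hf ha) (br01 oU hf hc) mul0r mulr0 addr0.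
Qed.

Lemma br_fun_mul3 U (f a c d : A U) : open U -> hom 0 f -> hom 1 a -> hom 1 c -> hom 1 d ->
  {{ f, a * c * d }} = 0.
Proof.
move=> oU hf ha hc hd; have hac := homM11 oU ha hc.
rewrite (br_leibnizE oU _ (isT : ~~ odd (0 * 2)) hf hac) (br_fun_mul2 oU hf ha hc).
by rewrite (br01 oU hf hd) mul0r mulr0 addr0.
Qed.

Section AdaptedVanishing.
Variables (V : set M) (r1 r2 : nat) (q : 'I_r1 -> sect Q) (t : 'I_r1 -> sect Qs)
  (b : 'I_r2 -> sect (TM M)) (beta : 'I_r2 -> sect (TstarM M)).
Hypothesis ad : adapted V q t b beta.
Let oV := adapted_open ad.
Variable a : A V.
Hypothesis a0 : forall W (h : W `<=` V) f, open W -> smooth_on W f ->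
  {{ emb W f, res h a }} = 0.

Lemma adapted_eq0_deg2 : hom 2 a ->
  (forall i j, {{ i1 V (app psi (q j)), {{ i1 V (app psi (q i)), a }} }} = 0) -> a = 0.
Proof.
move=> ha H; apply: (adapted_eq0 ad (k := 2)) => // i.
apply: (adapted_eq0 ad (k := 1)) => //.
- exact: hom_br12 (adapted_hom_s ad i) ha.
- move=> W h f oW sf; rewrite res_br // i1_res //; last exact: (adapted_s_smooth ad).
  by apply: br_emb_br => //; [apply: (adapted_s_smooth (adapted_sub oW h ad))|apply: a0].
Qed.

Lemma adapted_eq0_deg3 : hom 3 a ->
  (forall i j k : 'I_r1, {{ i1 V (app psi (q k)), {{ i1 V (app psi (q j)),
     {{ i1 V (app psi (q i)), a }} }} }} = 0) -> a = 0.
Proof.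
move=> ha H; apply: (adapted_eq0 ad (k := 3)) => // i.
have ss := adapted_s_smooth ad.
have h2 : hom 2 {{ i1 V (app psi (q i)), a }} by apply: hom_br13 (adapted_hom_s ad i) ha.
have f0 W (h : W `<=` V) f : open W -> smooth_on W f ->
    {{ emb W f, res h {{ i1 V (app psi (q i)), a }} }} = 0.
  move=> oW sf; rewrite res_br // i1_res //.
  by apply: br_emb_br => //; [apply: (adapted_s_smooth (adapted_sub oW h ad))|apply: a0].
apply: (adapted_eq0 ad (k := 2)) => // j.
apply: (adapted_eq0 ad (k := 1)) => //.
- exact: hom_br12 (adapted_hom_s ad j) h2.
- move=> W h f oW sf; rewrite res_br // [res h (i1 _ _)]i1_res //.
  by apply: br_emb_br => //; [apply: (adapted_s_smooth (adapted_sub oW h ad))|apply: f0].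
Qed.

End AdaptedVanishing.

(** * The curvature form *)

Section Curvature.
Variable nb : sect Q -> sect (TM M) -> sect (TM M).
Hypothesis nbP : is_nabla nb.
Variable rho : bhom Q (TM M).
Hypothesis rhoE : forall x v, rho x v = dT x (psi x v).

Definition is_dual_nabla (ns : sect Q -> sect (TstarM M) -> sect (TstarM M)) : Prop :=
  forall U q c, open U -> smooth U q -> smooth U c -> smooth U (ns q c) /\
    forall X, smooth U X -> forall x, U x ->
     pairing (ns q c) X x = lie (app rho q) (pairing c X) x - pairing c (nb q X) x.

Lemma dual_nabla_exists : exists ns, is_dual_nabla ns.
Proof.
pose G q (c : sect (TstarM M)) X x := lie (app rho q) (pairing c X) x - pairing c (nb q X) x.
(* [G q c] is tensorial only near points where [q] and [c] are smooth; at other points the value of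
   [ns] does not matter. *)
pose ns q c := projT1 (cid (tensorial_dual (T_vbundle sg) (G q c))).
have nsP q c := projT2 (cid (tensorial_dual (T_vbundle sg) (G q c))).
have hTs := Ts_vbundle sg.
have nsE U q c X x : open U -> U x -> smooth U q -> smooth U c -> smooth U X ->
    G q c X x = ns q c x (X x).
  move=> oU Ux sq sc sX; apply: (nsP q c x _ U) => //.
  move=> V f Y Z u oV Vx sf sY sZ e.
  have oUV := openI oU oV.
  have h1 := @subIsetl _ U V; have h2 := @subIsetr _ U V.
  have sqV := smoothQ_sub oU sq h1 oUV; have scV := smooth_sub hTs oU oUV h1 sc.
  have sYV := smoothT_sub oV sY h2 oUV; have sZV := smoothT_sub oV sZ h2 oUV.
  have sfV := smooth_on_sub h2 sf; have Wx : (U `&` V) x by split.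
  have eV : eq_on (U `&` V) u (sadd (smul f Y) Z) by move=> y /h2; apply: e.
  have pY := pairing_smooth oUV scV sYV; have pZ := pairing_smooth oUV scV sZV.
  have mY := smoothM oUV sfV pY.
  rewrite /G {2}/pairing (nb_right nbP rhoE oUV sfV sqV sYV sZV eV Wx).
  have -> : lie (app rho q) (pairing c u) x =
      f x * lie (app rho q) (pairing c Y) x + pairing c Y x * lie (app rho q) f x
      + lie (app rho q) (pairing c Z) x.
    rewrite /lie -(tangentM _ oUV Wx sfV pY) -(tangentD _ oUV Wx mY pZ).
    symmetry; apply: (tangent_eq _ oUV Wx); first exact: smoothD.
    by move=> y Vy; rewrite /pairing eV // /sadd /smul dualD dualZ.
  rewrite /sadd /smul !dualD !dualZ /pairing /GRing.scale /=; ring.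
exists ns => U q c oU sq sc; split.
  move=> V X oV VU sX; have sqV := smoothQ_sub oU sq VU oV.
  have scV := smooth_sub hTs oU oV VU sc.
  have sG : smooth_on V (G q c X).
    apply: smoothB => //.
      by apply: lie_smooth => //; [apply: app_smooth|apply: pairing_smooth].
    by apply: pairing_smooth => //; have [] := nbP oV sqV sX.
  by apply: (smooth_on_eq oV sG) => x Vx; rewrite (nsE V).
by move=> X sX x Ux; rewrite [LHS]/pairing -(nsE U).
Qed.

(* The value on [X] of the curvature form: the part of [Q X] cubic in the degree 1 generators,
   isolated by removing from a triple contraction the contribution of [nb]. *)
Definition curv_form U q1 q2 q3 X : A U :=
  let s q := i1 U (app psi q) in let Y q := i2 U (nb q X) in
  - ({{ s q3, {{ s q2, {{ s q1, QQ (i2 U X) }} }} }} + {{ s q3, {{ Y q1, s q2 }} }}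
     - {{ s q3, {{ Y q2, s q1 }} }} + {{ s q2, {{ Y q3, s q1 }} }}).

Section OpenSet.
Variables (U : set M) (oU : open U).
Variable X : sect (TM M).
Hypothesis sX : smooth U X.
Implicit Types q : sect Q.

Let s_ q : A U := i1 U (app psi q).
Let Y_ q : A U := i2 U (nb q X).

Lemma hom_s_ q : smooth U q -> hom 1 (s_ q).
Proof. by move=> sq; apply: i1_hom => //; apply: app_smooth. Qed.

Lemma hom_Y_ q : smooth U q -> hom 2 (Y_ q).
Proof. by move=> sq; apply: i2_hom => //; have [] := nbP oU sq sX. Qed.

Lemma hom_curv_form q1 q2 q3 : smooth U q1 -> smooth U q2 -> smooth U q3 ->
  hom 0 (curv_form U q1 q2 q3 X).
Proof.
move=> s1 s2 s3; rewrite /curv_form -!/(s_ _) -!/(Y_ _).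
have h1 := hom_s_ s1; have h2 := hom_s_ s2; have h3 := hom_s_ s3.
have k1 := hom_Y_ s1; have k2 := hom_Y_ s2; have k3 := hom_Y_ s3.
have hX : hom 3 (QQ (i2 U X)) by hm.
apply: homN => //; apply: homD => //; last hm.
apply: homB => //; last hm.
by apply: homD => //; hm.
Qed.

Lemma br_s_pair q q' : smooth U q -> smooth U q' -> exists2 g, smooth_on U g &
  {{ s_ q, s_ q' }} = emb U g.
Proof.
move=> sq sq'; have h1 := app_smooth psi oU sq; have h2 := app_smooth psi oU sq'.
exists (pairing (app psi q') (app dQ (app psi q))); last exact: dQP.
exact: dQ_pairing_smooth.
Qed.

(** Triple contractions of [Q X] fail to be skew because exchanging two brackets leaves one with the
    function [{s_ p, s_ p'}], on which [{s_ q, Q X}] acts through [nb q X]. The symmetrized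
    corrections of [curv_form] have this same value, so both skew-symmetries follow. *)
Lemma br_Y_pair q p p' : smooth U q -> smooth U p -> smooth U p' ->
  {{ s_ p, {{ Y_ q, s_ p' }} }} + {{ s_ p', {{ Y_ q, s_ p }} }} =
  {{ {{ s_ q, QQ (i2 U X) }}, {{ s_ p, s_ p' }} }}.
Proof.
move=> sq sp sp'; have h2 := hom_s_ sp; have h3 := hom_s_ sp'; have k1 := hom_Y_ sq.
have [g sG eg] := br_s_pair sp sp'.
have [sn en] := nbP oU sq sX.
have hz : hom 1 {{ Y_ q, s_ p }} by hm.
by rewrite eg en // -(i2_anchor sg oU sn sG) -eg (br2jacobi _ oU k1 h2) (br11C oU hz h3) addrC.
Qed.

Lemma curv_form_skew23 q1 q2 q3 : smooth U q1 -> smooth U q2 -> smooth U q3 ->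
  curv_form U q1 q3 q2 X = - curv_form U q1 q2 q3 X.
Proof.
move=> s1 s2 s3; rewrite /curv_form -!/(s_ _) -!/(Y_ _).
have h1 := hom_s_ s1; have h2 := hom_s_ s2; have h3 := hom_s_ s3.
have hX : hom 3 (QQ (i2 U X)) by hm.
have [g sG eg] := br_s_pair s2 s3; have hg := hom_emb S oU sG.
have hA : hom 2 {{ s_ q1, QQ (i2 U X) }} by hm.
have E := br_Y_pair s1 s2 s3.
rewrite (br11jacobi _ oU h2 h3) eg (br0skew oU hg hA) -eg -E; zmod.
Qed.

Lemma curv_form_skew12 q1 q2 q3 : smooth U q1 -> smooth U q2 -> smooth U q3 ->
  curv_form U q2 q1 q3 X = - curv_form U q1 q2 q3 X.
Proof.
move=> s1 s2 s3; rewrite /curv_form -!/(s_ _) -!/(Y_ _).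
have h1 := hom_s_ s1; have h2 := hom_s_ s2; have h3 := hom_s_ s3.
have hX : hom 3 (QQ (i2 U X)) by hm.
have [g sG eg] := br_s_pair s1 s2; have hg := hom_emb S oU sG.
have E := br_Y_pair s3 s1 s2.
have e1 : {{ s_ q3, {{ {{ s_ q1, s_ q2 }}, QQ (i2 U X) }} }} =
    - {{ {{ s_ q3, QQ (i2 U X) }}, {{ s_ q1, s_ q2 }} }}.
  rewrite eg (br0skew oU hg hX) brNr // (br_jacobiO oU _ (isT : odd (1 * 3)) h3 hX).
  by rewrite (br10 oU h3 hg) br0r // subr0.
rewrite (br11jacobi _ oU h1 h2) brBr // e1 -E; zmod.
Qed.

(** Linearity is checked in the last argument only; cyclic permutations bring the others into its
    place. *)
Lemma curv_form_comb3 f q1 q2 q3 q3' u : smooth_on U f -> smooth U q1 -> smooth U q2 ->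
  smooth U q3 -> smooth U q3' -> eq_on U u (sadd (smul f q3) q3') ->
  curv_form U q1 q2 u X = emb U f * curv_form U q1 q2 q3 X + curv_form U q1 q2 q3' X.
Proof.
move=> sf s1 s2 s3 s3' e; rewrite /curv_form -!/(s_ _) -!/(Y_ _).
have hQ := Q_vbundle Q; have hQs := Qs_vbundle Q; have hT := T_vbundle sg.
have h1 := hom_s_ s1; have h2 := hom_s_ s2; have h3 := hom_s_ s3; have h3' := hom_s_ s3'.
have k1 := hom_Y_ s1; have k2 := hom_Y_ s2; have k3 := hom_Y_ s3; have k3' := hom_Y_ s3'.
have hX : hom 3 (QQ (i2 U X)) by hm.
have hf := hom_emb S oU sf.
have su : smooth U u.
  by apply: (smooth_eq_on hQ oU (smooth_comb hQ oU sf s3 s3')) => x Ux; rewrite e.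
have eu : s_ u = emb U f * s_ q3 + s_ q3'.
  have p3 := app_smooth psi oU s3; have p3' := app_smooth psi oU s3'.
  have p := smooth_smul hQs oU sf p3.
  rewrite /s_ -i1Z // -i1D //; apply: i1_eq => //; first exact: app_smooth.
    exact: (smooth_sadd hQs).
  by move=> x Ux; rewrite /app e // /sadd /smul linearD linearZ.
have eY : Y_ u = emb U f * Y_ q3 + Y_ q3'.
  have n3 := nb_smooth nbP oU s3 sX; have n3' := nb_smooth nbP oU s3' sX.
  have p := smooth_smul hT oU sf n3.
  rewrite /Y_ -i2Z // -i2D //; apply: i2_eq => //; first exact: (nb_smooth nbP).
    exact: (smooth_sadd hT).
  exact: (nb_left nbP oU sf s3 s3' sX e).
have d1 : hom 1 {{ s_ q2, {{ s_ q1, QQ (i2 U X) }} }} by hm.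
have d2 : hom 1 {{ Y_ q1, s_ q2 }} by hm.
have d3 : hom 1 {{ Y_ q2, s_ q1 }} by hm.
have z a : hom 1 a -> {{ emb U f * s_ q3 + s_ q3', a }} =
    emb U f * {{ s_ q3, a }} + {{ s_ q3', a }}.
  by move=> ha; rewrite brDl // (brZl0 oU hf h3 ha (br01 oU hf ha)).
rewrite eu eY !z // brDl // (brZl0 oU hf k3 h1 (br01 oU hf h1)) brDr //.
rewrite (brZr0 oU _ h2 hf (br10 oU h2 hf)) mulrN !mulrDr mulrN; zmod.
Qed.

End OpenSet.

(** The derivatives of [f] come from two sources, the term [Q f * X] of [Q (f * X)], contracted in
    [lead], and the Leibniz rule of [nb] in the three corrections. They cancel in pairs. *)
Lemma curv_form_combX U f q1 q2 q3 X X' u : open U -> smooth_on U f -> smooth U q1 ->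
  smooth U q2 -> smooth U q3 -> smooth U X -> smooth U X' ->
  eq_on U u (sadd (smul f X) X') ->
  curv_form U q1 q2 q3 u = emb U f * curv_form U q1 q2 q3 X + curv_form U q1 q2 q3 X'.
Proof.
move=> oU sf s1 s2 s3 sX sX' e; rewrite /curv_form.
have hQs := Qs_vbundle Q; have hT := T_vbundle sg.
have h1 := hom_s_ oU s1; have h2 := hom_s_ oU s2; have h3 := hom_s_ oU s3.
have k1 := hom_Y_ oU sX s1; have k2 := hom_Y_ oU sX s2; have k3 := hom_Y_ oU sX s3.
have hf := hom_emb S oU sf; have hQf := homQ0 oU hf.
have hx : hom 2 (i2 U X) by hm.
have hc : hom 3 (QQ (i2 U X)) by hm.
have su : smooth U u.
  by apply: (smooth_eq_on hT oU (smooth_comb hT oU sf sX sX')) => x Ux; rewrite e.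
have eu : i2 U u = emb U f * i2 U X + i2 U X'.
  have p := smooth_smul hT oU sf sX.
  rewrite -i2Z // -i2D //; apply: i2_eq => //; exact: (smooth_sadd hT).
pose r q := lie (app rho q) f.
have sr q : smooth U q -> smooth_on U (r q).
  by move=> sq; apply: lie_smooth => //; apply: app_smooth.
have eY q : smooth U q -> i2 U (nb q u) =
    emb U f * i2 U (nb q X) + i2 U (nb q X') + emb U (r q) * i2 U X.
  move=> sq; have srq := sr q sq; have n1 := nb_smooth nbP oU sq sX; have n2 := nb_smooth nbP oU sq sX'.
  have p1 := smooth_smul hT oU sf n1; have p2 := smooth_sadd hT oU p1 n2.
  have p3 := smooth_smul hT oU (sr q sq) sX.
  rewrite -!i2Z // -!i2D //; apply: i2_eq => //; first exact: (nb_smooth nbP).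
    exact: (smooth_sadd hT).
  exact: (nb_right nbP rhoE oU sf sq sX sX' e).
have er q : smooth U q -> {{ i1 U (app psi q), QQ (emb U f) }} = emb U (r q).
  by move=> sq; rewrite i1_QembE -?(app_rho _ rhoE) //; apply: app_smooth.
set a1 := i1 U (app psi q1) in h1 *; set a2 := i1 U (app psi q2) in h2 *.
set a3 := i1 U (app psi q3) in h3 *.
pose z1 := {{ a1, i2 U X }}; pose z2 := {{ a2, i2 U X }}.
have hz1 : hom 1 z1 by rewrite /z1; hm.
have hz2 : hom 1 z2 by rewrite /z2; hm.
have hw : hom 0 {{ a2, z1 }} by hm.
have R1 := hom_emb S oU (sr _ s1); have R2 := hom_emb S oU (sr _ s2).
have R3 := hom_emb S oU (sr _ s3).
have lead : {{ a3, {{ a2, {{ a1, QQ (emb U f) * i2 U X }} }} }} =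
    emb U (r q1) * {{ a3, z2 }} - emb U (r q2) * {{ a3, z1 }} + emb U (r q3) * {{ a2, z1 }}.
  rewrite (br_leibnizO oU _ (isT : odd (1 * 1)) h1 hQf) er // brBr //.
  rewrite (brZr0 oU _ h2 R1 (br10 oU h2 R1)) (br_leibnizO oU _ (isT : odd (1 * 1)) h2 hQf) er //.
  rewrite !brBr // (brZr0 oU _ h3 R1 (br10 oU h3 R1)) (brZr0 oU _ h3 R2 (br10 oU h3 R2)).
  rewrite (br_leibnizO oU _ (isT : odd (1 * 1)) h3 hQf) er // (br10 oU h3 hw) mulr0 -/z1 -/z2.
  zmod.
have sc a : hom 1 a -> forall c, {{ a, emb U f * c }} = emb U f * {{ a, c }}.
  by move=> ha c; rewrite (brZr0 oU _ ha hf (br10 oU ha hf)).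
have scr (a g c : A U) : hom 1 a -> hom 0 g -> {{ a, g * c }} = g * {{ a, c }}.
  by move=> ha hg; rewrite (brZr0 oU _ ha hg (br10 oU ha hg)).
have scl (g a c : A U) : hom 0 g -> hom 2 a -> hom 1 c -> {{ g * a, c }} = g * {{ a, c }}.
  by move=> hg ha hc'; rewrite (brZl0 oU hg ha hc' (br01 oU hg hc')).
rewrite eu QD // Q_leibniz0 // !eY // !brDr // lead !sc // !brDl // !scl // !brDr // !scr //.
have x1 : {{ i2 U X, a1 }} = - z1 by apply: br2skew oU hx h1.
have x2 : {{ i2 U X, a2 }} = - z2 by apply: br2skew oU hx h2.
rewrite x1 x2 !brNr // !mulrN !mulrDr !mulrN; zmod.
Qed.

Definition is_curvature (om : sect Q -> sect Q -> sect Q -> sect (TstarM M)) : Prop :=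
  forall U q1 q2 q3, open U -> smooth U q1 -> smooth U q2 -> smooth U q3 ->
    smooth U (om q1 q2 q3) /\
    forall X, smooth U X -> emb U (pairing (om q1 q2 q3) X) = curv_form U q1 q2 q3 X.

Lemma curvature_exists : exists om, is_curvature om.
Proof.
have /choice[om omP] : forall p : sect Q * sect Q * sect Q, exists a : sect (TstarM M),
    forall U, [/\ open U, smooth U p.1.1, smooth U p.1.2 & smooth U p.2] -> smooth U a /\
    forall X, smooth U X -> emb U (pairing a X) = curv_form U p.1.1 p.1.2 p.2 X.
  move=> p; apply: (glue_dual (T_vbundle sg)).
  - by move=> U [].
  - by move=> U V [oU s1 s2 s3] oV VU; split=> //; apply: (smooth_sub (Q_vbundle Q) oU oV).
  - by move=> U X [oU s1 s2 s3] sX; apply: hom_curv_form.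
  - move=> U V h X [oU s1 s2 s3] oV sX.
    have a1 := app_smooth psi oU s1; have a2 := app_smooth psi oU s2.
    have a3 := app_smooth psi oU s3.
    have n1 := nb_smooth nbP oU s1 sX; have n2 := nb_smooth nbP oU s2 sX.
    have n3 := nb_smooth nbP oU s3 sX.
    by rewrite /curv_form rmorphN !(rmorphD, rmorphN) !res_br // res_Q // !i1_res // !i2_res.
  by move=> U f X X' u [oU s1 s2 s3] sf sX sX' e; apply: curv_form_combX.
by exists (fun q1 q2 q3 => om (q1, q2, q3)) => U q1 q2 q3 oU s1 s2 s3; apply: (omP (q1, q2, q3)).
Qed.

End Curvature.

(** * Assembling the split Lie 2-algebroid and its dual *)

Section SplitData.
Variables (rho : bhom Q (TM M)) (l : bhom (TstarM M) Q).
Hypothesis rhoE : forall x v, rho x v = dT x (psi x v).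
Hypothesis lE : forall x (beta : dual (tangent x)) (tau : dual (Q x)),
  tau (l x beta) = - beta (dT x tau).
Variables (Del : sect Q -> sect Qs -> sect Qs) (dl : sect Q -> sect Q -> sect Q).
Variable nb : sect Q -> sect (TM M) -> sect (TM M).
Variable ns : sect Q -> sect (TstarM M) -> sect (TstarM M).
Variable om0 : sect Q -> sect Q -> sect Q -> sect (TstarM M).
Hypotheses (DelP : is_Delta Del) (dlP : is_dull dl) (nbP : is_nabla nb).
Hypotheses (nsP : is_dual_nabla nb rho ns) (om0P : is_curvature nb om0).

Let hQ := Q_vbundle Q.
Let hQs := Qs_vbundle Q.
Let hT := T_vbundle sg.
Let hTs := Ts_vbundle sg.

Lemma nb_connection : is_connection rho nb.
Proof.
apply: (connection_of_linear hT).
- exact: nb_smooth nbP.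
- exact: nb_left nbP.
- move=> U f q e e1 u; exact: (nb_right nbP rhoE (u := u)).
Qed.

Lemma ns_smooth U q c : open U -> smooth U q -> smooth U c -> smooth U (ns q c).
Proof. by move=> oU sq sc; have [] := nsP oU sq sc. Qed.

Lemma ns_connection : is_connection rho ns.
Proof.
apply: (connection_of_linear hTs).
- exact: ns_smooth.
- move=> U f q q' u c oU sf sq sq' sc e x Ux; apply: dual_ext => v.
  have [V [X [oV Vx VU sX <-]]] := local_section hT (v : TM M x) oU Ux.
  have sqV := smoothQ_sub oU sq VU oV; have sqV' := smoothQ_sub oU sq' VU oV.
  have scV := smooth_sub hTs oU oV VU sc; have sfV := smooth_on_sub VU sf.
  have eV : eq_on V u (sadd (smul f q) q') by move=> y /VU; apply: e.
  have suV : smooth V u.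
    by apply: (smooth_eq_on hQ oV (smooth_comb hQ oV sfV sqV sqV')) => y Vy; rewrite eV.
  have [_ n0] := nsP oV suV scV; have [_ n1] := nsP oV sqV scV; have [_ n2] := nsP oV sqV' scV.
  rewrite addd scaled -!/(pairing _ X x) n0 // n1 // n2 // /pairing.
  rewrite (nb_left nbP oV sfV sqV sqV' sX eV Vx) /sadd /smul dualD dualZ.
  have -> : lie (app rho u) (pairing c X) x =
      f x * lie (app rho q) (pairing c X) x + lie (app rho q') (pairing c X) x.
    by rewrite /lie /app eV // /sadd /smul linearD linearZ.
  by rewrite /pairing; ring.
- move=> U f q c c' u oU sf sq sc sc' e x Ux; apply: dual_ext => v.
  have [V [X [oV Vx VU sX <-]]] := local_section hT (v : TM M x) oU Ux.
  have sqV := smoothQ_sub oU sq VU oV; have sfV := smooth_on_sub VU sf.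
  have scV := smooth_sub hTs oU oV VU sc; have scV' := smooth_sub hTs oU oV VU sc'.
  have eV : eq_on V u (sadd (smul f c) c') by move=> y /VU; apply: e.
  have suV : smooth V u.
    by apply: (smooth_eq_on hTs oV (smooth_comb hTs oV sfV scV scV')) => y Vy; rewrite eV.
  have [_ n0] := nsP oV sqV suV; have [_ n1] := nsP oV sqV scV; have [_ n2] := nsP oV sqV scV'.
  have p1 := pairing_smooth oV scV sX; have p2 := pairing_smooth oV scV' sX.
  have m1 := smoothM oV sfV p1.
  rewrite !addd !scaled -!/(pairing _ X x) n0 // n1 // n2 //.
  have -> : lie (app rho q) (pairing u X) x = f x * lie (app rho q) (pairing c X) x
      + pairing c X x * lie (app rho q) f x + lie (app rho q) (pairing c' X) x.
    rewrite /lie -(tangentM _ oV Vx sfV p1) -(tangentD _ oV Vx m1 p2).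
    symmetry; apply: (tangent_eq _ oV Vx); first exact: smoothD.
    by move=> y Vy; rewrite /pairing eV.
  rewrite [pairing u _ _]/pairing eV // /sadd /smul addd scaled /pairing; ring.
Qed.

Lemma om0_skew12 U q1 q2 q3 : open U -> smooth U q1 -> smooth U q2 -> smooth U q3 ->
  eq_on U (om0 q1 q2 q3) (fun x => - om0 q2 q1 q3 x).
Proof.
move=> oU s1 s2 s3; have [w1 _] := om0P oU s1 s2 s3; have [w2 _] := om0P oU s2 s1 s3.
apply: (covector_ext (S := S) hT) => //; first exact: (smooth_opp hTs).
move=> V X oV VU sX.
have s1V := smoothQ_sub oU s1 VU oV; have s2V := smoothQ_sub oU s2 VU oV.
have s3V := smoothQ_sub oU s3 VU oV.
have [p1 -> //] := om0P oV s1V s2V s3V; have [p2 e2] := om0P oV s2V s1V s3V.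
rewrite (curv_form_skew12 nbP oV sX s2V s1V s3V) -e2 // -embN //; exact: pairing_smooth.
Qed.

Lemma om0_skew23 U q1 q2 q3 : open U -> smooth U q1 -> smooth U q2 -> smooth U q3 ->
  eq_on U (om0 q1 q2 q3) (fun x => - om0 q1 q3 q2 x).
Proof.
move=> oU s1 s2 s3; have [w1 _] := om0P oU s1 s2 s3; have [w2 _] := om0P oU s1 s3 s2.
apply: (covector_ext (S := S) hT) => //; first exact: (smooth_opp hTs).
move=> V X oV VU sX.
have s1V := smoothQ_sub oU s1 VU oV; have s2V := smoothQ_sub oU s2 VU oV.
have s3V := smoothQ_sub oU s3 VU oV.
have [p1 -> //] := om0P oV s1V s2V s3V; have [p2 e2] := om0P oV s1V s3V s2V.
rewrite (curv_form_skew23 nbP oV sX s1V s3V s2V) -e2 // -embN //; exact: pairing_smooth.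
Qed.

Lemma om0_cycle U q1 q2 q3 : open U -> smooth U q1 -> smooth U q2 -> smooth U q3 ->
  eq_on U (om0 q1 q2 q3) (om0 q2 q3 q1).
Proof.
move=> oU s1 s2 s3 x Ux.
by rewrite (om0_skew12 oU s1 s2 s3 Ux) (om0_skew23 oU s2 s1 s3 Ux) opprK.
Qed.

Lemma om0_comb3 U f q1 q2 q3 q3' u : open U -> smooth_on U f -> smooth U q1 ->
  smooth U q2 -> smooth U q3 -> smooth U q3' -> eq_on U u (sadd (smul f q3) q3') ->
  eq_on U (om0 q1 q2 u) (sadd (smul f (om0 q1 q2 q3)) (om0 q1 q2 q3')).
Proof.
move=> oU sf s1 s2 s3 s3' e.
have su : smooth U u.
  by apply: (smooth_eq_on hQ oU (smooth_comb hQ oU sf s3 s3')) => x Ux; rewrite e.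
have [w1 _] := om0P oU s1 s2 s3; have [w2 _] := om0P oU s1 s2 s3'.
have [w3 _] := om0P oU s1 s2 su.
apply: (covector_ext (S := S) hT) => //; first exact: (smooth_comb hTs).
move=> V X oV VU sX.
have s1V := smoothQ_sub oU s1 VU oV; have s2V := smoothQ_sub oU s2 VU oV.
have s3V := smoothQ_sub oU s3 VU oV; have s3V' := smoothQ_sub oU s3' VU oV.
have suV := smoothQ_sub oU su VU oV; have sfV := smooth_on_sub VU sf.
have eV : eq_on V u (sadd (smul f q3) q3') by move=> y /VU; apply: e.
have [p1 -> //] := om0P oV s1V s2V suV; have [p2 e2] := om0P oV s1V s2V s3V.
have [p3 e3] := om0P oV s1V s2V s3V'.
rewrite (curv_form_comb3 nbP oV sX sfV s1V s2V s3V s3V' eV) -e2 // -e3 //.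
have k2 := pairing_smooth oV p2 sX; have k3 := pairing_smooth oV p3 sX.
by rewrite -embM // -embD //; apply: smoothM.
Qed.

Lemma om0_eq3 V x p q r r' : open V -> V x -> smooth V p -> smooth V q ->
  smooth V r -> smooth V r' -> r x = r' x -> om0 p q r x = om0 p q r' x.
Proof.
move=> oV Vx sp sq sr sr' e.
have tens : tensorial (W := TstarM M x) x (fun r => om0 p q r x).
  move=> W f a c u oW Wx sf sa sc eu.
  have oVW := openI oV oW.
  have h1 := @subIsetl _ V W; have h2 := @subIsetr _ V W.
  have Dx : (V `&` W) x by split.
  rewrite (om0_comb3 oVW (smooth_on_sub h2 sf) (smoothQ_sub oV sp h1 oVW)
    (smoothQ_sub oV sq h1 oVW) (smoothQ_sub oW sa h2 oVW) (smoothQ_sub oW sc h2 oVW) _ Dx) //.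
  by move=> y /h2; apply: eu.
exact: (tensorial_eq_at hQ tens oV Vx sr oV Vx sr' e).
Qed.

(** One argument is exchanged at a time, always in the last place; after three cyclic permutations
    the order is restored. *)
Lemma om0_eq V x p q r p' q' r' : open V -> V x ->
  smooth V p -> smooth V q -> smooth V r -> smooth V p' -> smooth V q' -> smooth V r' ->
  p x = p' x -> q x = q' x -> r x = r' x -> om0 p q r x = om0 p' q' r' x.
Proof.
move=> oV Vx sp sq sr sp' sq' sr' ep eq er.
rewrite (om0_eq3 oV Vx sp sq sr sr' er) (om0_cycle oV sp sq sr' Vx).
rewrite (om0_eq3 oV Vx sq sr' sp sp' ep) (om0_cycle oV sq sr' sp' Vx).
by rewrite (om0_eq3 oV Vx sr' sp' sq sq' eq) (om0_cycle oV sr' sp' sq' Vx).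
Qed.

(** [omega] acts on vectors while [om0] acts on sections. It is [om0] on local extensions, which is
    legitimate by [om0_eq]; its linearity rests on that of the extension. *)
Lemma omega_exists : exists om : forall x, Q x -> Q x -> Q x -> dual (tangent x),
  [/\ forall U q1 q2 q3 x, open U -> U x -> smooth U q1 -> smooth U q2 -> smooth U q3 ->
        om x (q1 x) (q2 x) (q3 x) = om0 q1 q2 q3 x,
      forall x a (u v w z : Q x), om x (a *: u + v) w z = a *: om x u w z + om x v w z,
      forall x (u v w : Q x), om x u v w = - om x v u w
    & forall x (u v w : Q x), om x u v w = - om x u w v].
Proof.
have [ext extP] := extension hQ.
exists (fun x u v w => om0 (ext x u) (ext x v) (ext x w) x); split.
- move=> U q1 q2 q3 x oU Ux s1 s2 s3; have [[W [oW Wx sE]] eE _] := extP x.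
  have oV := openI oU oW.
  have h1 := @subIsetl _ U W; have h2 := @subIsetr _ U W.
  have sEV v := smoothQ_sub oW (sE v) h2 oV.
  apply: (om0_eq oV) => //; exact: smoothQ_sub oU _ h1 oV.
- move=> x a u v w z; have [[W [oW Wx sE]] eE lEx] := extP x.
  have sa := smooth_cst (M := M) W a.
  have sS : smooth W (ext x (a *: u + v)) by [].
  rewrite (om0_cycle oW sS (sE w) (sE z) Wx).
  rewrite (om0_comb3 oW sa (sE w) (sE z) (sE u) (sE v) _ Wx); last by move=> y _; apply: lEx.
  rewrite /sadd /smul (om0_cycle oW (sE u) (sE w) (sE z) Wx).
  by rewrite (om0_cycle oW (sE v) (sE w) (sE z) Wx).
- move=> x u v w; have [[W [oW Wx sE]] eE lEx] := extP x.
  exact: (om0_skew12 oW (sE u) (sE v) (sE w) Wx).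
- move=> x u v w; have [[W [oW Wx sE]] eE lEx] := extP x.
  exact: (om0_skew23 oW (sE u) (sE v) (sE w) Wx).
Qed.

Section Adapted.
Variables (V : set M) (r1 r2 : nat) (q : 'I_r1 -> sect Q) (t : 'I_r1 -> sect Qs)
  (b : 'I_r2 -> sect (TM M)) (beta : 'I_r2 -> sect (TstarM M)).
Hypothesis ad : adapted V q t b beta.
Let oV := adapted_open ad.

(** Here and in degrees 1 and 2 below, the two sides are shown equal by testing their difference
    against functions and against iterated brackets with the frame. *)
Lemma adapted_Q_function f : smooth_on V f ->
  QQ (emb V f) = \sum_(i < r1) emb V (lie (app rho (q i)) f) * i1 V (t i).
Proof.
move=> sf; have sq := adapted_q_smooth ad; have ss := adapted_s_smooth ad.
have sl i : smooth_on V (lie (app rho (q i)) f) by apply: lie_smooth => //; apply: app_smooth.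
have ht := adapted_hom_t ad; have hs := adapted_hom_s ad.
have hf := hom_emb S oV sf.
apply/eqP; rewrite -subr_eq0; apply/eqP.
have hd : hom 1 (QQ (emb V f) - \sum_(i < r1) emb V (lie (app rho (q i)) f) * i1 V (t i)).
  apply: homB => //; first hm.
  by apply: hom_sum => // i _; apply: homM0 => //; hm.
apply: (adapted_eq0 ad (k := 1)) => //.
  move=> W h g oW sG; apply: br_emb_deg1 => //; exact: res_hom.
move=> a; rewrite brBr // i1_QembE // br_sumr // (bigD1 a) //= big1 ?addr0.
  by rewrite (adapted_br_emb ad a (k := 1)) // (adapted_br ad) eqxx mulr1 (app_rho _ rhoE) subrr.
move=> i /negbTE ia.
by rewrite (adapted_br_emb ad a (k := 1)) // (adapted_br ad) ia mulr0.
Qed.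

Lemma adapted_Q_deg1 (k : 'I_r1) :
  QQ (i1 V (t k)) =
    - (\sum_(i < r1) \sum_(j < r1 | (i < j)%N)
        emb V (pairing (t k) (dl (q i) (q j))) * (i1 V (t i) * i1 V (t j)))
    + i2 V (app dT (t k)).
Proof.
have sq := adapted_q_smooth ad; have ss := adapted_s_smooth ad; have st := adapted_t ad.
have ht := adapted_hom_t ad; have hs := adapted_hom_s ad.
have sdl i j := dl_smooth dlP oV (sq i) (sq j).
have sp i j : smooth_on V (pairing (t k) (dl (q i) (q j))) by apply: pairing_smooth.
have sX := dT_smooth oV (st k).
set sum2 := \sum_(i < r1) _.
have h2 : hom 2 sum2.
  apply: hom_sum => // i _; apply: hom_sum => // j _; apply: homM0 => //; first exact: hom_emb.
  exact: homM11.
apply/eqP; rewrite -subr_eq0; apply/eqP.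
have E : QQ (i1 V (t k)) - (- sum2 + i2 V (app dT (t k))) =
    (QQ (i1 V (t k)) - i2 V (app dT (t k))) + sum2 by zmod.
rewrite E; apply: (adapted_eq0_deg2 ad).
(* Brackets with functions: [Q (t k)] and [i2] of [dT (t k)] have the same anchor, and products of
   degree 1 functions have none. *)
- move=> W h f oW sf; have hf := hom_emb S oW sf.
  have stW := adapted_t (adapted_sub oW h ad).
  have sXW := dT_smooth oW (stW k).
  have hQt : hom 2 (QQ (i1 W (t k))) by have := stW k; hm.
  have hX : hom 2 (i2 W (app dT (t k))) by hm.
  rewrite rmorphD rmorphB res_Q // i1_res // i2_res // brDr // brBr //.
  rewrite (br0skew oW hf hQt) (br0skew oW hf hX) dTP // i2_anchor // subrr add0r.
  rewrite rmorph_sum br_sumr // big1 // => i _; rewrite rmorph_sum br_sumr // big1 // => j _.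
  rewrite !rmorphM emb_res // !i1_res //.
  have hi := adapted_hom_t (adapted_sub oW h ad) i.
  have hj := adapted_hom_t (adapted_sub oW h ad) j.
  have he := hom_emb S oW (smooth_on_sub h (sp i j)).
  by rewrite (brZr0 oW _ hf he (br00 oW hf he)) (br_fun_mul2 oW hf hi hj) mulr0.
- apply: homD => //; apply: homB => //; last hm.
  by have := st k; hm.
move=> i j; rewrite [poisson _ (_ + sum2)]brDr // [poisson _ (_ + poisson _ sum2)]brDr //.
rewrite (dull_formE oV (st k) (ss i) (ss j)).
have e1 : {{ i1 V (t k), i1 V (app psi (q j)) }} = (k == j)%:R.
  by rewrite (br11C oV (ht k) (hs j)) (adapted_br ad).
rewrite e1 (adapted_br ad) -!emb_natr // (br_cst oV _ (homQ1 oV (hs i))) Q_cst // br0r //.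
rewrite (@adapted_quadratic _ _ _ _ _ _ _ ad (fun i j => pairing (t k) (dl (q i) (q j)))) //.
  by have [_ -> //] := dlP oV (sq i) (sq j); zmod.
move=> i' j' x Vx; rewrite /pairing (dl_skew dlP oV (sq i') (sq j') Vx) /smul scaleN1r.
exact: dualN.
Qed.

(** The pairings of dual frames are constant, so the coefficients of [ns] are minus those of [nb],
    and the sum over [j] reassembles the vector field [nb (q i) (b m)]. *)
Lemma adapted_nabla_term (m : 'I_r2) (i : 'I_r1) :
  \sum_(j < r2) emb V (pairing (ns (q i) (beta j)) (b m)) * (i1 V (t i) * i2 V (b j)) =
  - (i1 V (t i) * i2 V (nb (q i) (b m))).
Proof.
have sq := adapted_q_smooth ad; have sb := adapted_b_smooth ad.
have sbeta := adapted_beta ad; have ht := adapted_hom_t ad.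
have sY := nb_smooth nbP oV (sq i) (sb m).
have sp j : smooth_on V (pairing (beta j) (nb (q i) (b m))) by apply: pairing_smooth.
have sn j := ns_smooth oV (sq i) (sbeta j).
have E j : emb V (pairing (ns (q i) (beta j)) (b m)) =
    - emb V (pairing (beta j) (nb (q i) (b m))).
  rewrite -embN //; apply: emb_ext => //; first exact: pairing_smooth.
  move=> x Vx; have [_ -> //] := nsP oV (sq i) (sbeta j).
  suff -> : lie (app rho (q i)) (pairing (beta j) (b m)) x = 0 by rewrite sub0r.
  rewrite -[RHS](tangent_cst (app rho (q i) x) (j == m)%:R) /lie.
  apply: (tangent_eq _ oV Vx); first exact: pairing_smooth.
  by move=> y Vy; rewrite (adapted_betab ad).
have -> : i2 V (nb (q i) (b m)) =
    \sum_(j < r2) emb V (pairing (beta j) (nb (q i) (b m))) * i2 V (b j).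
  rewrite -(@i2_sum _ _ _ _ _ _ _ oV _ _ (fun j => pairing (beta j) (nb (q i) (b m))) b) //.
  apply: i2_eq => //.
    by apply: (smooth_sum_sect hT) => // j; apply: (smooth_smul hT).
  move=> x Vx; exact: (adapted_decT ad).
rewrite mulr_sumr -sumrN; apply: eq_bigr => j _.
rewrite E mulNr !mulrA; congr (- (_ * _)).
exact: (fn_commE oV (isT : ~~ odd (0 * 1)) (hom_emb S oV (sp j)) (ht i)).
Qed.

Lemma adapted_Q_deg2 (m : 'I_r2) :
  QQ (i2 V (b m)) =
    - (\sum_(i < r1) \sum_(j < r1 | (i < j)%N) \sum_(k < r1 | (j < k)%N)
         emb V (pairing (om0 (q i) (q j) (q k)) (b m))
         * (i1 V (t i) * i1 V (t j) * i1 V (t k)))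
    - \sum_(i < r1) \sum_(j < r2)
         emb V (pairing (ns (q i) (beta j)) (b m)) * (i1 V (t i) * i2 V (b j)).
Proof.
under [X in _ = _ - X]eq_bigr => i _ do rewrite adapted_nabla_term.
rewrite sumrN opprK.
have sq := adapted_q_smooth ad; have sb := adapted_b_smooth ad; have st := adapted_t ad.
have ss := adapted_s_smooth ad; have ht := adapted_hom_t ad; have hs := adapted_hom_s ad.
have sY i := nb_smooth nbP oV (sq i) (sb m).
have so i j (k : 'I_r1) : smooth V (om0 (q i) (q j) (q k)).
  by have [] := om0P oV (sq i) (sq j) (sq k).
have sp i j (k : 'I_r1) := pairing_smooth oV (so i j k) (sb m).
have hX : hom 2 (i2 V (b m)) by have := sb m; hm.
have hc := homQ2 oV hX.
have hY i : hom 2 (i2 V (nb (q i) (b m))) by have := sY i; hm.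
set sum3 := \sum_(i < r1) \sum_(j < r1 | _) _.
set N := \sum_(i < r1) i1 V (t i) * _.
have h3 : hom 3 sum3.
  apply: hom_sum => // i _; apply: hom_sum => // j _; apply: hom_sum => // k _.
  by apply: homM0 => //; [exact: hom_emb|apply: homM21 => //; apply: homM11].
have hN : hom 3 N by apply: hom_sum => // i _; apply: homM12.
apply/eqP; rewrite -subr_eq0; apply/eqP.
have E : QQ (i2 V (b m)) - (- sum3 + N) = (QQ (i2 V (b m)) - N) + sum3 by zmod.
rewrite E; apply: (adapted_eq0_deg3 ad).
- move=> W h f oW sf; have hf := hom_emb S oW sf; have adW := adapted_sub oW h ad.
  have sqW := adapted_q_smooth adW; have sbW := adapted_b_smooth adW.
  have htW := adapted_hom_t adW; have hsW := adapted_hom_s adW.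
  have sYW i := nb_smooth nbP oW (sqW i) (sbW m).
  have hXW : hom 2 (i2 W (b m)) by have := sbW m; hm.
  have hYW i : hom 2 (i2 W (nb (q i) (b m))) by have := sYW i; hm.
  have hcW := homQ2 oW hXW.
  have sl i : smooth_on W (lie (nb (q i) (b m)) f) by apply: lie_smooth.
  have z3 : {{ emb W f, res h sum3 }} = 0.
    rewrite rmorph_sum br_sumr // big1 // => i _; rewrite rmorph_sum br_sumr // big1 // => j _.
    rewrite rmorph_sum br_sumr // big1 // => k _; rewrite !rmorphM emb_res // !i1_res //.
    have he := hom_emb S oW (smooth_on_sub h (sp i j k)).
    by rewrite (brZr0 oW _ hf he (br00 oW hf he)) br_fun_mul3 // mulr0.
  have eN : res h N = \sum_(i < r1) i1 W (t i) * i2 W (nb (q i) (b m)).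
    by rewrite rmorph_sum; apply: eq_bigr => i _; rewrite rmorphM i1_res // i2_res.
  have hNW : hom 3 (res h N) by apply: res_hom.
  rewrite rmorphD rmorphB brDr // z3 addr0 brBr // res_Q // i2_res //.
  rewrite (br0skew oW hf hcW) (br0skew oW hf hNW) opprK.
  suff -> : {{ QQ (i2 W (b m)), emb W f }} = {{ res h N, emb W f }} by rewrite addNr.
  rewrite eN br_suml //.
  have -> : \sum_(i < r1) {{ i1 W (t i) * i2 W (nb (q i) (b m)), emb W f }} =
      \sum_(i < r1) emb W (lie (nb (q i) (b m)) f) * i1 W (t i).
    apply: eq_bigr => i _.
    rewrite (br_leibniz_lE oW (isT : ~~ odd (2 * 0)) (htW i) (hYW i) hf).
    rewrite (br10 oW (htW i) hf) mul0r addr0 i2_anchor //.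
    by apply: (fn_commE oW (isT : ~~ odd (1 * 0)) (htW i)); apply: hom_emb.
  (* Two functions of degree 1 are compared by contraction. Since [{s a, f}] is zero, the
     contraction of [{Q X, f}] with [s a] is [{{s a, Q X}, f}], the derivative of [f] along
     [nb (q a) X]. *)
  apply/eqP; rewrite -subr_eq0; apply/eqP.
  apply: (adapted_eq0 adW (k := 1)) => //.
  + apply: homB => //; first exact: hom_br30.
    by apply: hom_sum => // i _; apply: homM0 => //; apply: hom_emb.
  + move=> W' h' g oW' sG; apply: br_emb_deg1 => //; apply: res_hom => //.
    apply: homB => //; first exact: hom_br30.
    by apply: hom_sum => // i _; apply: homM0 => //; apply: hom_emb.
  move=> a; rewrite brBr // (br_jacobiO oW _ (isT : odd (1 * 3)) (hsW a) hcW).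
  rewrite (br10 oW (hsW a) hf) br0r // subr0.
  have [_ -> //] := nbP oW (sqW a) (sbW m).
  rewrite br_sumr // (bigD1 a) //= big1 ?addr0.
    by rewrite (adapted_br_emb adW a (k := 1)) // (adapted_br adW) eqxx mulr1 subrr.
  move=> i /negbTE ia.
  by rewrite (adapted_br_emb adW a (k := 1)) // (adapted_br adW) ia mulr0.
- by apply: homD => //; apply: homB.
have k12 i j (k : 'I_r1) x : V x -> pairing (om0 (q i) (q j) (q k)) (b m) x =
    - pairing (om0 (q j) (q i) (q k)) (b m) x.
  by move=> Vx; rewrite /pairing (om0_skew12 oV (sq i) (sq j) (sq k) Vx).
have k23 i j (k : 'I_r1) x : V x -> pairing (om0 (q i) (q j) (q k)) (b m) x =
    - pairing (om0 (q i) (q k) (q j)) (b m) x.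
  by move=> Vx; rewrite /pairing (om0_skew23 oV (sq i) (sq j) (sq k) Vx).
move=> a c d; rewrite [poisson _ (_ + sum3)]brDr // [poisson _ (_ + poisson _ sum3)]brDr //.
rewrite [poisson _ (_ + poisson _ (poisson _ sum3))]brDr //.
rewrite (@adapted_cubic _ _ _ _ _ _ _ ad (fun i j (k : 'I_r1) => pairing (om0 (q i) (q j) (q k)) (b m))) //.
have [_ -> //] := om0P oV (sq a) (sq c) (sq d).
have L (x : 'I_r1) (y z : A V) : hom 1 y -> {{ i1 V (app psi (q x)), y * z }} =
    {{ i1 V (app psi (q x)), y }} * z - y * {{ i1 V (app psi (q x)), z }}.
  by move=> hy; rewrite (br_leibnizO oV _ (isT : odd (1 * 1)) (hs x) hy).
have pick (x : 'I_r1) (F : 'I_r1 -> A V) : \sum_(i < r1) (i == x)%:R * F i = F x.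
  rewrite (bigD1 x) //= eqxx mul1r big1 ?addr0 // => i /negbTE ->; exact: mul0r.
pose Y i := i2 V (nb (q i) (b m)); pose s i := i1 V (app psi (q i)).
(* The triple contraction of the connection part [N] is, up to sign, the sum of the corrections in
   [curv_form]. Removing it leaves minus the coefficient of the cubic part. *)
have N1 : {{ s a, N }} = Y a - \sum_i i1 V (t i) * {{ s a, Y i }}.
  rewrite br_sumr // -[Y a](pick a Y) -sumrB; apply: eq_bigr => i _.
  by rewrite L // (adapted_br ad).
have N2 : {{ s c, {{ s a, N }} }} =
    {{ s c, Y a }} - {{ s a, Y c }} + \sum_i i1 V (t i) * {{ s c, {{ s a, Y i }} }}.
  rewrite N1 brBr // br_sumr //.
  rewrite (eq_bigr (fun i => (i == c)%:R * {{ s a, Y i }} - i1 V (t i) * {{ s c, {{ s a, Y i }} }})).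
    by rewrite sumrB (pick c (fun i => {{ s a, Y i }})) opprD opprK addrA.
  by move=> i _; rewrite L ?(adapted_br ad) //; apply: hom_br12 => //; apply: hs.
have hw i : hom 0 {{ s c, {{ s a, Y i }} }}.
  exact: (hom_br11 oV (hs c) (hom_br12 oV (hs a) (hY i))).
have N3 : {{ s d, {{ s c, {{ s a, N }} }} }} =
    {{ s d, {{ s c, Y a }} }} - {{ s d, {{ s a, Y c }} }} + {{ s c, {{ s a, Y d }} }}.
  rewrite N2 brDr // brBr // br_sumr //; congr (_ + _).
  rewrite -(pick d (fun i => {{ s c, {{ s a, Y i }} }})); apply: eq_bigr => i _.
  by rewrite L // (adapted_br ad) (br10 oV (hs d) (hw i)) mulr0 subr0.
have fl (i j : 'I_r1) : {{ s i, Y j }} = - {{ Y j, s i }}.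
  by rewrite (br2skew oV (hY j) (hs i)) opprK.
rewrite [poisson _ (_ - N)]brBr // [poisson _ (_ - poisson _ N)]brBr //.
rewrite [poisson _ (_ - poisson _ (poisson _ N))]brBr // N3 !fl !brNr // /curv_form.
rewrite -!/(s _) -!/(Y _); zmod.
Qed.

End Adapted.

Lemma split_data : exists L D, splitting_data sg dQ L D.
Proof.
have [om [omE oml om12 om23]] := omega_exists.
have om_cycle x (u v w : Q x) : om x u v w = om x w u v by rewrite om23 om12 opprK.
have om_lin3 x a (u v w z : Q x) : om x w z (a *: u + v) = a *: om x w z u + om x w z v.
  by rewrite om_cycle oml -!(om_cycle _ w z).
have cvE x (u v : Q x) (X : tangent x) : exists phi : dual (Q x), forall w, phi w = om x u v w X.
  by apply: dual_of => a w z; rewrite om_lin3 addd scaled.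
pose cv x u v X := projT1 (cid (cvE x u v X)).
have cvP x u v X w : cv x u v X w = om x u v w X by exact: (projT2 (cid (cvE x u v X))).
pose L := SplitLie2 l rho dl ns om.
pose D := Dorfman dT Del nb cv.
exists L, D; split=> //.
- split=> /=.
  + exact (dl_local dlP rhoE).
  + exact (dl_bilinear dlP rhoE).
  + exact (dl_skew dlP).
  + exact (dl_leibniz dlP rhoE).
  + exact: ns_connection.
  + exact: oml.
  + exact: om12.
  + exact: om23.
  + move=> U q1 q2 q3 oU s1 s2 s3; have [w1 _] := om0P oU s1 s2 s3.
    by apply: (smooth_eq_on hTs oU w1) => x Ux; rewrite /omegas /= (omE U).
- move=> U r1 r2 q t b beta oU fq fb st sbeta tq betab.
  have ad : adapted U q t b beta by split.
  have sq := adapted_q_smooth ad; have sb := adapted_b_smooth ad.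
  split=> /=.
  + by move=> f sf; apply: (adapted_Q_function ad).
  + move=> k; rewrite (adapted_Q_deg1 ad k); congr (_ + _).
    have sp r : smooth_on U (pairing (t k) (app l (beta r))).
      by apply: pairing_smooth => //; apply: app_smooth.
    rewrite -(@i2_sum _ _ _ _ _ _ _ oU _ _ (fun r x => - pairing (t k) (app l (beta r)) x) b) //;
      last by move=> r; apply: smoothN.
    apply: i2_eq => //; first exact: app_smooth.
      by apply: (smooth_sum_sect hT) => // r; apply: (smooth_smul hT) => //; apply: smoothN.
    move=> x Ux; rewrite [LHS](adapted_decT ad _ Ux); apply: eq_bigr => r _.
    by rewrite /pairing /app lE opprK.
  + move=> m; rewrite (adapted_Q_deg2 ad m); congr (- _ - _).
    apply: eq_bigr => i _; apply: eq_bigr => j _; apply: eq_bigr => k _.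
    have [w1 _] := om0P oU (sq i) (sq j) (sq k).
    congr (_ * _); apply: emb_ext => //; first exact: pairing_smooth.
    by move=> x Ux; rewrite /pairing /omegas /= (omE U).
- split=> /=.
  + by move=> x c tau; rewrite lE opprK.
  + move=> U s s' t t' oU ss st es et; have [sD eD] := DelP oU ss st; split=> //.
    have ss' := smooth_eq_on hQ oU ss es; have st' := smooth_eq_on hQs oU st et.
    have [sD' eD'] := DelP oU ss' st'.
    apply: (i1_inj (sg := sg) oU) => //; rewrite eD eD'.
    have p := app_smooth psi oU ss; have p' := app_smooth psi oU ss'.
    have X := dT_smooth oU st; have X' := dT_smooth oU st'.
    have -> : i1 U (app psi s') = i1 U (app psi s).
      by apply: i1_eq => // x Ux; rewrite /app es.
    have -> : i1 U t' = i1 U t by apply: i1_eq => // x Ux; rewrite et.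
    have -> // : i2 U (app dT t') = i2 U (app dT t).
    by apply: i2_eq => // x Ux; rewrite /app et.
  + move=> U q1 q2 t oU s1 s2 st.
    have [sD eD] := DelP oU s1 st; have [sd ed] := dlP oU s1 s2.
    have p1 := app_smooth psi oU s1; have p2 := app_smooth psi oU s2.
    have k1 := pairing_smooth oU sD s2; have k2 := pairing_smooth oU st sd.
    have k3 := pairing_smooth oU st s2.
    have sl : smooth_on U (lie (app rho q1) (pairing t q2)).
      by apply: lie_smooth => //; apply: app_smooth.
    apply: (emb_inj (S := S) oU) => //; first exact: smoothB.
    have eP u : smooth U u -> emb U (pairing u q2) = {{ i1 U u, i1 U (app psi q2) }}.
      by move=> su; rewrite br11C ?dQP ?app_dQ_psi //; apply: i1_hom.
    rewrite eP // eD delta_pairing // embB // ed // (app_rho _ rhoE) -dTP //.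
    by rewrite eP.
  + exact: nb_connection.
  + by move=> U q c X oU sq sc sX x Ux; have [_ ->] := nsP oU sq sc.
  + by move=> x a u v w X; apply: dual_ext => z; rewrite addd scaled !cvP oml addd scaled.
  + by move=> x a u v X Y; apply: dual_ext => z; rewrite addd scaled !cvP dual_linear.
  + by move=> x u v X; apply: dual_ext => z; rewrite oppd !cvP om12 oppd.
  + by move=> x u v w X; rewrite cvP.
Qed.

End SplitData.

Lemma splitting_data_exists : exists L D, splitting_data sg dQ L D.
Proof.
have [rho rhoE] := bhom_comp psi dT; have [l lE] := l1_exists.
have [Del DelP] := Delta_exists; have [dl dlP] := dull_exists.
have [nb nbP] := nabla_exists; have [ns nsP] := dual_nabla_exists nbP rhoE.
have [om0 om0P] := curvature_exists nbP rhoE.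
exact: (split_data rhoE lE DelP dlP nbP nsP om0P).
Qed.

End Core.

(** * Independence of the splitting *)

Section Independence.
Variables (R : realType) (n : nat) (M : manifold R n) (S : symplectic_lie2 M).
Implicit Types (U V W : set M) (x : M).

Local Notation A := (fn S).
Local Notation emb := (emb S).
Local Notation "{{ a , b }}" := (poisson (s := S) a b).
Local Notation QQ := (homological (s := S)).

(** Degree 1 functions belong to [S] and not to a splitting, so inverting [i1 sg'] on the image of
    [i1 sg] compares the two dual bundles. *)
Lemma degree1_comparison (Q Q' : vbundle M) (sg : splitting S Q) (sg' : splitting S Q') :
  exists j : bhom (dual_bundle Q) (dual_bundle Q'),
    forall U t, open U -> smooth U t -> i1 sg' U (app j t) = i1 sg U t.
Proof.
have hQs := Qs_vbundle Q; have hQs' := Qs_vbundle Q'.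
have /choice[op opP'] : forall t : sect (dual_bundle Q),
    exists r : sect (dual_bundle Q'), forall U,
    open U /\ smooth U t -> smooth U r /\ i1 sg' U r = i1 sg U t.
  move=> t; apply: glue_deg1 => U [oU st]; split=> //; first exact: i1_hom.
  move=> V h oV; split; last by rewrite i1_res.
  split=> //; exact: (smooth_sub hQs oU oV h st).
have opP U t oU st := opP' t U (conj oU st).
have [j jE] : exists phi : bhom (dual_bundle Q) (dual_bundle Q'),
    forall U s, open U -> smooth U s -> eq_on U (app phi s) (op s).
  apply: (tensorial_bhom hQs hQs').
    move=> x U f s t r oU Ux sf ss st e.
    have sfs := smooth_smul hQs oU sf ss; have sc := smooth_sadd hQs oU sfs st.
    have sr : smooth U r by apply: (smooth_eq_on hQs oU sc) => y Uy; rewrite e.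
    have [k1 e1] := opP U s oU ss; have [k2 e2] := opP U t oU st.
    have [k3 e3] := opP U r oU sr.
    have m1 := smooth_smul hQs' oU sf k1.
    suff : eq_on U (op r) (sadd (smul f (op s)) (op t)) by apply.
    apply: (i1_inj (sg := sg') oU) => //; first exact: (smooth_sadd hQs').
    by rewrite e3 (i1_eq sg oU sr sc e) !i1D // !i1Z // e1 e2.
  by move=> U s oU ss; have [] := opP U s oU ss.
exists j => U t oU st; have [so <-] := opP U t oU st.
by apply: i1_eq => //; [exact: app_smooth|exact: jE].
Qed.

Section Comparison.
Variables (Q Q' : vbundle M) (sg : splitting S Q) (sg' : splitting S Q').
Variables (j : bhom (dual_bundle Q) (dual_bundle Q')).
Hypothesis jP : forall U t, open U -> smooth U t -> i1 sg' U (app j t) = i1 sg U t.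

Lemma comparison_cancel (j' : bhom (dual_bundle Q') (dual_bundle Q)) x :
  (forall U t, open U -> smooth U t -> i1 sg U (app j' t) = i1 sg' U t) ->
  cancel (j x) (j' x).
Proof.
move=> jP' v; have [U [t [oU Ux _ st <-]]] := local_section (Qs_vbundle Q) v openT I.
have sj := app_smooth j oU st.
have : eq_on U (app j' (app j t)) t.
  by apply: (i1_inj (sg := sg) oU) => //; [exact: app_smooth|rewrite jP' // jP].
exact.
Qed.

Lemma comparison_pairing (dQ : bhom (dual_bundle Q) Q) (dQ' : bhom (dual_bundle Q') Q')
    x (s t : dual (Q x)) : is_dQ sg dQ -> is_dQ sg' dQ' ->
  (j x s : dual (Q' x)) (dQ' x (j x t)) = s (dQ x t).
Proof.
move=> dP dP'; have hQs := Qs_vbundle Q.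
have [U [s1 [oU Ux _ ss <-]]] := local_section hQs (s : dual_bundle Q x) openT I.
have [V [t1 [oV Vx VU st <-]]] := local_section hQs (t : dual_bundle Q x) oU Ux.
have ssV := smooth_sub hQs oU oV VU ss.
have sj1 := app_smooth j oV ssV; have sj2 := app_smooth j oV st.
have := emb_inj (S := S) oV (dQ_pairing_smooth dQ' oV sj2 sj1) (dQ_pairing_smooth dQ oV st ssV).
apply=> //; by rewrite -dP // -dP' // !jP.
Qed.

Lemma comparison_anchor (dT : bhom (dual_bundle Q) (TM M)) (dT' : bhom (dual_bundle Q') (TM M)) x
    (s : dual (Q x)) :
  is_dTM sg dT -> is_dTM sg' dT' -> dT' x (j x s) = dT x s.
Proof.
move=> H H'; have [U [t [oU Ux _ st <-]]] := local_section (Qs_vbundle Q) (s : dual_bundle Q x) openT I.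
have sj := app_smooth j oU st.
suff : eq_on U (app dT' (app j t)) (app dT t) by apply.
apply: (anchor_unique (S := S)) => //; try exact: app_smooth.
move=> V f oV VU sf; have stV := smooth_sub (Qs_vbundle Q) oU oV VU st.
by rewrite -H // -H' ?jP //; apply: app_smooth.
Qed.

End Comparison.

Lemma courant_independent (Q Q' : vbundle M) (sg : splitting S Q) (sg' : splitting S Q')
    dQ L D (C : courant Q) dQ' L' D' (C' : courant Q') :
  splitting_data sg dQ L D -> courant_formulas sg dQ D C ->
  splitting_data sg' dQ' L' D' -> courant_formulas sg' dQ' D' C' ->
  exists phi : bhom Q Q', courant_iso phi C C' /\
    forall U (q : sect Q), open U -> smooth U q -> same_section sg sg' U q (app phi q).
Proof.
move=> data cf data' cf'.
have dP := data_dQ data; have dP' := data_dQ data'.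
have [psi [psiK dQK]] := dQ_inverse dP; have [psi' [psiK' dQK']] := dQ_inverse dP'.
have [dT dTP] := dTM_exists sg; have [dT' dTP'] := dTM_exists sg'.
have [j jP] := degree1_comparison sg sg'; have [j' jP'] := degree1_comparison sg' sg.
have jK x := comparison_cancel (x := x) jP jP'; have jK' x := comparison_cancel (x := x) jP' jP.
(* The isomorphism passes from $Q$ to its dual by [psi], compares the duals by [j], and returns to
   $Q'$ by [dQ']. *)
have [p1 p1E] := bhom_comp psi j; have [phi phiE'] := bhom_comp p1 dQ'.
have phiE x v : phi x v = dQ' x (j x (psi x v)) by rewrite phiE' p1E.
have [p2 p2E] := bhom_comp psi' j'; have [phi' phi'E'] := bhom_comp p2 dQ.
have phi'E x v : phi' x v = dQ x (j' x (psi' x v)) by rewrite phi'E' p2E.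
(* On degree 1 functions [phi] is the identity. Both brackets are the same derived bracket there, so
   [phi] preserves them. *)
have sphi U (q : sect Q) : open U -> smooth U q ->
    i1 sg' U (app psi' (app phi q)) = i1 sg U (app psi q).
  move=> oU sq; have sp := app_smooth psi oU sq; rewrite -(jP U) //.
  congr (i1 sg' U _); apply: functional_extensionality_dep => x.
  by rewrite /app phiE psiK'.
exists phi; split.
- split.
  + exists phi' => x; split=> v; rewrite phi'E phiE.
      by rewrite psiK' jK dQK.
    by rewrite psiK jK' dQK'.
  + move=> x u v; rewrite !phiE (formula_pair cf') (comparison_pairing jP _ _ dP dP').
    by rewrite -(formula_pair cf) !dQK.
  + move=> x u; rewrite phiE (formula_anchor cf') (data_dTM dTP' data').
    rewrite (comparison_anchor jP _ dTP dTP') -(data_dTM dTP data).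
    by rewrite -(formula_anchor cf) dQK.
  + move=> U s t oU ss st.
    have [sb eb] := courant_br dP psiK dQK dTP data cf oU ss st.
    have ps := app_smooth phi oU ss; have pt := app_smooth phi oU st.
    have [sb' eb'] := courant_br dP' psiK' dQK' dTP' data' cf' oU ps pt.
    apply: (Phi_inj (sg := sg') dQK' oU) => //; first exact: app_smooth.
    by rewrite eb' !sphi.
- move=> U q oU sq V t t' oV VU st st' e x Vx.
  have : eq_on V (app j t) t'.
    by apply: (i1_inj (sg := sg') oV) => //; [exact: app_smooth|rewrite jP].
  move=> /(_ x Vx) ej; rewrite /pairing -ej /app phiE (comparison_pairing jP _ _ dP dP').
  by rewrite dQK.
Qed.

End Independence.

Theorem theorem7p9 (R : realType) (n : nat) (M : manifold R n)
    (S : symplectic_lie2 M) :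
  (* in every splitting *)
  (forall (Q : vbundle M) (sg : splitting S Q),
     (exists dQ L D, splitting_data sg dQ L D) /\
     (forall dQ L D, splitting_data sg dQ L D ->
        [/\ is_biso dQ,
            exists C : courant Q, courant_formulas sg dQ D C
          & forall C : courant Q, courant_formulas sg dQ D C ->
              is_courant C /\ corresponds sg dQ C])) /\
  (* independence of the splitting *)
  (forall (Q Q' : vbundle M) (sg : splitting S Q) (sg' : splitting S Q')
      dQ L D (C : courant Q) dQ' L' D' (C' : courant Q'),
     splitting_data sg dQ L D -> courant_formulas sg dQ D C ->
     splitting_data sg' dQ' L' D' -> courant_formulas sg' dQ' D' C' ->
     exists phi : bhom Q Q',
       courant_iso phi C C' /\
       forall U (q : sect Q), open U -> smooth U q ->
         same_section sg sg' U q (app phi q)).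
Proof.
split; last by move=> *; apply: courant_independent; eassumption.
move=> Q sg; split.
  have [dQ dQP] := dQ_exists sg; have [psi [psiK dQK]] := dQ_inverse dQP.
  have [dT dTP] := dTM_exists sg; exists dQ; exact: (splitting_data_exists dQP psiK dQK dTP).
move=> dQ L D data; have dQP := data_dQ data.
have [psi [psiK dQK]] := dQ_inverse dQP; have [dT dTP] := dTM_exists sg.
split.
- exact: (dQ_biso dQP).
- exact: (courant_formulas_exist dQP psiK dQK dTP data).
- move=> C cf; split; first exact: (is_courant_formulas dQP psiK dQK dTP data cf).
  exact: (corresponds_formulas dQP psiK dQK dTP data cf).
Qed.
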